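(* Consider the class of equations $$u_t + A(t)\,u^n u_x + C(t)\,u^{2n}u_x + B(t)\,u_{xxx} + Q(t)\,u = 0,$$ where $n$ is a positive constant and $A(t)$, $B(t)\neq 0$, $C(t)\neq 0$, $Q(t)\neq 0$ are arbitrary smooth functions of $t$. The (continuous) equivalence group of this class consists of the transformations $$\tilde t = \alpha(t),\qquad \tilde x = (x+\epsilon_2)e^{\epsilon_1},\qquad \tilde u = e^{\epsilon_1-\epsilon_r r(t)}\,u,$$ $$\tilde A = \frac{e^{n\epsilon_r r(t)+(1-n)\epsilon_1}}{\alpha_t}A,\qquad \tilde B = \frac{e^{3\epsilon_1}}{\alpha_t}B,\qquad \tilde C = \frac{e^{2n\epsilon_r r(t)+(1-2n)\epsilon_1}}{\alpha_t}C,\qquad \tilde Q = \frac{Q+\epsilon_r r_t}{\alpha_t},\qquad \tilde n = n,$$ where $\epsilon_1,\epsilon_2,\epsilon_r$ are arbitrary constants and $\alpha=\alpha(t)$, $r=r(t)$ are arbitrary smooth functions with $\alpha_t\neq 0$.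
   Context: An equivalence transformation of the class is a nondegenerate point transformation from $(t,x,u)$ to $(\tilde t,\tilde x,\tilde u)$, acting in the augmented space $(t,x,u,A,B,C,Q,n)$, which maps every equation of the class to an equation of the same class, with possibly different arbitrary elements $\tilde A(\tilde t),\tilde B(\tilde t),\tilde C(\tilde t),\tilde Q(\tilde t),\tilde n$. The equivalence group is understood as the continuous one determined by Lie's infinitesimal criterion: one considers one-parameter groups of transformations of the augmented space with infinitesimal generator $$Y=\tau\partial_t+\xi\partial_x+\eta\partial_u+\omega^1\partial_A+\omega^2\partial_B+\omega^3\partial_C+\omega^4\partial_Q+\omega^5\partial_n,$$ where $\tau,\xi,\eta$ are functions of $(t,x,u)$ and the $\omega^i$ are functions of $(t,x,u,A,B,C,Q,n)$, and requires invariance of the equation of the class together with the auxiliary system $$A_x=A_u=B_x=B_u=C_x=C_u=Q_x=Q_u=n_t=n_x=n_u=0.$$ Subscripts denote derivatives, e.g. $\alpha_t=d\alpha/dt$, $r_t=dr/dt$. Powers of $u$ are understood where they are defined.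
   Formalization: Proved for u>0; the group generated by Lie's criterion is the listed set with α_t>0, and all α_t≠0 are obtained after adjoining the time reversal (t,A,B,C,Q)→−(t,A,B,C,Q); the transformed Q̃ is allowed to vanish, since Q+ε_r r_t can be zero. *)

(* Defs.v *)
From HB Require Import structures.
From mathcomp Require Import all_boot all_order all_algebra.
From mathcomp Require Import all_classical all_reals all_analysis.

Set Implicit Arguments.
Unset Strict Implicit.
Unset Printing Implicit Defensive.

Import Order.TTheory GRing.Theory Num.Theory.
Import numFieldNormedType.Exports.
Local Open Scope classical_set_scope.
Local Open Scope ring_scope.

Definition partial (R : realType) (k : nat) (i : 'I_k) (f : 'rV[R]_k -> R) :
  'rV[R]_k -> R := fun p => 'D_(delta_mx 0 i) f p.

(* C^m on an open set U *)
Fixpoint Cm_on (R : realType) (k m : nat) (U : set 'rV[R]_k)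
    (f : 'rV[R]_k -> R) : Prop :=
  (forall p, U p -> {for p, continuous f}) /\
  match m with
  | 0 => True
  | m'.+1 => forall i : 'I_k,
      (forall p, U p -> derivable f p (delta_mx 0 i)) /\
      Cm_on m' U (partial i f)
  end.

Definition smooth_on (R : realType) (k : nat) (U : set 'rV[R]_k)
    (f : 'rV[R]_k -> R) : Prop := forall m, Cm_on m U f.

Definition smooth1_on (R : realType) (I : set R) (f : R -> R) : Prop :=
  forall (m : nat) t, I t -> derivable (derive1n m f) t 1.

(* Coordinates (t, x, u) and (A, B, C, Q, n). *)
Definition it : 'I_3 := @Ordinal 3 0 isT.
Definition ix : 'I_3 := @Ordinal 3 1 isT.
Definition iu : 'I_3 := @Ordinal 3 2 isT.

Definition iA : 'I_5 := @Ordinal 5 0 isT.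
Definition iB : 'I_5 := @Ordinal 5 1 isT.
Definition iC : 'I_5 := @Ordinal 5 2 isT.
Definition iQ : 'I_5 := @Ordinal 5 3 isT.
Definition iN : 'I_5 := @Ordinal 5 4 isT.

Definition row3 (R : realType) (t x u : R) : 'rV[R]_3 :=
  \row_i tnth [tuple t; x; u] i.
Definition row5 (R : realType) (a b c q n : R) : 'rV[R]_5 :=
  \row_i tnth [tuple a; b; c; q; n] i.

(* A point of the augmented space (t, x, u, A, B, C, Q, n) is
   row_mx (t, x, u) (A, B, C, Q, n); lsubmx and rsubmx recover both parts.

   The values u > 0, n > 0 make all powers u^n and their derivatives in u and n
   meaningful.  The inequations B, C, Q != 0 are not part of the space: flows
   of equivalence generators may carry Q through 0. *)
Definition base_space (R : realType) : set 'rV[R]_3 := [set b | 0 < b 0 iu].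

Definition aug_space (R : realType) : set 'rV[R]_(3 + 5) :=
  [set p | 0 < lsubmx p 0 iu /\ 0 < rsubmx p 0 iN].

Definition aug_over (R : realType) (I : set R) : set 'rV[R]_(3 + 5) :=
  [set p | I (lsubmx p 0 it) /\ aug_space p].

(* Left-hand side of u_t + A u^n u_x + C u^(2n) u_x + B u_xxx + Q u = 0, with
   e = (A, B, C, Q, n). *)
Definition kdv (R : realType) (e : 'rV[R]_5) (u ut ux uxxx : R) : R :=
  ut + e 0 iA * u `^ e 0 iN * ux + e 0 iC * u `^ (2 * e 0 iN) * ux
  + e 0 iB * uxxx + e 0 iQ * u.

(* zeta = (tau, xi, eta), omega = (omega^1, ..., omega^5) *)
Record generator (R : realType) := Generator {
  zeta : 'I_3 -> 'rV[R]_3 -> R ;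
  omega : 'I_5 -> 'rV[R]_(3 + 5) -> R }.

Definition gen_field (R : realType) (Y : generator R) (p : 'rV[R]_(3 + 5)) :
  'rV[R]_(3 + 5) :=
  row_mx (\row_i zeta Y i (lsubmx p)) (\row_i omega Y i p).

(* A jet is row_mx (t, x, u) (u_t, u_x, u_tx, u_xx, u_txx, u_xxx). *)
Section Prolongation.
Variable R : realType.
Notation jet := 'rV[R]_(3 + 6).

Definition jt : 'I_6 := @Ordinal 6 0 isT.
Definition jx : 'I_6 := @Ordinal 6 1 isT.
Definition jtx : 'I_6 := @Ordinal 6 2 isT.
Definition jxx : 'I_6 := @Ordinal 6 3 isT.
Definition jtxx : 'I_6 := @Ordinal 6 4 isT.
Definition jxxx : 'I_6 := @Ordinal 6 5 isT.

Definition jbase (i : 'I_3) : 'I_(3 + 6) := lshift 6 i.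
Definition jder (j : 'I_6) : 'I_(3 + 6) := rshift 3 j.
Definition jcoord (j : 'I_6) (z : jet) : R := z 0 (jder j).

Definition on_jets (f : 'rV[R]_3 -> R) : jet -> R := fun z => f (lsubmx z).

(* Total derivatives; Dt is only applied to functions of (t, x, u), and Dx only
   to functions of (t, x, u, u_t, u_x, u_tx, u_xx). *)
Definition Dt (F : jet -> R) : jet -> R := fun z =>
  partial (jbase it) F z + jcoord jt z * partial (jbase iu) F z.

Definition Dx (F : jet -> R) : jet -> R := fun z =>
  partial (jbase ix) F z + jcoord jx z * partial (jbase iu) F z
  + jcoord jtx z * partial (jder jt) F z
  + jcoord jxx z * partial (jder jx) F z
  + jcoord jtxx z * partial (jder jtx) F z
  + jcoord jxxx z * partial (jder jxx) F z.

Variable Y : generator R.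
Let tau := on_jets (zeta Y it).
Let xi := on_jets (zeta Y ix).
Let eta := on_jets (zeta Y iu).

Definition eta_t : jet -> R := fun z =>
  Dt eta z - jcoord jt z * Dt tau z - jcoord jx z * Dt xi z.
Definition eta_x : jet -> R := fun z =>
  Dx eta z - jcoord jt z * Dx tau z - jcoord jx z * Dx xi z.
Definition eta_xx : jet -> R := fun z =>
  Dx eta_x z - jcoord jtx z * Dx tau z - jcoord jxx z * Dx xi z.
Definition eta_xxx : jet -> R := fun z =>
  Dx eta_xx z - jcoord jtxx z * Dx tau z - jcoord jxxx z * Dx xi z.

(* Prolonged generator applied to the left-hand side of the equation, that is,
   the derivative of kdv in the direction of the prolonged generator. *)
Definition pr_kdv (z : jet) (e : 'rV[R]_5) : R :=
  let p := row_mx (lsubmx z) e in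
  derive1 (fun h : R =>
    kdv (e + h *: \row_i omega Y i p)
        (z 0 (jbase iu) + h * eta z)
        (jcoord jt z + h * eta_t z)
        (jcoord jx z + h * eta_x z)
        (jcoord jxxx z + h * eta_xxx z)) 0.

(* Th i j is the derivative of the i-th arbitrary element, as a function of
   (t, x, u), with respect to the j-th variable; pr_element is the coefficient
   of the prolonged generator at the coordinate Th i j. *)
Definition pr_element (p : 'rV[R]_(3 + 5)) (Th : 'M[R]_(5, 3))
    (i : 'I_5) (j : 'I_3) : R :=
  partial (lshift 5 j) (omega Y i) p
  + \sum_(l < 5) Th l j * partial (rshift 3 l) (omega Y i) p
  - \sum_(k < 3) Th i k * partial j (zeta Y k) (lsubmx p).

End Prolongation.

(* The auxiliary system A_x = A_u = ... = Q_x = Q_u = n_t = n_x = n_u = 0. *)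
Definition auxiliary (i : 'I_5) (j : 'I_3) : bool := (i == iN) || (j != it).

Definition smooth_generator (R : realType) (Y : generator R) : Prop :=
  (forall i, smooth_on (@base_space R) (zeta Y i)) /\
  (forall i, smooth_on (@aug_space R) (omega Y i)).

(* Lie's infinitesimal criterion *)
Definition equivalence_generator (R : realType) (Y : generator R) : Prop :=
  smooth_generator Y /\
  forall (z : 'rV[R]_(3 + 6)) (e : 'rV[R]_5) (Th : 'M[R]_(5, 3)),
    aug_space (row_mx (lsubmx z) e) ->
    e 0 iB != 0 -> e 0 iC != 0 -> e 0 iQ != 0 ->
    kdv e (z 0 (jbase iu)) (jcoord jt z) (jcoord jx z) (jcoord jxxx z) = 0 ->
    (forall i j, auxiliary i j -> Th i j = 0) ->
    pr_kdv Y z e = 0 /\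
    (forall i j, auxiliary i j ->
       pr_element Y (row_mx (lsubmx z) e) Th i j = 0).

(* Time is the first coordinate of the argument of a flow. *)
Definition at_time (R : realType) (s : R) (p : 'rV[R]_(3 + 5)) :
  'rV[R]_(1 + (3 + 5)) := row_mx (const_mx s) p.

(* Phi is a smooth local flow of Y, defined at least on the points of E for all
   values of the group parameter between 0 and s; no completeness of Y is
   required. *)
Definition local_flow (R : realType) (Y : generator R)
    (E : set 'rV[R]_(3 + 5)) (s : R)
    (Phi : 'rV[R]_(1 + (3 + 5)) -> 'rV[R]_(3 + 5)) : Prop :=
  exists W : set 'rV[R]_(1 + (3 + 5)),
    [/\ open W,
        forall p c, E p -> 0 <= c <= 1 -> W (at_time (c * s) p),
        forall p, E p -> Phi (at_time 0 p) = p,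
        forall k, smooth_on W (fun w => Phi w 0 k)
      & forall w, W w -> aug_space (Phi w) /\
          forall k, partial ord0 (fun w' => Phi w' 0 k) w
                    = gen_field Y (Phi w) 0 k].

(* The continuous equivalence group, as a pseudogroup: T restricted to D is a
   composition of transformations from one-parameter groups whose generators
   satisfy the infinitesimal criterion (s < 0 gives the inverses). *)
Inductive continuous_equivalence (R : realType) (D : set 'rV[R]_(3 + 5)) :
    ('rV[R]_(3 + 5) -> 'rV[R]_(3 + 5)) -> Prop :=
| ce_id T : (forall p, D p -> T p = p) -> continuous_equivalence D T
| ce_flow T T' Y s Phi :
    continuous_equivalence D T ->
    equivalence_generator Y ->
    local_flow Y (T @` D) s Phi ->
    (forall p, D p -> T' p = Phi (at_time s (T p))) ->
    continuous_equivalence D T'.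

Record elements (R : realType) := Elements {
  elA : R -> R ; elB : R -> R ; elC : R -> R ; elQ : R -> R ; eln : R }.

Definition values (R : realType) (th : elements R) (t : R) : 'rV[R]_5 :=
  row5 (elA th t) (elB th t) (elC th t) (elQ th t) (eln th).

Definition open_interval (R : realType) (K : set R) : Prop :=
  open K /\ is_interval K.

(* Equations of the form under consideration on the interval K, Q being
   allowed to vanish. *)
Definition class_form (R : realType) (K : set R) (th : elements R) : Prop :=
  [/\ open_interval K,
      0 < eln th,
      [/\ smooth1_on K (elA th), smooth1_on K (elB th),
          smooth1_on K (elC th) & smooth1_on K (elQ th)]
    & forall t, K t -> elB th t != 0 /\ elC th t != 0].

Definition in_class (R : realType) (K : set R) (th : elements R) : Prop :=
  class_form K th /\ forall t, K t -> elQ th t != 0.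

(* Functions v of (t, x) are functions on row vectors of length 2. *)
Definition solves_at (R : realType) (th : elements R) (v : 'rV[R]_2 -> R)
    (z : 'rV[R]_2) : Prop :=
  let dt := partial (ord0 : 'I_2) in
  let dx := partial (ord_max : 'I_2) in
  kdv (values th (z 0 ord0)) (v z) (dt v z) (dx v z) (dx (dx (dx v)) z) = 0.

Definition graph_pt (R : realType) (v : 'rV[R]_2 -> R) (z : 'rV[R]_2) :
  'rV[R]_3 := row3 (z 0 ord0) (z 0 ord_max) (v z).

Definition smooth_positive (R : realType) (O : set 'rV[R]_2)
    (v : 'rV[R]_2 -> R) : Prop :=
  [/\ open O, smooth_on O v & forall z, O z -> 0 < v z].

(* P sends the graph of v over O into the graph of v' over O', matching the
   point of the graph over z with that over z'. *)
Definition maps_graph (R : realType) (P : 'rV[R]_3 -> 'rV[R]_3)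
    (O : set 'rV[R]_2) (v : 'rV[R]_2 -> R)
    (O' : set 'rV[R]_2) (v' : 'rV[R]_2 -> R) : Prop :=
  forall z, O z -> exists2 z', O' z' & P (graph_pt v z) = graph_pt v' z'.

Definition new_times (R : realType) (P : 'rV[R]_3 -> 'rV[R]_3) (K : set R) :
  set R :=
  [set t' | exists b : 'rV[R]_3, [/\ K (b 0 it), base_space b & t' = P b 0 it]].

(* T, restricted to times in I, is induced by a nondegenerate point
   transformation P of (t, x, u), and maps every equation of the class, over
   every subinterval K of I, to an equation of the same form, transforming the
   arbitrary elements accordingly and solutions into solutions.  The new Q is
   a value of the transformation on the augmented space; the image th' lies in
   the class exactly where this value is nonzero, hence class_form. *)
Definition equivalence_transformation (R : realType) (I : set R)
    (T : 'rV[R]_(3 + 5) -> 'rV[R]_(3 + 5)) : Prop :=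
  exists P : 'rV[R]_3 -> 'rV[R]_3,
    let dom : set 'rV[R]_3 := [set b : 'rV[R]_3 | I (b 0 it) /\ base_space b] in
    [/\ forall p, aug_over I p -> lsubmx (T p) = P (lsubmx p),
        (forall i, smooth_on dom (fun b => P b 0 i)),
        (forall b, dom b -> base_space (P b) /\ \det ('J P b) != 0),
        (forall b b', dom b -> dom b' -> P b = P b' -> b = b')
      & forall (K : set R) (th : elements R),
          K `<=` I -> in_class K th ->
          exists th' : elements R,
            [/\ class_form (new_times P K) th',
                forall b : 'rV[R]_3, K (b 0 it) -> base_space b ->
                  rsubmx (T (row_mx b (values th (b 0 it))))
                  = values th' (P b 0 it)
              & forall (O : set 'rV[R]_2) v (O' : set 'rV[R]_2) v',
                  smooth_positive O v -> smooth_positive O' v' ->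
                  (forall z, O z -> K (z 0 ord0)) ->
                  maps_graph P O v O' v' ->
                  forall z z', O z -> O' z' ->
                    P (graph_pt v z) = graph_pt v' z' ->
                    (solves_at th v z <-> solves_at th' v' z')]].

Definition listed (R : realType) (eps1 eps2 epsr : R) (alpha r : R -> R)
    (p : 'rV[R]_(3 + 5)) : 'rV[R]_(3 + 5) :=
  let t := lsubmx p 0 it in
  let x := lsubmx p 0 ix in
  let u := lsubmx p 0 iu in
  let A := rsubmx p 0 iA in
  let B := rsubmx p 0 iB in
  let C := rsubmx p 0 iC in
  let Q := rsubmx p 0 iQ in
  let n := rsubmx p 0 iN in
  let alpha_t := derive1 alpha t in
  let r_t := derive1 r t in
  row_mx
    (row3 (alpha t)
          ((x + eps2) * expR eps1)
          (expR (eps1 - epsr * r t) * u))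
    (row5 (expR (n * epsr * r t + (1 - n) * eps1) / alpha_t * A)
          (expR (3 * eps1) / alpha_t * B)
          (expR (2 * n * epsr * r t + (1 - 2 * n) * eps1) / alpha_t * C)
          ((Q + epsr * r_t) / alpha_t)
          n).

(* (t, x, u, A, B, C, Q, n) |-> (-t, x, u, -A, -B, -C, -Q, n) *)
Definition time_reversal (R : realType) :
    'rV[R]_(3 + 5) -> 'rV[R]_(3 + 5) :=
  listed 0 0 0 (fun t => - t) (fun _ => 0).

(* Main.v *)
(** Evaluating Lie's criterion at the jets with u_x, u_xx, u_xxx in {-1, 0, 1},
    and letting u run through powers that separate 1, u^n, u^(2n) and ln u, gives
    the determining equations: tau = tau(t), xi = c1 x + c2, eta = f(t) u, with
    omega induced.  Along the flow of such a generator put V = dt~/dt and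
    U = u~/u.  Since V' = tau_t(t~) V and U' = f(t~) U, the quantities
      B~ V e^(-3 c1 s),  A~ V U^n e^(-c1 s),  C~ V U^(2n) e^(-c1 s),  Q~ V + U_t/U
    do not depend on s, so every flow is a listed transformation.

    Conversely every increasing diffeomorphism between open intervals has to be
    composed of flows of vector fields that are smooth on the whole line.  The
    flow of 1/h' is t~ = h^-1(h(t) + s), so it suffices to solve
    h(g(t)) = h(t) + s with h' > 0 on R.  Taking h = exp moves the ends of an
    interval, which reduces everything to a diffeomorphism of (-oo, 0) onto
    (1, +oo); there the domain and the image are disjoint and h can be
    prescribed on (-oo, 0), subject to gluing at the two ends.  The function r is
    introduced after mapping I onto R, where it is smooth on the whole line. *)

Require Import Defs.
From HB Require Import structures.
From mathcomp Require Import all_boot all_order all_algebra.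
From mathcomp Require Import all_classical all_reals all_analysis.
From mathcomp Require Import ring lra.
Import Order.TTheory GRing.Theory Num.Theory.
Import numFieldNormedType.Exports.
Local Open Scope classical_set_scope.
Local Open Scope ring_scope.

Set Implicit Arguments.
Unset Strict Implicit.
Unset Printing Implicit Defensive.

(** * Smooth functions of one variable *)

(** To turn a flow into a listed transformation, t~ and u~ are never solved for. The flow is given
    as a smooth map, so its derivatives in the initial time satisfy the linearized equations as soon
    as mixed partials commute, and the invariants are checked by differentiation. V and U are read
    off at a reference point that depends on t alone, which rests on uniqueness for t' = tau(t). V
    cannot vanish, being a factor of the invariant of B, and it starts at 1. Hence flows keep the
    direction of time, and alpha_t < 0 is reached only with the time reversal.

    The criterion speaks only of points with B, C and Q nonzero, whereas a flow may pass through Q =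
    0; continuity of the coefficients extends the determining equations to the whole augmented
    space.

    In the converse direction the obstacle is that generators live on the whole line, while alpha
    and r are given on I and may blow up at its ends. *)

Section DirectionalDerivatives.
Variables (R : realType) (V : normedModType R).
Implicit Types (f g : V -> R) (p v : V).

(** Derivatives in a direction are derivatives along a line; through this reduction the one-variable
    chain rule and mean value theorem serve in every dimension. *)
Lemma is_derive_lineE f p v (c d : R) :
  is_derive (c *: v + p) v f d <-> is_derive c 1 (fun h => f (h *: v + p)) d.
Proof.
have E : (fun h : R => h^-1 *: ((f \o shift (c *: v + p)) (h *: v)
                          - f (c *: v + p))) =
   (fun h : R => h^-1 *: (((fun h => f (h *: v + p)) \o shift c) (h *: 1)
                          - f (c *: v + p))).
  by apply/funext => h /=; rewrite addrA -scalerDl /GRing.scale /= mulr1.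
split=> -[H1 H2]; split; move: H1 H2; rewrite /derivable /derive E //.
Qed.

Lemma is_derive_line f p v (d : R) :
  is_derive p v f d <-> is_derive (0 : R) 1 (fun h => f (h *: v + p)) d.
Proof. by rewrite -is_derive_lineE scale0r add0r. Qed.

Lemma is_deriveDf f g p v (a b : R) : is_derive p v f a -> is_derive p v g b ->
  is_derive p v (fun x => f x + g x) (a + b).
Proof. by move=> *; apply: is_deriveD. Qed.

Lemma is_deriveBf f g p v (a b : R) : is_derive p v f a -> is_derive p v g b ->
  is_derive p v (fun x => f x - g x) (a - b).
Proof. by move=> *; apply: is_deriveB. Qed.

Lemma is_deriveNf f p v (a : R) : is_derive p v f a ->
  is_derive p v (fun x => - f x) (- a).
Proof. by move=> *; apply: is_deriveN. Qed.

Lemma is_deriveMf f g p v (a b : R) : is_derive p v f a -> is_derive p v g b ->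
  is_derive p v (fun x => f x * g x) (a * g p + f p * b).
Proof.
move=> fa gb; have := @is_deriveM _ _ f g p v a b fa gb.
move/is_derive_eq; apply; by rewrite /GRing.scale /= addrC (mulrC a).
Qed.

Lemma is_deriveZf f p v (k a : R) : is_derive p v f a ->
  is_derive p v (fun x => k * f x) (k * a).
Proof. by move=> fa; apply: is_deriveZ. Qed.

Lemma is_derive_addr f p v (c a : R) : is_derive p v f a ->
  is_derive p v (fun x => f x + c) a.
Proof.
by move=> fa; have := is_deriveDf fa (is_derive_cst c p v); rewrite addr0.
Qed.

Lemma is_derive_compf f (g : R -> R) p v (a b : R) : is_derive p v f a ->
  is_derive (f p) 1 g b -> is_derive p v (fun x => g (f x)) (b * a).
Proof.
move=> /is_derive_line fa gb; apply/is_derive_line.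
apply: (@is_derive1_comp _ g (fun h => f (h *: v + p))) => //.
by rewrite scale0r add0r.
Qed.

Lemma is_deriveVf f p v (a : R) : f p != 0 -> is_derive p v f a ->
  is_derive p v (fun x => (f x)^-1) (- a / f p ^+ 2).
Proof.
move=> fp [fa <-]; split; first exact: derivableV.
by rewrite deriveV // /GRing.scale /= mulNr mulrC mulNr.
Qed.

Lemma is_derive_on (U : set V) f g p v (a : R) : open U -> U p ->
  (forall x, U x -> f x = g x) -> is_derive p v f a -> is_derive p v g a.
Proof.
move=> oU Up fg; apply: near_eq_is_derive; near=> x; apply: fg; near: x.
exact: open_nbhs_nbhs.
Unshelve. all: by end_near. Qed.

Lemma is_derive_expRf f p v (a : R) : is_derive p v f a ->
  is_derive p v (fun x => expR (f x)) (expR (f p) * a).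
Proof. by move=> fa; apply: is_derive_compf fa _; apply: is_derive_expR. Qed.

Lemma is_derive_lnf f p v (a : R) : 0 < f p -> is_derive p v f a ->
  is_derive p v (fun x => ln (f x)) (a / f p).
Proof.
move=> fp fa; rewrite mulrC; apply: is_derive_compf fa _.
exact: is_derive1_ln.
Qed.

End DirectionalDerivatives.

Section SmoothLine.
Variable R : realType.
Implicit Types (I J : set R) (f g h : R -> R) (t : R).

(** By induction on the order, each iterated derivative agrees on [I] with a member of [S] and is
    therefore differentiable again. Smoothness thus needs only a class closed under differentiation,
    and no formula for higher derivatives of products or compositions. *)
Lemma smooth1_coind I (S : (R -> R) -> Prop) : open I ->
  (forall f, S f -> exists2 g, S g & forall t, I t -> is_derive t 1 f (g t)) ->
  forall f, S f -> smooth1_on I f.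
Proof.
move=> oI H f Sf.
have K m : exists2 g, S g & forall t, I t -> derive1n m f t = g t.
  elim: m => [|m [g Sg fg]]; first by exists f.
  have [g' Sg' gg'] := H _ Sg; exists g' => // t It.
  rewrite derive1nS derive1E.
  have [] := is_derive_on oI It (fun x Ix => esym (fg x Ix)) (gg' t It).
  by [].
move=> m t It; have [g Sg fg] := K m; have [g' _ gg'] := H _ Sg.
by have [] := is_derive_on oI It (fun x Ix => esym (fg x Ix)) (gg' t It).
Qed.

Lemma smooth1_is_derive I f t : smooth1_on I f -> I t ->
  is_derive t 1 f (derive1 f t).
Proof. by move=> /(_ 0%N) sf It; rewrite derive1E; apply/derivableP/sf. Qed.

Lemma smoothT_is_derive f : smooth1_on setT f -> forall t,
  is_derive t 1 f (derive1 f t).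
Proof. by move=> sf t; exact: (@smooth1_is_derive setT). Qed.

Lemma smooth1_derive1 I f : smooth1_on I f -> smooth1_on I (derive1 f).
Proof. by move=> sf m; rewrite -derive1Sn; apply: (sf m.+1). Qed.

Lemma smooth1_derive1n I f m : smooth1_on I f -> smooth1_on I (derive1n m f).
Proof.
move=> sf; elim: m => [|m IH]; first exact: sf.
rewrite derive1nS; exact: (smooth1_derive1 IH).
Qed.

Lemma is_derive_scale (k t : R) : is_derive t 1 (fun x => k * x) k.
Proof. by have := is_deriveZf k (is_derive_id t (1 : R)); rewrite mulr1. Qed.

Lemma is_derive1E f t (a : R) : is_derive t 1 f a -> derive1 f t = a.
Proof. by move=> fa; rewrite derive1E derive_val. Qed.

Lemma derive1_zero t : derive1 (fun=> 0 : R) t = 0.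
Proof. by apply: is_derive1E; apply: is_derive_cst. Qed.

Lemma is_derive_cvg f t (a : R) : is_derive t 1 f a -> {for t, continuous f}.
Proof.
move=> fa; apply: differentiable_continuous; apply/derivable1_diffP.
exact: ex_derive.
Qed.

Lemma smooth1_sub I J f : I `<=` J -> smooth1_on J f -> smooth1_on I f.
Proof. by move=> IJ sf m t /IJ; apply: sf. Qed.

(** Iterated derivatives depend on germs only. This is what lets a function be glued from smooth
    pieces on overlapping open sets. *)
Lemma smooth1_local I f :
  (forall t, I t -> exists J g, [/\ open J, J t, smooth1_on J g
     & forall y, J y -> f y = g y]) -> smooth1_on I f.
Proof.
move=> H m t It; have [J [g [oJ Jt sg fg]]] := H t It.
have E k y : J y -> derive1n k f y = derive1n k g y.
  elim: k y => [|k IH] y Jy; first exact: fg.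
  rewrite !derive1nS; apply: is_derive1E.
  apply: (is_derive_on oJ Jy (fun x Jx => esym (IH x Jx))) _.
  exact: smooth1_is_derive (smooth1_derive1n sg) Jy.
have gd : is_derive t 1 (derive1n m g) ('D_1 (derive1n m g) t).
  exact/derivableP/sg.
by case: (is_derive_on oJ Jt (fun x Jx => esym (E m x Jx)) gd).
Qed.

Lemma smooth1_ext I f g : open I -> (forall t, I t -> f t = g t) ->
  smooth1_on I f -> smooth1_on I g.
Proof.
by move=> oI fg sf; apply: smooth1_local => t It; exists I, f; split=> // y /fg.
Qed.

(** The constructors are chosen so that the derivative of each function is again in the closure.
    [sc_ode] admits solutions of autonomous equations f' = g(f), whose derivative is a composition;
    it yields [expR], [ln] and all inverse functions. *)
Inductive smooth_closure I : (R -> R) -> Prop :=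
| sc_base f : smooth1_on I f -> smooth_closure I f
| sc_add f g : smooth_closure I f -> smooth_closure I g ->
    smooth_closure I (fun t => f t + g t)
| sc_mul f g : smooth_closure I f -> smooth_closure I g ->
    smooth_closure I (fun t => f t * g t)
| sc_inv f : smooth_closure I f -> (forall t, I t -> f t != 0) ->
    smooth_closure I (fun t => (f t)^-1)
| sc_comp J f g : smooth1_on J g -> smooth_closure I f ->
    (forall t, I t -> J (f t)) -> smooth_closure I (fun t => g (f t))
| sc_ode J f g : smooth1_on J g ->
    (forall t, I t -> J (f t) /\ is_derive t 1 f (g (f t))) ->
    smooth_closure I f.

Lemma smooth1_id I : smooth1_on I id.
Proof.
have : smooth1_on setT (@id R).
  apply: (@smooth1_coind _ (fun f => f = id \/ exists c, f = cst c)).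
  - exact: openT.
  - move=> f [->|[c ->]].
      exists (cst 1); first by right; exists 1.
      by move=> t _; apply: is_derive_id.
    exists (cst 0); first by right; exists 0.
    by move=> t _; apply: is_derive_cst.
  by left.
by apply: smooth1_sub.
Qed.

Lemma smooth1_cst I (c : R) : smooth1_on I (fun=> c).
Proof.
have : smooth1_on setT (fun=> c : R).
  apply: (@smooth1_coind _ (fun f => exists c, f = cst c)).
  - exact: openT.
  - move=> f [d ->]; exists (cst 0); first by exists 0.
    by move=> t _; apply: is_derive_cst.
  by exists c.
by apply: smooth1_sub.
Qed.

Lemma smooth_closure_smooth I f : open I -> smooth_closure I f -> smooth1_on I f.
Proof.
move=> oI; apply: smooth1_coind oI _ f => f; elim=> {f}.
- move=> f sf; exists (derive1 f); first exact/sc_base/smooth1_derive1.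
  by move=> t; apply: smooth1_is_derive.
- move=> f g _ [f' sf' ff'] _ [g' sg' gg'].
  exists (fun t => f' t + g' t); first exact: sc_add.
  by move=> t It; apply: is_deriveDf; [apply: ff'|apply: gg'].
- move=> f g sf [f' sf' ff'] sg [g' sg' gg'].
  exists (fun t => f' t * g t + f t * g' t).
    by apply: sc_add; apply: sc_mul.
  by move=> t It; apply: is_deriveMf; [apply: ff'|apply: gg'].
- move=> f sf [f' sf' ff'] fn0.
  exists (fun t => (- 1) * f' t * ((f t)^-1 * (f t)^-1)).
    apply: sc_mul; last by apply: sc_mul; apply: sc_inv.
    apply: (@sc_mul _ (fun=> -1)) => //; exact/sc_base/(@smooth1_cst I (-1)).
  move=> t It; apply: is_derive_eq.
    by apply: is_deriveVf; [apply: fn0|apply: ff'].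
  by rewrite mulN1r expr2 invfM.
- move=> J f g sg sf [f' sf' ff'] fJ; exists (fun t => derive1 g (f t) * f' t).
    by apply: sc_mul => //; apply: sc_comp (smooth1_derive1 sg) sf fJ.
  move=> t It; apply: is_derive_compf; first exact: ff'.
  by apply: smooth1_is_derive sg (fJ _ It).
- move=> J f g sg fg; exists (fun t => g (f t)); last by move=> t /fg[].
  by apply: (sc_comp sg) => [|t /fg[]//]; apply: sc_ode sg fg.
Qed.

Lemma smooth1D I f g : open I -> smooth1_on I f -> smooth1_on I g ->
  smooth1_on I (fun t => f t + g t).
Proof.
by move=> oI sf sg; apply: smooth_closure_smooth oI _; apply: sc_add; apply: sc_base.
Qed.

Lemma smooth1M I f g : open I -> smooth1_on I f -> smooth1_on I g ->
  smooth1_on I (fun t => f t * g t).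
Proof.
by move=> oI sf sg; apply: smooth_closure_smooth oI _; apply: sc_mul; apply: sc_base.
Qed.

Lemma smooth1Z I f c : open I -> smooth1_on I f -> smooth1_on I (fun t => c * f t).
Proof. by move=> oI sf; exact: (smooth1M oI (@smooth1_cst I c) sf). Qed.

Lemma smooth1N I f : open I -> smooth1_on I f -> smooth1_on I (fun t => - f t).
Proof.
move=> oI sf; have := @smooth1Z I f (-1) oI sf.
by congr smooth1_on; apply/funext => t; rewrite mulN1r.
Qed.

Lemma smooth1B I f g : open I -> smooth1_on I f -> smooth1_on I g ->
  smooth1_on I (fun t => f t - g t).
Proof. by move=> oI sf sg; exact: (smooth1D oI sf (smooth1N oI sg)). Qed.

Lemma smooth1V I f : open I -> smooth1_on I f -> (forall t, I t -> f t != 0) ->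
  smooth1_on I (fun t => (f t)^-1).
Proof.
by move=> oI sf fn0; exact: (smooth_closure_smooth oI (sc_inv (sc_base sf) fn0)).
Qed.

Lemma smooth1_comp I J f g : open I -> smooth1_on I f -> smooth1_on J g ->
  (forall t, I t -> J (f t)) -> smooth1_on I (fun t => g (f t)).
Proof.
move=> oI sf sg fJ.
exact: (smooth_closure_smooth oI (sc_comp sg (sc_base sf) fJ)).
Qed.

Lemma smooth1_expR I : smooth1_on I expR.
Proof.
have : smooth1_on setT (@expR R).
  apply: smooth_closure_smooth; first exact: openT.
  apply: (@sc_ode _ setT _ id); first exact: smooth1_id.
  by move=> t _; split => //; apply: is_derive_expR.
by apply: smooth1_sub.
Qed.

Lemma smooth1_ln : smooth1_on [set x : R | 0 < x] (@ln R).
Proof.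
apply: smooth_closure_smooth; first exact: open_gt.
(* The logarithm solves y' = exp(-y). *)
apply: (@sc_ode _ setT _ (fun y => expR (- y))).
  apply: (@smooth1_comp _ setT); [exact: openT| |exact: smooth1_expR|by []].
  by apply: smooth1N (openT) _; apply: smooth1_id.
move=> t t0; split => //; rewrite expRN lnK //; exact: is_derive1_ln.
Qed.

End SmoothLine.

(** * Mean values, images and inverses on intervals; uniqueness for autonomous equations *)

Section IntervalCalculus.
Variable R : realType.
Implicit Types (I J : set R) (f g df : R -> R) (t a b : R).

Lemma interval_between I a b t : is_interval I -> I a -> I b ->
  Num.min a b <= t <= Num.max a b -> I t.
Proof.
move=> iI Ia Ib; rewrite /Num.min /Num.max; case: ifP => _.
  exact: (iI a b Ia Ib).
exact: (iI b a Ib Ia).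
Qed.

Lemma is_interval_segment a b : is_interval [set t | a <= t <= b].
Proof.
by move=> x y /= /andP[? ?] /andP[? ?] z /andP[? ?]; apply/andP; split; lra.
Qed.

Lemma within_itv_continuous I f a b : is_interval I -> I a -> I b ->
  (forall t, I t -> {for t, continuous f}) -> {within `[a, b], continuous f}.
Proof.
move=> iI Ia Ib cf; apply: continuous_in_subspaceT => x.
rewrite inE /= in_itv /= => xab; apply: cf; exact: (iI a b).
Qed.

Lemma MVT_interval I f df a b : is_interval I -> I a -> I b ->
  (forall t, I t -> is_derive t 1 f (df t)) ->
  exists2 c, I c & f b - f a = df c * (b - a).
Proof.
move=> iI; wlog ab : a b / a <= b => [H|] Ia Ib fdf.
  have [/H|/ltW/H] := leP a b; first by apply.
  move=> /(_ Ib Ia fdf)[c Ic E]; exists c => //.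
  by apply/eqP; rewrite -opprB E -mulrN opprB.
have [||c cab E] := @MVT_segment R f df a b ab.
- move=> x; rewrite in_itv /= => /andP[ax xb]; apply: fdf.
  by apply: (iI a b) => //; rewrite !ltW.
- apply: (within_itv_continuous iI) => // t It.
  exact: is_derive_cvg (fdf t It).
exists c => //; apply: (iI a b) => //; by rewrite in_itv in cab.
Qed.

Lemma derive0_const I f : is_interval I ->
  (forall t, I t -> is_derive t 1 f 0) -> forall a b, I a -> I b -> f a = f b.
Proof.
move=> iI f0 a b Ia Ib.
have [c _ E] := @MVT_interval I f (fun=> 0) a b iI Ia Ib f0.
by apply/eqP; rewrite eq_sym -subr_eq0 E mul0r.
Qed.

Lemma IVT_interval I f a b v : is_interval I -> I a -> I b ->
  (forall t, I t -> {for t, continuous f}) ->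
  Num.min (f a) (f b) <= v <= Num.max (f a) (f b) ->
  exists2 c, I c & f c = v.
Proof.
move=> iI; wlog ab : a b / a <= b => [H|] Ia Ib cf fv.
  have [/H|/ltW/H] := leP a b; first by apply.
  by apply => //; rewrite minC maxC.
have [|c cab fc] := IVT ab _ fv; first exact: (within_itv_continuous iI).
by exists c => //; apply: (iI a b) => //; rewrite in_itv in cab.
Qed.

Lemma nonvanishing_sign I f : is_interval I ->
  (forall t, I t -> {for t, continuous f}) -> (forall t, I t -> f t != 0) ->
  forall a b, I a -> I b -> 0 < f a * f b.
Proof.
move=> iI cf f0 a b Ia Ib; rewrite ltNge; apply/negP => fab.
have [] := @IVT_interval I f a b 0 iI Ia Ib cf.
  move: fab; rewrite /Num.min /Num.max.
  have := f0 a Ia; have := f0 b Ib.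
  by case: ltgtP => [|a0 b0 |//] /=; case: ltP; nra.
by move=> c Ic fc; have := f0 c Ic; rewrite fc eqxx.
Qed.

Lemma derive_neq0_inj I f df : is_interval I ->
  (forall t, I t -> is_derive t 1 f (df t)) -> (forall t, I t -> df t != 0) ->
  forall a b, I a -> I b -> f a = f b -> a = b.
Proof.
move=> iI fdf df0 a b Ia Ib fab.
have [c Ic /eqP] := MVT_interval iI Ia Ib fdf.
rewrite fab subrr eq_sym mulf_eq0 (negbTE (df0 c Ic)) /= subr_eq0.
by move/eqP.
Qed.

Lemma derive_gt0_lt I f df : is_interval I ->
  (forall t, I t -> is_derive t 1 f (df t)) -> (forall t, I t -> 0 < df t) ->
  forall a b, I a -> I b -> a < b -> f a < f b.
Proof.
move=> iI fdf df0 a b Ia Ib ab; have [c Ic E] := MVT_interval iI Ia Ib fdf.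
by rewrite -subr_gt0 E mulr_gt0 ?df0 // subr_gt0.
Qed.

Lemma open_between I t : open I -> I t ->
  exists a b, [/\ I a, I b & a < t < b].
Proof.
rewrite openE => /(_ t) oI /oI /nbhs_ballP[e /= e0 eI].
exists (t - e / 2), (t + e / 2); split.
- by apply: eI; rewrite /ball /=; rewrite opprB addrC subrK gtr0_norm; lra.
- by apply: eI; rewrite /ball /=; rewrite opprD addNKr normrN gtr0_norm; lra.
- by apply/andP; split; lra.
Qed.

(** The derivative has constant sign, so points on the two sides of t have values on the two sides
    of f t; the intermediate value theorem then fills a neighbourhood of f t. *)
Lemma image_open_interval I f df : open_interval I ->
  (forall t, I t -> is_derive t 1 f (df t)) ->
  (forall t, I t -> {for t, continuous df}) ->
  (forall t, I t -> df t != 0) -> open_interval (f @` I).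
Proof.
move=> [oI iI] fdf cdf df0.
have cf t : I t -> {for t, continuous f} by move=> It; apply: is_derive_cvg (fdf t It).
split; last first.
  move=> _ _ [a Ia <-] [b Ib <-] v fv.
  have [|c Ic <-] := @IVT_interval I f a b v iI Ia Ib cf; last by exists c.
  case/andP: fv => av vb; apply/andP; split.
    by rewrite ge_min av.
  by rewrite le_max vb orbT.
rewrite openE => _ [t It <-].
have [a [b [Ia Ib /andP[at_ tb]]]] := open_between oI It.
have [c Ic E1] := MVT_interval iI Ia It fdf.
have [d Id E2] := MVT_interval iI It Ib fdf.
have S := nonvanishing_sign iI cdf df0 Ic Id.
have P : 0 < (f t - f a) * (f b - f t).
  by rewrite E1 E2 mulrACA mulr_gt0 // mulr_gt0 // subr_gt0.
have : (\forall v \near f t, Num.min (f a) (f b) < v) /\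
   (\forall v \near f t, v < Num.max (f a) (f b)).
  split.
    apply: lt_nbhsr; move: P; clear; rewrite /Num.min; case: (ltP (f a) (f b)); nra.
  apply: lt_nbhsl; move: P; clear; rewrite /Num.max; case: (ltP (f a) (f b)); nra.
move=> [N1 N2]; near=> v.
have [|e Ie <-] := @IVT_interval I f a b v iI Ia Ib cf; last by exists e.
apply/andP; split; apply: ltW; near: v; [exact: N1|exact: N2].
Unshelve. all: by end_near. Qed.

Lemma smooth1_continuous I f t : smooth1_on I f -> I t -> {for t, continuous f}.
Proof. by move=> sf It; apply: is_derive_cvg (smooth1_is_derive sf It). Qed.

Lemma smooth1_image I f : open_interval I -> smooth1_on I f ->
  (forall t, I t -> derive1 f t != 0) -> open_interval (f @` I).
Proof.
move=> oI sf f0; apply: (image_open_interval oI) f0 => t It.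
  exact: smooth1_is_derive sf It.
exact: smooth1_continuous (smooth1_derive1 sf) It.
Qed.

Lemma inverse_is_derive I f g t : open I -> smooth1_on I f ->
  (forall t, I t -> derive1 f t != 0) -> (forall t, I t -> g (f t) = t) ->
  I t -> is_derive (f t) 1 g (derive1 f t)^-1.
Proof.
move=> oI sf f0 gf It; apply: is_derive_inverse.
- by near=> x; apply: gf; near: x; exact: open_nbhs_nbhs.
- near=> x; apply: smooth1_continuous sf _; near: x; exact: open_nbhs_nbhs.
- exact: smooth1_is_derive sf It.
- exact: f0.
Unshelve. all: by end_near. Qed.

(** The inverse solves the autonomous equation g' = 1 / f'(g), so [sc_ode] gives all orders at
    once. *)
Lemma smooth1_inverse I f g : open_interval I -> smooth1_on I f ->
  (forall t, I t -> derive1 f t != 0) -> (forall t, I t -> g (f t) = t) ->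
  smooth1_on (f @` I) g.
Proof.
move=> [oI iI] sf f0 gf.
have [oJ _] := smooth1_image (conj oI iI) sf f0.
apply: (smooth_closure_smooth oJ).
apply: (@sc_ode _ _ I _ (fun t => (derive1 f t)^-1)).
  exact: (smooth1V oI (smooth1_derive1 sf) f0).
move=> _ [t It <-]; rewrite gf //; split=> //.
exact: (inverse_is_derive oI sf f0 gf It).
Qed.

(* Uniqueness for y' = F y: the squared distance of two solutions, damped by
   exp (-2 K t), does not increase. *)
Lemma ode_unique (F : R -> R) (y1 y2 : R -> R) (s : R) :
  smooth1_on setT F ->
  (forall c : R, 0 <= c <= 1 -> is_derive c 1 y1 (s * F (y1 c))) ->
  (forall c : R, 0 <= c <= 1 -> is_derive c 1 y2 (s * F (y2 c))) ->
  y1 0 = y2 0 -> forall c : R, 0 <= c <= 1 -> y1 c = y2 c.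
Proof.
move=> sF d1 d2 y0 c c01.
have I01 := @is_interval_segment 0 1.
have bound (y : R -> R) (dy : R -> R) :
    (forall c : R, 0 <= c <= 1 -> is_derive c 1 y (dy c)) ->
    exists M : R, forall c : R, 0 <= c <= 1 -> `|y c| <= M.
  move=> dY; have C : {within `[0, 1], continuous (fun t => `|y t|)}.
    apply: (within_itv_continuous I01) => //=; [lra|lra|].
    move=> t t01; apply: continuous_comp.
      exact: is_derive_cvg (dY t t01).
    exact: norm_continuous.
  have [m m01 mM] := EVT_max (ler01) C.
  by exists `|y m| => t t01; apply: mM; rewrite in_itv.
have [M1 HM1] := bound _ _ d1; have [M2 HM2] := bound _ _ d2.
pose M := Num.max M1 M2.
have IM : is_interval [set t : R | `|t| <= M].
  move=> x y /=; rewrite !ler_norml => /andP[Mx _] /andP[_ yM] z /andP[xz zy].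
  by rewrite ler_norml (le_trans Mx xz) (le_trans zy yM).
have M0 : 0 <= M.
  by apply: le_trans (normr_ge0 (y1 0)) _; rewrite le_max HM1 //; lra.
(* Both solutions stay in the compact interval [-M, M], and there [K] is a Lipschitz constant of
   [s * F]. *)
have [K HK] : exists K : R, forall t, `|t| <= M -> `|s * derive1 F t| <= K.
  have C : {within `[- M, M], continuous (fun t => `|s * derive1 F t|)}.
    apply: continuous_subspaceT => t; apply: cvg_norm.
    by apply: is_derive_cvg (is_deriveZf s (smooth1_is_derive (smooth1_derive1 sF) _)).
  have NM : - M <= M by lra.
  have [m _ mM] := EVT_max NM C.
  by exists `|s * derive1 F m| => t; rewrite ler_norml => tM; apply: mM; rewrite in_itv.
pose E t := (y1 t - y2 t) ^+ 2 * expR (- (2 * K) * t).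
have dE t : 0 <= t <= 1 -> is_derive t 1 E
   ((2 * (y1 t - y2 t) * (s * F (y1 t) - s * F (y2 t)) -
     2 * K * (y1 t - y2 t) ^+ 2) * expR (- (2 * K) * t)).
  move=> t01; rewrite /E; apply: is_derive_eq.
    apply: is_deriveMf.
    rewrite -[X in is_derive _ _ X]/(fun x => (y1 x - y2 x) * (y1 x - y2 x)).
    by apply: is_deriveMf; apply: is_deriveBf; [exact: d1|exact: d2|exact: d1|exact: d2].
  by rewrite /GRing.scale /=; ring.
have Z01 : 0 <= (0 : R) <= 1 by rewrite lexx ler01.
have [d d01] := MVT_interval I01 Z01 c01 dE.
have Ec0 : 0 <= E c by rewrite mulr_ge0 ?sqr_ge0 // expR_ge0.
have E0 : E 0 = 0 by rewrite /E y0 subrr expr0n /= mul0r.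
have M1d : `|y1 d| <= M by rewrite le_max HM1.
have M2d : `|y2 d| <= M by rewrite le_max HM2 // orbT.
have [e eM Ed] := @MVT_interval _ (fun t => s * F t) (fun t => s * derive1 F t) (y2 d) (y1 d) IM M2d M1d
   (fun t _ => is_deriveZf s (smoothT_is_derive sF t)).
have : (2 * (y1 d - y2 d) * (s * F (y1 d) - s * F (y2 d)) -
     2 * K * (y1 d - y2 d) ^+ 2) <= 0.
  rewrite Ed; have := HK _ eM; rewrite ler_norml => /andP[_ qK].
  have := mulr_ge0 (sqr_ge0 (y1 d - y2 d)) (_ : 0 <= K - s * derive1 F e).
  by rewrite subr_ge0 => /(_ qK); nra.
move=> H1 H2; have := expR_ge0 (- (2 * K) * d).
have : E c <= 0.
  rewrite -[E c]subr0 -{1}E0 H2 subr0; apply: mulr_le0_ge0.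
    exact: mulr_le0_ge0.
  by case/andP: c01.
move=> Ele _; have : E c = 0 by lra.
move/eqP; rewrite mulf_eq0 expR_eq0 orbF sqrf_eq0 subr_eq0.
by move/eqP.
Qed.

End IntervalCalculus.

(** * Smooth functions of several variables *)

Section SmoothSpace.
Variables (R : realType) (k : nat).
Implicit Types (U : set 'rV[R]_k) (f g : 'rV[R]_k -> R) (p v : 'rV[R]_k).
Implicit Types (i j : 'I_k) (m : nat).

Lemma is_derive_coord p v j : is_derive p v (fun x => x 0 j) (v 0 j).
Proof.
apply/is_derive_line.
have -> : (fun h : R => (h *: v + p) 0 j) = (fun h => v 0 j * h + p 0 j).
  by apply/funext => h; rewrite !mxE mulrC.
exact: (is_derive_addr (p 0 j) (is_derive_scale (v 0 j) 0)).
Qed.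

Lemma continuous_coord p j : {for p, continuous (fun x : 'rV[R]_k => x 0 j)}.
Proof. exact: coord_continuous. Qed.

Lemma continuous_near_eq f g p :
  (\forall x \near p, f x = g x) -> {for p, continuous f} -> {for p, continuous g}.
Proof.
move=> fg; have fgp : f p = g p := nbhs_singleton fg.
rewrite /prop_for /continuous_at fgp; apply: cvg_trans.
by apply: near_eq_cvg => //; apply: (nbhs_filter p).
Qed.

Lemma near_in_open (T : topologicalType) (A : set T) (x : T) : open A -> A x ->
  \forall y \near x, A y.
Proof. by move=> oA Ax; apply: open_nbhs_nbhs. Qed.

Lemma partialE U f p i (a : R) : is_derive p (delta_mx 0 i) f a ->
  partial i f p = a.
Proof. by move=> fa; rewrite /partial derive_val. Qed.

Lemma eq_partial U f g i p : open U -> U p -> (forall q, U q -> f q = g q) ->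
  partial i f p = partial i g p.
Proof.
move=> oU Up fg; apply: near_eq_derive.
by apply: filterS (near_in_open oU Up) => q /fg.
Qed.

Lemma Cm_on_ext m U f g : open U -> (forall p, U p -> f p = g p) ->
  Cm_on m U f -> Cm_on m U g.
Proof.
move=> oU; elim: m f g => [|m IH] f g fg /= [cf df].
  split=> // p Up; apply: continuous_near_eq (cf p Up).
  by apply: filterS (near_in_open oU Up) => x /fg.
split=> [p Up|i].
  apply: continuous_near_eq (cf p Up).
  by apply: filterS (near_in_open oU Up) => x /fg.
have [fd fc] := df i.
have E p : U p -> is_derive p (delta_mx 0 i) g (partial i f p).
  by move=> Up; apply: (is_derive_on oU Up fg); apply/derivableP/fd.
split=> [p /E[]//|]; apply: (IH (partial i f)) => // p Up.
by apply/esym/(partialE U)/E.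
Qed.

Lemma smooth_continuous U f p : smooth_on U f -> U p -> {for p, continuous f}.
Proof. by move=> /(_ 0%N)[cf _]; apply: cf. Qed.

Lemma smooth_partial U f i : smooth_on U f -> smooth_on U (partial i f).
Proof. by move=> sf m; have [_ /(_ i)[]] := sf m.+1. Qed.

Lemma smooth_is_derive U f p i : smooth_on U f -> U p ->
  is_derive p (delta_mx 0 i) f (partial i f p).
Proof. by move=> /(_ 1%N)[_ /(_ i)[fd _]] /fd /derivableP. Qed.

Lemma smooth_coind U (S : ('rV[R]_k -> R) -> Prop) : open U ->
  (forall f, S f -> (forall p, U p -> {for p, continuous f}) /\
    forall i, exists2 g, S g & forall p, U p -> is_derive p (delta_mx 0 i) f (g p)) ->
  forall f, S f -> smooth_on U f.
Proof.
move=> oU H f Sf m; elim: m f Sf => [|m IH] f Sf /=.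
  by have [] := H f Sf.
have [cf df] := H f Sf; split=> // i; have [g Sg fg] := df i.
split=> [p /fg[]//|]; apply: Cm_on_ext (IH g Sg) => // p Up.
by apply/esym/(partialE U)/fg.
Qed.

(** Same principle as in one variable, with closure under all partial derivatives. *)
Inductive smooth_space_closure U : ('rV[R]_k -> R) -> Prop :=
| ssc_base f : smooth_on U f -> smooth_space_closure U f
| ssc_add f g : smooth_space_closure U f -> smooth_space_closure U g ->
    smooth_space_closure U (fun p => f p + g p)
| ssc_mul f g : smooth_space_closure U f -> smooth_space_closure U g ->
    smooth_space_closure U (fun p => f p * g p)
| ssc_comp J f (g : R -> R) : smooth1_on J g -> smooth_space_closure U f ->
    (forall p, U p -> J (f p)) -> smooth_space_closure U (fun p => g (f p)).

Lemma smooth_cst U (c : R) : open U -> smooth_on U (fun=> c).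
Proof.
move=> oU; apply: (@smooth_coind U (fun f => exists c, f = cst c) oU); last by exists c.
move=> _ [d ->]; split=> [p _|i]; first by apply: cst_continuous.
by exists (cst 0); [exists 0|move=> p _; apply: is_derive_cst].
Qed.

Lemma smooth_coord U j : open U -> smooth_on U (fun p => p 0 j).
Proof.
move=> oU; apply: (@smooth_coind U (fun f => (exists c, f = cst c) \/ f = (fun p => p 0 j)) oU);
  last by right.
move=> _ [[d ->]|->]; split=> [p _|i].
- by apply: cst_continuous.
- by exists (cst 0); [left; exists 0|move=> p _; apply: is_derive_cst].
- exact: continuous_coord.
- exists (cst ((delta_mx 0 i : 'rV[R]_k) 0 j)); first by left; eexists.
  by move=> p _; apply: is_derive_coord.
Qed.

Lemma smooth_space_closure_smooth U f : open U -> smooth_space_closure U f ->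
  smooth_on U f.
Proof.
move=> oU; apply: (smooth_coind oU) => {}f; elim=> {f}.
- move=> f sf; split=> [p|i]; first exact: smooth_continuous sf.
  exists (partial i f); first exact/ssc_base/smooth_partial.
  by move=> p; apply: smooth_is_derive.
- move=> f g _ [cf df] _ [cg dg]; split=> [p Up|i].
    by apply: continuousD; [apply: cf|apply: cg].
  have [f' sf' ff'] := df i; have [g' sg' gg'] := dg i.
  exists (fun p => f' p + g' p); first exact: ssc_add.
  by move=> p Up; exact: (is_deriveDf (ff' p Up) (gg' p Up)).
- move=> f g sf [cf df] sg [cg dg]; split=> [p Up|i].
    by apply: continuousM; [apply: cf|apply: cg].
  have [f' sf' ff'] := df i; have [g' sg' gg'] := dg i.
  exists (fun p => f' p * g p + f p * g' p).
    exact: (ssc_add (ssc_mul sf' sg) (ssc_mul sf sg')).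
  by move=> p Up; exact: (is_deriveMf (ff' p Up) (gg' p Up)).
- move=> J f g sg sf [cf df] fJ; split=> [p Up|i].
    apply: (@continuous_comp _ _ _ f g p); first exact: cf.
    exact: (smooth1_continuous sg (fJ p Up)).
  have [f' sf' ff'] := df i.
  exists (fun p => derive1 g (f p) * f' p).
    exact: (ssc_mul (ssc_comp (smooth1_derive1 sg) sf fJ) sf').
  move=> p Up.
  exact: (is_derive_compf (ff' p Up) (smooth1_is_derive sg (fJ p Up))).
Qed.

Lemma smoothD U f g : open U -> smooth_on U f -> smooth_on U g ->
  smooth_on U (fun p => f p + g p).
Proof.
move=> oU sf sg.
exact: (smooth_space_closure_smooth oU (ssc_add (ssc_base sf) (ssc_base sg))).
Qed.

Lemma smoothM U f g : open U -> smooth_on U f -> smooth_on U g ->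
  smooth_on U (fun p => f p * g p).
Proof.
move=> oU sf sg.
exact: (smooth_space_closure_smooth oU (ssc_mul (ssc_base sf) (ssc_base sg))).
Qed.

Lemma smooth_comp1 U J f (g : R -> R) : open U -> smooth_on U f ->
  smooth1_on J g -> (forall p, U p -> J (f p)) ->
  smooth_on U (fun p => g (f p)).
Proof.
move=> oU sf sg fJ.
exact: (smooth_space_closure_smooth oU (ssc_comp sg (ssc_base sf) fJ)).
Qed.

Lemma smoothZ U f (c : R) : open U -> smooth_on U f -> smooth_on U (fun p => c * f p).
Proof. by move=> oU sf; exact: (smoothM oU (@smooth_cst U c oU) sf). Qed.

Lemma smoothN U f : open U -> smooth_on U f -> smooth_on U (fun p => - f p).
Proof.
move=> oU sf; have := @smoothZ U f (-1) oU sf.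
by congr smooth_on; apply/funext => t; rewrite mulN1r.
Qed.

Lemma smoothB U f g : open U -> smooth_on U f -> smooth_on U g ->
  smooth_on U (fun p => f p - g p).
Proof. by move=> oU sf sg; exact: (smoothD oU sf (smoothN oU sg)). Qed.

Lemma continuous_line v p : continuous (fun h : R => h *: v + p).
Proof.
by move=> h; apply: cvgD; [apply: cvgZr_tmp; apply: cvg_id|apply: cvg_cst].
Qed.

Lemma open_line U v p : open U -> open [set h : R | U (h *: v + p)].
Proof. by apply: open_comp => h _; apply: continuous_line. Qed.

Lemma line_is_derive U f i p (c : R) : smooth_on U f ->
  U (c *: delta_mx 0 i + p) ->
  is_derive c 1 (fun h => f (h *: delta_mx 0 i + p))
    (partial i f (c *: delta_mx 0 i + p)).
Proof.
move=> sf Uc; have H := @smooth_is_derive U f _ i sf Uc.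
exact: ((is_derive_lineE f p (delta_mx 0 i) c _).1 H).
Qed.

Lemma smooth_line U f i p : open U -> smooth_on U f ->
  smooth1_on [set h | U (h *: delta_mx 0 i + p)]
    (fun h => f (h *: delta_mx 0 i + p)).
Proof.
move=> oU sf.
pose S (g : R -> R) := exists2 F, smooth_on U F
   & g = fun h => F (h *: delta_mx 0 i + p).
have := @smooth1_coind R _ S (@open_line U (delta_mx 0 i) p oU).
apply; last by exists f.
move=> _ [F sF ->]; exists (fun h => partial i F (h *: delta_mx 0 i + p)).
  by exists (partial i F) => //; apply: smooth_partial.
by move=> c; apply: line_is_derive.
Qed.

Lemma near_box (A : set 'rV[R]_k) p v w : nbhs p A ->
  exists2 e : R, 0 < e & forall s t : R, 0 <= s <= e -> 0 <= t <= e ->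
    A (s *: v + (t *: w + p)).
Proof.
move=> /nbhs_ballP[r /= r0 rA]; pose N := `|v| + `|w| + 1.
have N0 : 0 < N by rewrite ltr_wpDl // addr_ge0.
exists (r / 2 / N); first by rewrite !divr_gt0.
move=> s t /andP[s0 se] /andP[t0 te]; apply: rA.
rewrite -ball_normE /= addrA opprD addrCA subrr addr0 normrN.
apply: le_lt_trans (ler_normD _ _) _; rewrite !normrZ !ger0_norm //.
apply: (@le_lt_trans _ _ (r / 2 / N * N)).
  have := normr_ge0 v; have := normr_ge0 w; rewrite /N.
  have := ler_wpM2r (normr_ge0 v) se; have := ler_wpM2r (normr_ge0 w) te.
  have : 0 <= r / 2 / N by rewrite !divr_ge0 // ltW.
  rewrite -/N; set q := r / 2 / N; rewrite /N; nra.
by rewrite divfK ?gt_eqF //; lra.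
Qed.

(** Mean value theorem twice: along direction i for the difference of [f] on two parallel segments,
    then along direction j for the i-th partial derivative. The second difference is symmetric in i
    and j, which [partialC] exploits. *)
Lemma second_difference U f i j p (e : R) : smooth_on U f -> 0 < e ->
  (forall s t : R, 0 <= s <= e -> 0 <= t <= e ->
    U (s *: delta_mx 0 i + (t *: delta_mx 0 j + p))) ->
  exists s t : R, [/\ 0 <= s <= e, 0 <= t <= e &
    f (e *: delta_mx 0 i + (e *: delta_mx 0 j + p))
    - f (e *: delta_mx 0 i + p) - f (e *: delta_mx 0 j + p) + f p
    = partial j (partial i f) (s *: delta_mx 0 i + (t *: delta_mx 0 j + p)) * e ^+ 2].
Proof.
move=> sf e0 Ubox.
have I0e := @is_interval_segment R 0 e.
have in0 : 0 <= (0 : R) <= e by rewrite lexx ltW.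
have ine : 0 <= e <= e by rewrite lexx ltW.
have Ub s : 0 <= s <= e -> U (s *: delta_mx 0 i + p).
  by move=> se; have := Ubox s 0 se in0; rewrite scale0r add0r.
pose G g (s : R) : R :=
  g (s *: delta_mx 0 i + (e *: delta_mx 0 j + p)) - g (s *: delta_mx 0 i + p).
have [s se E1] := @MVT_interval R _ (G f) (G (partial i f)) 0 e I0e in0 ine
  (fun s se => is_deriveBf (line_is_derive sf (Ubox s e se ine)) (line_is_derive sf (Ub s se))).
have swap x y : x *: delta_mx 0 i + (y *: delta_mx 0 j + p) =
  y *: delta_mx 0 j + (x *: delta_mx 0 i + p) :> 'rV[R]_k by rewrite addrCA.
have D t : 0 <= t <= e -> is_derive t 1
   (fun t => partial i f (t *: delta_mx 0 j + (s *: delta_mx 0 i + p)))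
   (partial j (partial i f) (t *: delta_mx 0 j + (s *: delta_mx 0 i + p))).
  move=> te; apply: (line_is_derive (smooth_partial i sf)).
  by rewrite -swap; apply: Ubox.
have [t te E2] := MVT_interval I0e in0 ine D.
exists s, t; split=> //; move: E1 E2; rewrite /G.
rewrite -!swap !scale0r !add0r !subr0 => E1 E2.
by rewrite expr2 mulrA -E2 -E1; ring.
Qed.

(** Schwarz's theorem. If the mixed derivatives differed by d at [p], each would stay within d/2 of
    its value at [p] on a small box, whereas the common second difference makes them equal at two
    points of that box. *)
Lemma partialC U f i j p : open U -> smooth_on U f -> U p ->
  partial i (partial j f) p = partial j (partial i f) p.
Proof.
move=> oU sf Up; apply/eqP; rewrite -subr_eq0; apply/negPn/negP => d0.
pose d := `|partial i (partial j f) p - partial j (partial i f) p|.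
have dp : 0 < d / 2 by rewrite divr_gt0 // normr_gt0.
have near_val i1 j1 : \forall q \near p,
    `|partial i1 (partial j1 f) p - partial i1 (partial j1 f) q| < d / 2.
  have : {for p, continuous (partial i1 (partial j1 f))}.
    exact: (smooth_continuous (smooth_partial i1 (smooth_partial j1 sf)) Up).
  by move/cvgrPdist_lt => /(_ _ dp).
have : nbhs p [set q | [/\ U q,
    `|partial i (partial j f) p - partial i (partial j f) q| < d / 2 &
    `|partial j (partial i f) p - partial j (partial i f) q| < d / 2]].
  apply: filterS (filterI (near_in_open oU Up) (filterI (near_val i j) (near_val j i))).
  by move=> q [Uq [Hq1 Hq2]]; split.
move=> /(near_box (delta_mx 0 i) (delta_mx 0 j))[e e0 box].
have swap x y : x *: delta_mx 0 i + (y *: delta_mx 0 j + p) =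
  y *: delta_mx 0 j + (x *: delta_mx 0 i + p) :> 'rV[R]_k by rewrite addrCA.
have [|s [t [se te E1]]] := @second_difference U f i j p e sf e0.
  by move=> s t se te; have [] := box s t se te.
have [|t' [s' [te' se' E2]]] := @second_difference U f j i p e sf e0.
  by move=> t' s' te' se'; have [] := box s' t' se' te'; rewrite swap.
have [_ _ B1] := box s t se te; have [_ B2 _] := box s' t' se' te'.
have : partial j (partial i f) (s *: delta_mx 0 i + (t *: delta_mx 0 j + p)) =
       partial i (partial j f) (s' *: delta_mx 0 i + (t' *: delta_mx 0 j + p)).
  have e20 : e ^+ 2 != 0 by rewrite expf_neq0 // gt_eqF.
  apply: (mulIf e20); apply: (etrans (esym E1)).
  rewrite (swap s' t'); apply: (etrans _ E2).
  by rewrite (swap e e); congr (_ + _); rewrite addrAC.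
move=> E; move: B1; rewrite E => B1.
have tri (a b c r : R) : `|a - c| < r -> `|b - c| < r -> `|a - b| < r + r.
  move=> ac bc; rewrite -(subrKA c); apply: le_lt_trans (ler_normD _ _) _.
  by rewrite (distrC c); apply: ltrD.
have : d < d / 2 + d / 2 by exact: (tri _ _ _ _ B2 B1).
by rewrite -splitr ltxx.
Qed.

End SmoothSpace.

(** * Diffeomorphisms of intervals as compositions of flows *)

Section TimeFlows.
Variable R : realType.
Implicit Types (I J K : set R) (f g h k : R -> R) (t s : R).

(** A step composes with the time-s flow of the field 1 / h'. The relation is written without the
    inverse of [h], which need not be onto: that [g] exists says that the flow is defined up to the
    parameter [s]. *)
Inductive tflows I : (R -> R) -> Prop :=
| tf_id f : (forall t, I t -> f t = t) -> tflows I f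
| tf_step f g h s : tflows I f -> smooth1_on setT h ->
    (forall t, 0 < derive1 h t) -> (forall t, I t -> h (g t) = h (f t) + s) ->
    tflows I g.

Lemma tflows_ext I f g : (forall t, I t -> f t = g t) -> tflows I f -> tflows I g.
Proof.
move=> fg ff; case: ff fg => [{}f fE|f0 {}f h s f0f sh h0 E] fg.
  by apply: tf_id => t It; rewrite -fg // fE.
by apply: (tf_step f0f sh h0 (s := s)) => t It; rewrite -fg // E.
Qed.

Lemma tflows_sub I J f : I `<=` J -> tflows J f -> tflows I f.
Proof.
move=> IJ; elim=> {f} [f fE|f g h s _ IH sh h0 E].
  by apply: tf_id => t /IJ; apply: fE.
by apply: (tf_step IH sh h0 (s := s)) => t /IJ; apply: E.
Qed.

Lemma tflows_comp I f g : tflows I f -> tflows (f @` I) g -> tflows I (g \o f).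
Proof.
move=> If; elim=> {g} [g gE|g0 g h s _ IH sh h0 E].
  by apply: tflows_ext If => t It /=; rewrite gE //; exists t.
by apply: (tf_step IH sh h0 (s := s)) => t It /=; apply: E; exists t.
Qed.

Lemma is_intervalT : is_interval (@setT R).
Proof. by []. Qed.

Lemma increasing_inverse h : smooth1_on setT h -> (forall t, 0 < derive1 h t) ->
  exists2 k, (forall t, k (h t) = t) & smooth1_on (range h) k.
Proof.
move=> sh h0; have hn0 t : setT t -> derive1 h t != 0 by rewrite gt_eqF.
have dh t : setT t -> is_derive t 1 h (derive1 h t) by apply: (smooth1_is_derive sh).
pose k y := xget 0 [set t | h t = y].
have kh t : k (h t) = t.
  rewrite /k; case: xgetP => [x _ /= hx|/(_ t) /=]; last by case.
  exact: (derive_neq0_inj is_intervalT dh hn0).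
exists k => //; apply: smooth1_inverse sh hn0 _ => //.
by split; [exact: openT|exact: is_intervalT].
Qed.

(** With k the inverse of [h], a step is g t = k (h (f t) + s), which gives smoothness;
    differentiating the defining relation gives the sign. *)
Lemma tflows_smooth I f : open I -> tflows I f ->
  smooth1_on I f /\ forall t, I t -> 0 < derive1 f t.
Proof.
move=> oI; elim=> {f} [f fE|f g h s _ [sf f0] sh h0 E].
  have sf : smooth1_on I f.
    by apply: (@smooth1_ext _ I id f oI _ (@smooth1_id R I)) => t It; rewrite fE.
  split=> // t It; have D : is_derive t 1 f 1.
    by apply: (is_derive_on oI It _ (is_derive_id t 1)) => x Ix; rewrite fE.
  by rewrite (is_derive1E D).
have [k kh sk] := increasing_inverse sh h0.
have shf : smooth1_on I (fun t => h (f t)).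
  exact: (smooth1_comp oI sf sh (fun _ _ => Logic.I)).
have sg : smooth1_on I g.
  apply: (@smooth1_ext R I (fun t => k (h (f t) + s)) g oI).
    by move=> t It; rewrite -E // kh.
  apply: (smooth1_comp oI _ sk).
    exact: (smooth1D oI shf (@smooth1_cst _ I s)).
  by move=> t It; exists (g t) => //; rewrite E.
split=> // t It.
have dg := smooth1_is_derive sg It; have df := smooth1_is_derive sf It.
have dh (y : R) : is_derive y 1 h (derive1 h y) by apply: (smooth1_is_derive sh).
have d1 := is_derive_compf dg (dh (g t)).
have d2 := is_derive_addr s (is_derive_compf df (dh (f t))).
have := is_derive1E (is_derive_on oI It (fun x Ix => esym (E x Ix)) d2).
rewrite (is_derive1E d1) => H.
by rewrite -(pmulr_rgt0 _ (h0 (g t))) H mulr_gt0 // f0.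
Qed.

(** The inverse is also required to be a composition of flows, so that the relation is symmetric and
    intervals can be compared through the whole line. *)
Definition tequiv I J := exists f k, [/\ tflows I f, tflows J k,
  forall t, I t -> J (f t) /\ k (f t) = t & forall y, J y -> I (k y) /\ f (k y) = y].

Lemma tequiv_refl I : tequiv I I.
Proof. by exists id, id; split=> //; apply: tf_id. Qed.

Lemma tequiv_sym I J : tequiv I J -> tequiv J I.
Proof. by move=> [f [k [? ? ? ?]]]; exists k, f. Qed.

Lemma tequiv_trans I J K : tequiv I J -> tequiv J K -> tequiv I K.
Proof.
move=> [f [k [If Jk fk kf]]] [f' [k' [Jf Kk fk' kf']]].
exists (f' \o f), (k \o k'); split.
- apply: tflows_comp If (tflows_sub _ Jf) => _ [t It <-]; by have [] := fk t It.
- apply: tflows_comp Kk (tflows_sub _ Jk) => _ [t Kt <-]; by have [] := kf' t Kt.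
- move=> t It /=; have [Jft kft] := fk t It; have [Kt kt] := fk' _ Jft.
  by rewrite kt.
- move=> y Ky /=; have [Jy ky] := kf' y Ky; have [It ft] := kf _ Jy.
  by rewrite ft.
Qed.

Lemma tequiv_step I J f k h s : smooth1_on setT h -> (forall t, 0 < derive1 h t) ->
  (forall t, I t -> J (f t) /\ k (f t) = t) ->
  (forall y, J y -> I (k y) /\ f (k y) = y) ->
  (forall t, I t -> h (f t) = h t + s) -> tequiv I J.
Proof.
move=> sh h0 fk kf E; exists f, k; split=> //.
  by apply: (@tf_step _ id _ h s) => //; apply: tf_id.
apply: (@tf_step _ id _ h (- s)) => //; first exact: tf_id.
by move=> y Jy; have [Iy <-] := kf y Jy; rewrite (kf y Jy).2 -{2}(kf y Jy).2 E // addrK.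
Qed.

Definition down_closed I := forall x y : R, I y -> x <= y -> I x.

Lemma tequiv_down_closed I : open_interval I -> I !=set0 ->
  exists J, [/\ open J, J !=set0, down_closed J & tequiv I J].
Proof.
move=> [oI iI] [t0 It0].
have [lI|nlI] := pselect (has_lbound I); last first.
  exists I; split=> //; [by exists t0| |exact: tequiv_refl].
  move=> x y Iy xy; apply: contrapT => nIx; apply: nlI; exists x => z Iz.
  rewrite leNgt; apply/negP => zx; apply: nIx; apply: (iI z y) => //.
  by rewrite xy ltW.
have I0 : has_inf I by split=> //; exists t0.
set p := inf I.
have pI t : I t -> p < t.
  move=> It; have [a [_ [Ia _ /andP[at_ _]]]] := open_between oI It.
  exact: le_lt_trans (ge_inf lI Ia) at_.
have eI t : I t -> 0 < expR t - expR p by move=> It; rewrite subr_gt0 ltr_expR pI.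
have pos y : 0 < expR y + expR p by rewrite addr_gt0 // expR_gt0.
(* In the coordinate exp, the translation by - exp p sends the lower end [p] to -oo. *)
pose k y := ln (expR y + expR p); pose f t := ln (expR t - expR p).
have fk t : I t -> k (f t) = t.
  by move=> It; rewrite /k /f lnK ?subrK ?expRK // posrE eI.
have kf y : f (k y) = y.
  by rewrite /k /f lnK ?addrK ?expRK // posrE.
have sk : smooth1_on setT k.
  apply: (smooth1_comp openT _ (@smooth1_ln R)) => [|t _]; last exact: pos.
  exact: (smooth1D openT (@smooth1_expR R setT) (@smooth1_cst R setT (expR p))).
have ek y : expR (k y) = expR y + expR p by rewrite lnK // posrE.
have ck : continuous k by move=> y; apply: (smooth1_continuous sk).
exists [set y | I (k y)]; split.
- by apply: open_comp => // y _; apply: ck.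
- by exists (f t0); rewrite /= fk.
- move=> x y /= Iy xy.
  have : p < k x by rewrite -ltr_expR ek ltrDr expR_gt0.
  move=> /(inf_lt I0.1)[a Ia akx]; apply: (iI a (k y)) => //.
  by rewrite ltW //= -ler_expR !ek lerD2r ler_expR.
- apply: (@tequiv_step _ _ f k expR (- expR p)).
  + exact: smooth1_expR.
  + move=> t; rewrite (is_derive1E (is_derive_expR t)); exact: expR_gt0.
  + by move=> t It /=; rewrite fk.
  + by move=> y Iy; rewrite kf.
  + by move=> t It; rewrite /f lnK // posrE eI.
Qed.

Lemma tequiv_down_closed_setT J : open J -> J !=set0 -> down_closed J ->
  tequiv J setT.
Proof.
move=> oJ [t0 Jt0] dJ.
have [uJ|nuJ] := pselect (has_ubound J); last first.
  suff -> : J = setT by exact: tequiv_refl.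
  apply/seteqP; split=> // x _; apply: contrapT => nJx; apply: nuJ.
  exists x => z Jz; rewrite leNgt; apply/negP => xz; apply: nJx.
  by apply: (dJ x z) => //; apply: ltW.
have J0 : has_sup J by split=> //; exists t0.
set q := sup J.
have Jq t : J t -> t < q.
  move=> Jt; have [_ [b [_ Jb /andP[_ tb]]]] := open_between oJ Jt.
  exact: lt_le_trans tb (ub_le_sup uJ Jb).
have eJ t : J t -> 0 < expR (- t) - expR (- q).
  by move=> Jt; rewrite subr_gt0 ltr_expR ltrN2 Jq.
have pos y : 0 < expR (- y) + expR (- q) by rewrite addr_gt0 // expR_gt0.
(* At the upper end the coordinate is - exp(-t), which tends to 0 at +oo; the translation by exp(-q)
   sends [q] there. *)
pose k y := - ln (expR (- y) + expR (- q)).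
pose f t := - ln (expR (- t) - expR (- q)).
have kf y : f (k y) = y.
  by rewrite /k /f opprK lnK ?addrK ?expRK ?opprK // posrE.
have dh t : is_derive t 1 (fun t => - expR (- t)) (expR (- t)).
  have := is_deriveNf (is_derive_expRf (is_deriveNf (is_derive_id t (1 : R)))).
  by move/is_derive_eq; apply; rewrite mulrN1 opprK.
apply: (@tequiv_step _ _ f k (fun t => - expR (- t)) (expR (- q))).
- apply: (smooth1N openT).
  apply: (smooth1_comp openT _ (@smooth1_expR R setT)) => //.
  exact: (smooth1N openT (@smooth1_id R setT)).
- by move=> t; rewrite (is_derive1E (dh t)) expR_gt0.
- move=> t Jt; split=> //.
  by rewrite /k /f opprK lnK ?subrK ?expRK ?opprK // posrE eJ.
- move=> y _; split => //.
  have : k y < q.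
    rewrite ltrNl -ltr_expR lnK ?posrE // ltrDr; exact: expR_gt0.
  by move=> /(sup_gt J0.1)[a Ja kya]; apply: (dJ _ a) => //; apply: ltW.
- move=> t Jt; rewrite /f opprK lnK ?posrE ?eJ //; ring.
Qed.

Lemma tequiv_setT I : open_interval I -> I !=set0 -> tequiv I setT.
Proof.
move=> oI I0; have [J [oJ J0 dJ IJ]] := tequiv_down_closed oI I0.
exact: (tequiv_trans IJ (tequiv_down_closed_setT oJ J0 dJ)).
Qed.

End TimeFlows.

(** * A smooth cutoff function *)

Section Cutoff.
Variable R : realType.
Implicit Types (t x : R) (n : nat).

(** The powers of 1/t are included because the span of the whole family is closed under
    differentiation, as [smooth1_coind] requires. *)
Definition flat n t : R := if 0 < t then t^-1 ^+ n * expR (- t^-1) else 0.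

Lemma flat_ge0 n t : 0 <= flat n t.
Proof.
rewrite /flat; case: ifP => // t0.
by rewrite mulr_ge0 ?expR_ge0 // exprn_ge0 // invr_ge0 ltW.
Qed.

Lemma flat_gt0 n t : 0 < t -> 0 < flat n t.
Proof. by move=> t0; rewrite /flat t0 mulr_gt0 ?expR_gt0 // exprn_gt0 // invr_gt0. Qed.

Lemma flat_le0 n t : t <= 0 -> flat n t = 0.
Proof. by rewrite /flat ltNge => ->. Qed.

(** For x = 1/t a single Taylor term gives x^(n+2) <= (n+2)! exp x. The two spare powers make the
    bound quadratic in t, which forces derivative 0 at the origin. *)
Lemma flat_bound n t : `|flat n t| <= (n.+2)`!%:R * t ^+ 2.
Proof.
rewrite ger0_norm ?flat_ge0 // /flat; case: ifP => t0; last first.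
  by rewrite mulr_ge0 // sqr_ge0.
have x0 : 0 <= t^-1 by rewrite invr_ge0 ltW.
have := @expR_ge1Dxn R _ n.+1 x0; set F := _`!%:R => H.
have F0 : 0 < F by rewrite ltr0n fact_gt0.
have H2 : t^-1 ^+ n.+2 <= F * expR t^-1.
  rewrite mulrC -ler_pdivrMr //; apply: le_trans H; by rewrite lerDr.
rewrite expRN ler_pdivrMr ?expR_gt0 // mulrAC.
have -> : t^-1 ^+ n = t^-1 ^+ n.+2 * t ^+ 2.
  rewrite -addn2 exprD -mulrA -exprMn mulVf ?gt_eqF // expr1n mulr1 //.
by rewrite ler_wpM2r // sqr_ge0.
Qed.

Lemma quadratic_is_derive0 (f : R -> R) (C : R) :
  (forall t, `|f t| <= C * t ^+ 2) -> is_derive (0 : R) 1 f 0.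
Proof.
move=> fC.
have f0 : f 0 = 0.
  by apply/eqP; rewrite -normr_le0; have := fC 0; rewrite expr0n /= mulr0.
have C0 : 0 <= C by have := fC 1; rewrite expr1n mulr1; apply: le_trans.
have L : (fun h : R => h^-1 *: ((f \o shift 0) (h *: 1) - f 0)) @ 0^' --> (0 : R).
  apply/cvgrPdist_le => e e0.
  have d0 : 0 < e / (C + 1) by rewrite divr_gt0 // ltr_wpDl.
  near=> h.
  have hn0 : h != 0 by near: h; exact: nbhs_dnbhs_neq.
  have he : `|h| <= e / (C + 1) by near: h; exact: dnbhs0_le.
  rewrite sub0r normrN /= addr0 /GRing.scale /= mulr1 f0 subr0 normrM normfV.
  rewrite ler_pdivrMl ?normr_gt0 //; apply: le_trans (fC h) _.
  rewrite -[h ^+ 2]real_normK ?num_real // expr2 mulrA mulrC.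
  rewrite ler_wpM2l //; apply: le_trans (_ : (C + 1) * `|h| <= _).
    by rewrite ler_wpM2r // lerDl.
  by rewrite mulrC -ler_pdivlMr // ltr_wpDl.
by split; [apply/cvg_ex; exists 0|apply/cvg_lim].
Unshelve. all: by end_near. Qed.

Lemma flat_is_derive n t :
  is_derive t 1 (flat n) (flat n.+2 t - n%:R * flat n.+1 t).
Proof.
have [t0|t0|<-] := ltgtP 0 t.
- have oP : open [set x : R | 0 < x] by exact: open_gt.
  apply: (@is_derive_on _ _ _ (fun t => t^-1 ^+ n * expR (- t^-1)) _ _ _ _ oP t0).
    by move=> x /= x0; rewrite /flat x0.
  have tn0 : t != 0 by rewrite gt_eqF.
  have dV := is_deriveVf tn0 (is_derive_id t (1 : R)).
  have dX : is_derive t 1 (fun t : R => t^-1 ^+ n) (n%:R * t^-1 ^+ n.-1 * (- 1 / t ^+ 2)).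
    have -> : (fun t : R => t^-1 ^+ n) = (fun t : R => t^-1) ^+ n.
      by apply/funext => x; rewrite exprfctE.
    exact: (@is_deriveX _ _ (fun t : R => t^-1) n t 1 _ dV).
  have := is_deriveMf dX (is_derive_expRf (is_deriveNf dV)).
  move/is_derive_eq; apply; rewrite /flat t0 !mulNr !mul1r opprK -exprVn.
  case: n {dX} => [|n] /=; rewrite !exprS ?expr0; first by ring.
  by ring.
- have oN : open [set x : R | x < 0] by exact: open_lt.
  have D : is_derive t 1 (flat n) 0.
    apply: (@is_derive_on _ _ _ (cst 0) _ _ _ _ oN t0) => x /= x0.
    by rewrite flat_le0 // ltW.
  move/is_derive_eq: D; apply.
  by rewrite (flat_le0 n.+2 (ltW t0)) (flat_le0 n.+1 (ltW t0)) mulr0 subr0.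
- rewrite (flat_le0 n.+2 (lexx 0)) (flat_le0 n.+1 (lexx 0)) mulr0 subr0.
  exact: (quadratic_is_derive0 (flat_bound n)).
Qed.

Inductive flat_combination : (R -> R) -> Prop :=
| fc_flat n : flat_combination (flat n)
| fc_add f g : flat_combination f -> flat_combination g ->
    flat_combination (fun t => f t + g t)
| fc_scale c f : flat_combination f -> flat_combination (fun t => c * f t).

Lemma smooth1_flat n : smooth1_on setT (flat n).
Proof.
apply: (@smooth1_coind _ _ flat_combination openT); last exact: fc_flat.
move=> f; elim=> {f} [m|f g _ [f' Cf ff'] _ [g' Cg gg']|c f _ [f' Cf ff']].
- exists (fun t => flat m.+2 t + (- m%:R) * flat m.+1 t).
    apply: fc_add; first exact: fc_flat.
    exact: (fc_scale _ (fc_flat _)).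
  by move=> t _; rewrite mulNr; apply: flat_is_derive.
- exists (fun t => f' t + g' t); first exact: fc_add.
  by move=> t _; exact: (is_deriveDf (ff' t Logic.I) (gg' t Logic.I)).
- exists (fun t => c * f' t); first exact: fc_scale.
  by move=> t _; exact: (is_deriveZf c (ff' t Logic.I)).
Qed.

Lemma cutoff : exists X : R -> R, [/\ smooth1_on setT X,
  forall t, 0 <= X t <= 1, forall t, t <= -2 -> X t = 0,
  forall t, -1 <= t -> X t = 1 &
  forall t, 0 <= derive1 X t /\ (t <= -2 \/ -1 <= t -> derive1 X t = 0)].
Proof.
(* [a] is positive for t > -2 and [b] for t < -1, so a + b never vanishes and a / (a + b) climbs
   from 0 to 1 between -2 and -1. *)
pose a t : R := flat 0 (t + 2); pose b t : R := flat 0 (- 1 - t).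
have ab0 t : 0 < a t + b t.
  have [t2|t2] := leP t (-2).
    by rewrite ltr_wpDl ?flat_ge0 // flat_gt0 //; lra.
  by rewrite ltr_pwDl ?flat_ge0 // flat_gt0 //; lra.
have sa : smooth1_on setT a.
  apply: (@smooth1_comp R setT setT (fun t => t + 2) (flat 0) openT _
    (@smooth1_flat 0%N) (fun _ _ => Logic.I)).
  exact: (smooth1D openT (@smooth1_id R setT) (@smooth1_cst R setT 2)).
have sb : smooth1_on setT b.
  apply: (@smooth1_comp R setT setT (fun t => - 1 - t) (flat 0) openT _
    (@smooth1_flat 0%N) (fun _ _ => Logic.I)).
  exact: (smooth1B openT (@smooth1_cst R setT (-1)) (@smooth1_id R setT)).
have da t : is_derive t 1 a (flat 2 (t + 2)).
  have := is_derive_compf (is_derive_addr 2 (is_derive_id t 1)) (flat_is_derive 0 (t + 2)).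
  by rewrite mul0r subr0 mulr1.
have db t : is_derive t 1 b (- flat 2 (- 1 - t)).
  have := is_derive_compf (is_deriveBf (is_derive_cst (-1 : R) t 1) (is_derive_id t 1))
    (flat_is_derive 0 (- 1 - t)).
  by move/is_derive_eq; apply; rewrite mul0r subr0 sub0r mulrN1.
have abn0 t : a t + b t != 0 by rewrite gt_eqF.
pose X t := a t * (a t + b t)^-1.
have dX t : is_derive t 1 X ((flat 2 (t + 2) * b t + a t * flat 2 (- 1 - t)) / (a t + b t) ^+ 2).
  have dV := @is_deriveVf _ _ (fun t => a t + b t) t _ _ (abn0 t)
    (is_deriveDf (da t) (db t)).
  have := is_deriveMf (da t) dV.
  by move/is_derive_eq; apply; field; apply: abn0.
exists X; split.
- exact: (smooth1M openT sa (smooth1V openT (smooth1D openT sa sb) (fun t _ => abn0 t))).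
- move=> t; rewrite /X; apply/andP; split.
    by rewrite divr_ge0 ?flat_ge0 // ltW.
  by rewrite ler_pdivrMr // mul1r lerDl flat_ge0.
- by move=> t t2; rewrite /X /a flat_le0 ?mul0r //; lra.
- by move=> t t1; rewrite /X /b (flat_le0 0 (_ : - 1 - t <= 0)) ?addr0 ?divff // ?gt_eqF ?flat_gt0 //; lra.
move=> t; rewrite (is_derive1E (dX t)); split.
  by rewrite divr_ge0 ?sqr_ge0 // addr_ge0 // mulr_ge0 ?flat_ge0.
move=> [t2|t1].
  by rewrite /a !(flat_le0 _ (_ : t + 2 <= 0)) ?mul0r ?addr0 ?mul0r //; lra.
by rewrite /b !(flat_le0 _ (_ : -1 - t <= 0)) ?mulr0 ?addr0 ?mul0r //; lra.
Qed.

End Cutoff.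

(** * Increasing diffeomorphisms as compositions of flows *)

Section Diffeomorphisms.
Variable R : realType.
Implicit Types (t y : R).
Let N : set R := [set t | t < 0].
Let P : set R := [set y | 1 < y].

Let oN : open_interval N.
Proof.
split; first exact: open_lt.
by move=> x y _ /= y0 z /andP[_ zy]; apply: le_lt_trans zy y0.
Qed.

Let oP : open_interval P.
Proof.
split; first exact: open_gt.
by move=> x y /= x1 _ z /andP[xz _]; apply: lt_le_trans x1 xz.
Qed.

(* The conjugacy h satisfies h (g t) = h t + c.  It equals g near -oo, hence
   the identity plus c just above 1, and t + c near 0, so that the three
   pieces glue smoothly; the growth of g at 0 is pushed to +oo. *)
Lemma tflows_half_lines (g gi : R -> R) : smooth1_on N g ->
  (forall t, N t -> 0 < derive1 g t) ->
  (forall t, N t -> P (g t) /\ gi (g t) = t) ->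
  (forall y, P y -> N (gi y) /\ g (gi y) = y) -> tflows N g.
Proof.
move=> sg g0 gP giN.
have dg t : N t -> is_derive t 1 g (derive1 g t) by move=> Nt; exact: (smooth1_is_derive sg Nt).
have gn0 t : N t -> derive1 g t != 0 by move=> Nt; rewrite gt_eqF ?g0.
have gE : g @` N = P.
  apply/seteqP; split=> [_ [t Nt <-]|y Py]; first by have [] := gP t Nt.
  by have [Ny gy] := giN y Py; exists (gi y).
have sgi : smooth1_on P gi.
  rewrite -gE; apply: (smooth1_inverse oN sg gn0) => t Nt.
  by have [] := gP t Nt.
have gmono s t : N s -> N t -> s < t -> g s < g t.
  exact: (derive_gt0_lt oN.2 dg g0).
have [X [sX X01 X0 X1 dX]] := @cutoff R.
have N1 : N (-1) by rewrite /N /=; lra.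
have N2 : N (-2) by rewrite /N /=; lra.
(* This makes t + c > g t in the transition zone -2 < t < -1, since t + c > g(-1) > g t there. Then
   X' (t + c - g t) >= 0, and the derivative of [h0] is at least (1 - X) g' + X > 0. *)
pose c := g (-1) + 2.
pose h0 t := (1 - X t) * g t + X t * (t + c).
pose h t := if t < 0 then h0 t else if t <= 1 then t + c else h0 (gi t) + c.
have sXN : smooth1_on N X by apply: smooth1_sub sX.
have sh0 : smooth1_on N h0.
  apply: (smooth1D oN.1).
    exact: (smooth1M oN.1 (smooth1B oN.1 (@smooth1_cst R N 1) sXN) sg).
  exact: (smooth1M oN.1 sXN (smooth1D oN.1 (@smooth1_id R N) (@smooth1_cst R N c))).
have key (x d d' y z : R) : 0 <= x -> x <= 1 -> 0 < d' -> 0 <= d * (z - y) ->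
    0 < (0 - d) * y + (1 - x) * d' + (d * z + x * 1).
  move=> x0 x1 d'0 K; suff : 0 < (1 - x) * d' + x by lra.
  have [->|xp] := eqVneq x 0; first by rewrite subr0 mul1r addr0.
  by rewrite ltr_wpDl // ?lt_def ?xp // mulr_ge0 ?subr_ge0 // ltW.
have h0_gt0 t : N t -> 0 < derive1 h0 t.
  move=> Nt; have dXt := @smooth1_is_derive R setT X t sX Logic.I.
  have D1 := is_deriveMf (is_deriveBf (is_derive_cst (1 : R) t (1 : R)) dXt) (dg t Nt).
  have D2 := is_deriveMf dXt (is_derive_addr c (is_derive_id t 1)).
  rewrite (is_derive1E (is_deriveDf D1 D2)).
  have := g0 t Nt; have [dX0 dXz] := dX t; have /andP[x0 x1] := X01 t.
  have K : 0 <= derive1 X t * (t + c - g t).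
    have [/orP t12|] := boolP ((t <= -2) || (-1 <= t)).
      by rewrite dXz ?mul0r.
    rewrite negb_or -!ltNge => /andP[t2 t1]; apply: mulr_ge0 => //.
    have := gmono t (-1) Nt N1 t1; rewrite /c; lra.
  by move=> g't; exact: (key (X t) _ _ (g t) (t + c) x0 x1 g't K).
(* An open set on which h t = t + c, overlapping both half-lines. It contains [0, 1] because g(-2) >
   1; for 1 < t < g(-2) the point [gi t] lies below -2, where [X] vanishes and h0 (gi t) = t. *)
pose V : set R := [set t | -1 < t /\ t < g (-2)].
have oV : open V by apply: openI; [exact: open_gt|exact: open_lt].
have hN t : N t -> h t = h0 t by rewrite /N /h /= => ->.
have hP t : P t -> h t = h0 (gi t) + c.
  by rewrite /P /h /= => t1; rewrite ltNge (ltW (lt_trans ltr01 t1)) /= leNgt t1.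
have hV t : V t -> h t = t + c.
  move=> [t1 t2]; have [t0|t0] := ltP t 0.
    by rewrite hN // /h0 X1 ?ltW // subrr mul0r add0r mul1r.
  have [t1'|t1'] := leP t 1; first by rewrite /h ltNge t0 /= t1'.
  have [Ny gy] := giN t t1'.
  rewrite hP // /h0 X0 ?subr0 ?mul1r ?mul0r ?addr0 ?gy //.
  rewrite leNgt; apply/negP => /(gmono _ _ N2 Ny); rewrite gy; lra.
have cover t : [\/ N t, V t | P t].
  have [g2 _] := gP _ N2.
  have [t0|t0] := ltP t 0; first by constructor 1.
  have [t1|t1] := leP t 1; last by constructor 3.
  by constructor 2; split; [lra|apply: le_lt_trans t1 g2].
have sPh : smooth1_on P (fun y => h0 (gi y) + c).
  apply: (smooth1D oP.1 _ (@smooth1_cst R P c)).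
  by apply: (smooth1_comp oP.1 sgi sh0) => y /giN[].
have sVh : smooth1_on V (fun t => t + c).
  exact: (smooth1D oV (@smooth1_id R V) (@smooth1_cst R V c)).
have sh : smooth1_on setT h.
  apply: smooth1_local => t _; have [Nt|Vt|Pt] := cover t.
  - by exists N, h0; split; first exact: oN.1.
  - by exists V, (fun t => t + c); split.
  - by exists P, (fun y => h0 (gi y) + c); split; first exact: oP.1.
have h_gt0 t : 0 < derive1 h t.
  have [Nt|Vt|Pt] := cover t.
  - have D := is_derive_on oN.1 Nt (fun x Nx => esym (hN x Nx)) (smooth1_is_derive sh0 Nt).
    by rewrite (is_derive1E D) h0_gt0.
  - have D := is_derive_on oV Vt (fun x Vx => esym (hV x Vx))
      (is_derive_addr c (is_derive_id t 1)).
    by rewrite (is_derive1E D) ltr01.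
  - have [Ny gy] := giN t Pt.
    have Di : is_derive t 1 gi (derive1 g (gi t))^-1.
      rewrite -{1}gy; apply: (inverse_is_derive oN.1 sg gn0 _ Ny) => x Nx.
      by have [] := gP x Nx.
    have D1 := is_derive_addr c (is_derive_compf Di (smooth1_is_derive sh0 Ny)).
    have D := is_derive_on oP.1 Pt (fun x Px => esym (hP x Px)) D1.
    by rewrite (is_derive1E D) mulr_gt0 ?h0_gt0 // invr_gt0 g0.
have tid : tflows N id by apply: tf_id.
apply: (@tf_step _ N id g h c tid sh h_gt0) => t Nt.
by have [Pg gig] := gP t Nt; rewrite hP // gig hN.
Qed.

Theorem diffeo_tflows (I : set R) (f : R -> R) : open_interval I ->
  smooth1_on I f -> (forall t, I t -> 0 < derive1 f t) -> tflows I f.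
Proof.
move=> oI sf f0; have [I0|nI0] := pselect (I !=set0); last first.
  by apply: tf_id => t It; case: nI0; exists t.
have fn0 t : I t -> derive1 f t != 0 by move=> /f0 /gt_eqF ->.
have oJ := smooth1_image oI sf fn0; set J := f @` I in oJ.
have df t : I t -> is_derive t 1 f (derive1 f t) by move=> It; exact: (smooth1_is_derive sf It).
have J0 : J !=set0 by have [t It] := I0; exists (f t); exists t.
have N0 : N !=set0 by exists (-1); rewrite /N /=; lra.
have P0 : P !=set0 by exists 2; rewrite /P /=; lra.
have [a [ai [Ia Na aN aiI]]] := tequiv_trans (tequiv_setT oI I0) (tequiv_sym (tequiv_setT oN N0)).
have [b [bi [Pb Jb bJ biP]]] := tequiv_trans (tequiv_setT oP P0) (tequiv_sym (tequiv_setT oJ J0)).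
pose fi y := xget 0 [set t | I t /\ f t = y].
have fiK t : I t -> fi (f t) = t.
  move=> It; rewrite /fi; case: xgetP => [x _ /= [Ix fx]|/(_ t) /=]; last by case.
  exact: (derive_neq0_inj oI.2 df fn0).
have Jfi y : J y -> I (fi y) /\ f (fi y) = y by move=> [t It <-]; rewrite fiK.
have [sai ai0] := tflows_smooth oN.1 Na.
have [sbi bi0] := tflows_smooth oJ.1 Jb.
pose g t := bi (f (ai t)).
have aiI' t : N t -> I (ai t) by move=> /aiI[].
have Jf t : I t -> J (f t) by exists t.
have sfai : smooth1_on N (fun t => f (ai t)) by exact: (smooth1_comp oN.1 sai sf aiI').
have sg : smooth1_on N g.
  by apply: (smooth1_comp oN.1 sfai sbi) => t /aiI' /Jf.
have tg : tflows N g.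
  apply: (@tflows_half_lines g (fun y => a (fi (b y)))) => //.
  - move=> t Nt; have Iai := aiI' t Nt.
    have D := is_derive_compf (is_derive_compf (smooth1_is_derive sai Nt)
      (smooth1_is_derive sf Iai)) (smooth1_is_derive sbi (Jf _ Iai)).
    by rewrite (is_derive1E D) !mulr_gt0 ?bi0 ?f0 ?ai0 //; apply: Jf.
  - move=> t Nt; have Iai := aiI' t Nt; have [Pbi bbi] := biP _ (Jf _ Iai).
    by split=> //; rewrite bbi fiK //; have [] := aiI t Nt.
  - move=> y Py; have [Jy bby] := bJ y Py; have [Iy fy] := Jfi _ Jy.
    by have [Na' aia] := aN _ Iy; split=> //; rewrite /g aia fy.
have T1 : tflows I (g \o a).
  by apply: (tflows_comp Ia (tflows_sub _ tg)) => _ [t It <-]; have [] := aN t It.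
have T2 : tflows I (b \o (g \o a)).
  apply: (tflows_comp T1 (tflows_sub _ Pb)) => _ [t It <-] /=.
  have [Nt aia] := aN t It; rewrite /g aia.
  by have [] := biP _ (Jf _ It).
apply: tflows_ext T2 => t It /=; have [Nt aia] := aN t It; rewrite /g aia.
by have [_ ->] := biP _ (Jf _ It).
Qed.

End Diffeomorphisms.

(** * Listed transformations are equivalence transformations *)

Section Coordinates.
Variable R : realType.
Implicit Types (t x u a b c q n : R) (p : 'rV[R]_(3 + 5)).

Lemma row3E t x u : (row3 t x u 0 it = t) * (row3 t x u 0 ix = x) *
  (row3 t x u 0 iu = u).
Proof. by split; [split|]; rewrite mxE (tnth_nth 0). Qed.

Lemma row5E a b c q n : (row5 a b c q n 0 iA = a) * (row5 a b c q n 0 iB = b) *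
  (row5 a b c q n 0 iC = c) * (row5 a b c q n 0 iQ = q) *
  (row5 a b c q n 0 iN = n).
Proof. by do !split; rewrite mxE (tnth_nth 0). Qed.

Lemma ord3P (P : 'I_3 -> Prop) : P it -> P ix -> P iu -> forall i, P i.
Proof.
by move=> Pt Px Pu [[|[|[|//]]] Hi]; rewrite (bool_irrelevance Hi isT).
Qed.

Lemma ord5P (P : 'I_5 -> Prop) : P iA -> P iB -> P iC -> P iQ -> P iN ->
  forall i, P i.
Proof.
by move=> PA PB PC PQ PN [[|[|[|[|[|//]]]]] Hi]; rewrite (bool_irrelevance Hi isT).
Qed.

Lemma row3_eta (v : 'rV[R]_3) : v = row3 (v 0 it) (v 0 ix) (v 0 iu).
Proof. by apply/rowP; apply: ord3P; rewrite row3E. Qed.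

Lemma row5_eta (v : 'rV[R]_5) :
  v = row5 (v 0 iA) (v 0 iB) (v 0 iC) (v 0 iQ) (v 0 iN).
Proof. by apply/rowP; apply: ord5P; rewrite row5E. Qed.

Lemma aug_ext (p q : 'rV[R]_(3 + 5)) :
  (forall i, lsubmx p 0 i = lsubmx q 0 i) ->
  (forall i, rsubmx p 0 i = rsubmx q 0 i) -> p = q.
Proof.
move=> E1 E2; rewrite -[p]hsubmxK -[q]hsubmxK.
by congr row_mx; apply/rowP.
Qed.

Lemma lsubmx_coord m1 m2 (p : 'rV[R]_(m1 + m2)) i : lsubmx p 0 i = p 0 (lshift m2 i).
Proof. by rewrite mxE. Qed.

Lemma rsubmx_coord m1 m2 (p : 'rV[R]_(m1 + m2)) i : rsubmx p 0 i = p 0 (rshift m1 i).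
Proof. by rewrite mxE. Qed.

Lemma ord8P (P : 'I_(3 + 5) -> Prop) : (forall i, P (lshift 5 i)) ->
  (forall i, P (rshift 3 i)) -> forall i, P i.
Proof.
move=> Pl Pr i; rewrite -[i](@splitK 3 5); case: (fintype.split i) => j /=; [exact: Pl|exact: Pr].
Qed.

Lemma powR_expRM a u n : 0 < u -> (expR a * u) `^ n = expR (n * a) * u `^ n.
Proof.
by move=> u0; rewrite powRM ?expR_ge0 ?ltW // -expRM mulrC [a * n]mulrC mulrC.
Qed.

Lemma open_base_space : open (@base_space R).
Proof.
rewrite (_ : @base_space R = (fun b : 'rV[R]_3 => b 0 iu) @^-1` [set x | 0 < x]) //.
by apply: open_comp; [move=> b _; apply: continuous_coord|exact: open_gt].
Qed.

Lemma open_aug_space : open (@aug_space R).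
Proof.
rewrite (_ : @aug_space R =
  ((fun p : 'rV[R]_(3 + 5) => p 0 (lshift 5 iu)) @^-1` [set x | 0 < x]) `&`
  ((fun p : 'rV[R]_(3 + 5) => p 0 (rshift 3 iN)) @^-1` [set x | 0 < x])).
  by apply: openI; (apply: open_comp; [move=> b _; apply: continuous_coord|exact: open_gt]).
by apply/seteqP; split=> p; rewrite /aug_space /= !mxE.
Qed.

Lemma open_aug_over (I : set R) : open I -> open (aug_over I).
Proof.
move=> oI; rewrite (_ : aug_over I =
  ((fun p : 'rV[R]_(3 + 5) => p 0 (lshift 5 it)) @^-1` I) `&` @aug_space R).
  apply: openI; last exact: open_aug_space.
  by apply: open_comp => // b _; apply: continuous_coord.
by apply/seteqP; split=> p; rewrite /aug_over /= !mxE.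
Qed.

End Coordinates.

Section Listed.
Variable R : realType.
Implicit Types (e er t : R) (alpha r : R -> R) (p : 'rV[R]_(3 + 5)).

Lemma eq_listed e1 e2 er alpha r er' alpha' r' p :
  let t := lsubmx p 0 it in
  alpha t = alpha' t -> derive1 alpha t = derive1 alpha' t ->
  er * r t = er' * r' t -> er * derive1 r t = er' * derive1 r' t ->
  listed e1 e2 er alpha r p = listed e1 e2 er' alpha' r' p.
Proof.
move=> /= a1 a2 r1 r2; rewrite /listed a1 a2 r1 r2.
by congr row_mx; congr row5; rewrite -!mulrA r1.
Qed.

Lemma listed_near (I : set R) e1 e2 alpha r alpha' r' p : open I ->
  I (lsubmx p 0 it) -> (forall t, I t -> alpha t = alpha' t) ->
  (forall t, I t -> r t = r' t) -> smooth1_on I alpha -> smooth1_on I r ->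
  listed e1 e2 1 alpha r p = listed e1 e2 1 alpha' r' p.
Proof.
move=> oI Ip aa rr sa sr.
have E f f' : (forall t, I t -> f t = f' t) -> smooth1_on I f ->
    derive1 f (lsubmx p 0 it) = derive1 f' (lsubmx p 0 it).
  move=> ff' sf; apply/esym.
  exact: (is_derive1E (is_derive_on oI Ip ff' (smooth1_is_derive sf Ip))).
by apply: eq_listed; rewrite ?aa ?rr ?(E alpha alpha') ?(E r r').
Qed.

(** Only the products of [er] with r and r_t enter a listed map. With [er] = 1 composition becomes
    addition of the functions r. *)
Lemma listed_normalize (I : set R) e1 e2 er alpha r p : smooth1_on I r ->
  I (lsubmx p 0 it) ->
  listed e1 e2 er alpha r p = listed e1 e2 1 alpha (fun t => er * r t) p.
Proof.
move=> sr Ip; apply: eq_listed; rewrite ?mul1r //.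
by rewrite (is_derive1E (is_deriveZf er (smooth1_is_derive sr Ip))).
Qed.

Lemma listed_id p : listed 0 0 1 id (fun=> 0) p = p.
Proof.
have d1 : derive1 (@id R) (lsubmx p 0 it) = 1 by apply: is_derive1E.
rewrite /listed derive1_zero d1 !(mulr0, subr0, addr0, expR0, divr1, mul1r, mulr1).
by rewrite -row3_eta -row5_eta hsubmxK.
Qed.

(** A listed map translates x before scaling it, so the second translation is divided by e^e1. The
    exponents add, and the two shifts of Q combine through the chain rule for r'(alpha(t)). *)
Lemma listed_comp e1 e2 alpha r e1' e2' alpha' r' p (a b a' b' : R) :
  let t := lsubmx p 0 it in
  is_derive t 1 alpha a -> is_derive t 1 r b ->
  is_derive (alpha t) 1 alpha' a' -> is_derive (alpha t) 1 r' b' -> a != 0 ->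
  listed e1' e2' 1 alpha' r' (listed e1 e2 1 alpha r p) =
  listed (e1 + e1') (e2 + e2' * expR (- e1)) 1 (fun t => alpha' (alpha t))
    (fun t => r t + r' (alpha t)) p.
Proof.
move=> t da dr da' dr' a0.
have d1 := is_derive1E (is_derive_compf da da').
have d2 := is_derive1E (is_deriveDf dr (is_derive_compf da dr')).
have := (is_derive1E da, is_derive1E dr, is_derive1E da', is_derive1E dr').
rewrite /t in d1 d2 * => -[[[D1 D2] D3] D4].
rewrite /listed !row_mxKl !row_mxKr !row3E !row5E d1 d2 D1 D2 D3 D4.
set n := rsubmx p 0 iN; set s := lsubmx p 0 it.
have E1 x : (x + e2 + e2' * expR (- e1)) * expR (e1 + e1') =
    ((x + e2) * expR e1 + e2') * expR e1'.
  have E0 : expR e1 != 0 by rewrite expR_eq0.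
  by rewrite expRD expRN; field.
have merge x y z : expR x / a' * (expR y / a * z) = expR (x + y) / (a' * a) * z.
  by rewrite expRD invfM; ring.
congr row_mx; [congr row3|congr row5].
- by rewrite -E1 addrA.
- rewrite mulrA -expRD; congr (expR _ * _); ring.
- rewrite merge; congr (expR _ / _ * _); ring.
- rewrite merge; congr (expR _ / _ * _); ring.
- rewrite merge; congr (expR _ / _ * _); ring.
- by rewrite invfM; move: (a'^-1) => c; field.
Qed.

Lemma listed_aug_over (I : set R) e1 e2 er alpha r p : aug_over I p ->
  aug_over (alpha @` I) (listed e1 e2 er alpha r p).
Proof.
move=> [Ip [u0 n0]]; split.
  by rewrite row_mxKl row3E; exists (lsubmx p 0 it).
by split; rewrite ?row_mxKl ?row_mxKr ?row3E ?row5E // mulr_gt0 // expR_gt0.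
Qed.

(** Preimages come from solving the formulas for the old coordinates. The image is again the full
    space over an interval of times, so the next flow of a composition starts on a set of the same
    kind. *)
Lemma listed_image (I : set R) e1 e2 alpha r : open I ->
  smooth1_on I alpha -> smooth1_on I r -> (forall t, I t -> derive1 alpha t != 0) ->
  listed e1 e2 1 alpha r @` aug_over I = aug_over (alpha @` I).
Proof.
move=> oI sa sr a0; apply/seteqP; split=> [_ [p Ip <-]|q]; first exact: listed_aug_over.
move=> [[t It tq] [u0 n0]].
set n := rsubmx q 0 iN in n0.
exists (row_mx (row3 t (lsubmx q 0 ix / expR e1 - e2)
                     (expR (r t - e1) * lsubmx q 0 iu))
   (row5 (derive1 alpha t / expR (n * r t + (1 - n) * e1) * rsubmx q 0 iA)
         (derive1 alpha t / expR (3 * e1) * rsubmx q 0 iB)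
         (derive1 alpha t / expR (2 * n * r t + (1 - 2 * n) * e1) * rsubmx q 0 iC)
         (derive1 alpha t * rsubmx q 0 iQ - derive1 r t) n)).
  split; first by rewrite row_mxKl row3E.
  split; rewrite ?row_mxKl ?row_mxKr ?row3E ?row5E //.
  by rewrite mulr_gt0 // expR_gt0.
have an0 := a0 t It.
rewrite /listed !row_mxKl !row_mxKr !row3E !row5E !mulr1 !mul1r tq.
have E (x : R) : expR x != 0 by rewrite expR_eq0.
apply: aug_ext; [apply: ord3P|apply: ord5P]; rewrite ?row_mxKl ?row_mxKr ?row3E ?row5E //.
- by field; apply: E.
- by rewrite mulrA -expRD (_ : _ + _ = 0) ?expR0 ?mul1r //; ring.
- by field; rewrite an0 E.
- by field; rewrite an0 E.
- by field; rewrite an0 E.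
- by field.
Qed.

End Listed.

(** * Action of a listed transformation on solutions *)

Section PointTransformation.
Variables (R : realType) (I : set R) (e1 e2 er : R) (alpha r : R -> R).
Hypotheses (oI : open_interval I) (sa : smooth1_on I alpha) (sr : smooth1_on I r).
Hypothesis a0 : forall t, I t -> derive1 alpha t != 0.

Definition point_map (b : 'rV[R]_3) : 'rV[R]_3 :=
  row3 (alpha (b 0 it)) ((b 0 ix + e2) * expR e1)
    (expR (e1 - er * r (b 0 it)) * b 0 iu).

Let map_t c : point_map c 0 it = alpha (c 0 it). Proof. by rewrite row3E. Qed.
Let map_x c : point_map c 0 ix = (c 0 ix + e2) * expR e1. Proof. by rewrite row3E. Qed.
Let map_u c : point_map c 0 iu = expR (e1 - er * r (c 0 it)) * c 0 iu.
Proof. by rewrite row3E. Qed.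

Let dom : set 'rV[R]_3 := [set b : 'rV[R]_3 | I (b 0 it) /\ base_space b].

Lemma open_dom : open dom.
Proof.
apply: openI; last exact: open_base_space.
by apply: open_comp oI.1 => b _; apply: continuous_coord.
Qed.

Lemma smooth_multiplier : smooth1_on I (fun t => expR (e1 - er * r t)).
Proof.
have s1 : smooth1_on I (fun t => e1 - er * r t).
  exact: (smooth1B oI.1 (@smooth1_cst R I e1) (@smooth1Z R I r er oI.1 sr)).
exact: (smooth1_comp oI.1 s1 (@smooth1_expR R setT) (fun _ _ => Logic.I)).
Qed.

Let sc (i : 'I_3) : smooth_on dom (fun b => b 0 i) := @smooth_coord R 3 dom i open_dom.

Let s_t : smooth_on dom (fun b => alpha (b 0 it)).
Proof. by apply: (smooth_comp1 open_dom (sc it) sa) => b []. Qed.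

Let s_x : smooth_on dom (fun b => (b 0 ix + e2) * expR e1).
Proof.
exact: (smoothM open_dom (smoothD open_dom (sc ix) (@smooth_cst R 3 dom e2 open_dom))
  (@smooth_cst R 3 dom (expR e1) open_dom)).
Qed.

Let s_m : smooth_on dom (fun b => expR (e1 - er * r (b 0 it))).
Proof. by apply: (smooth_comp1 open_dom (sc it) smooth_multiplier) => b []. Qed.

Let s_u : smooth_on dom (fun b => expR (e1 - er * r (b 0 it)) * b 0 iu).
Proof. exact: (smoothM open_dom s_m (sc iu)). Qed.

Lemma smooth_point_map i : smooth_on dom (fun b => point_map b 0 i).
Proof.
move: i; apply: ord3P; rewrite ?(funext map_t) ?(funext map_x) ?(funext map_u).
- exact: s_t.
- exact: s_x.
- exact: s_u.
Qed.

Lemma is_derive_coord_off (g : R -> R) (b : 'rV[R]_3) i j : i != j ->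
  is_derive b (delta_mx 0 i) (fun x => g (x 0 j)) 0.
Proof.
move=> ij; apply/is_derive_line.
have -> : (fun h : R => g ((h *: delta_mx 0 i + b) 0 j)) = cst (g (b 0 j)).
  apply/funext => h; rewrite !mxE /= (_ : (j == i) = false) ?mulr0 ?add0r //.
  by rewrite eq_sym; apply/negbTE.
exact: is_derive_cst.
Qed.

Lemma differentiable_point_map (b : 'rV[R]_3) : I (b 0 it) -> differentiable point_map b.
Proof.
move=> Ib.
have -> : point_map = (fun b : 'rV[R]_3 => alpha (b 0 it) *: delta_mx 0 it
    + ((b 0 ix + e2) * expR e1) *: delta_mx 0 ix
    + (expR (e1 - er * r (b 0 it)) * b 0 iu) *: delta_mx 0 iu).
  by apply/funext => c; apply/rowP; apply: ord3P;
    rewrite row3E !mxE /= !(mulr1, mulr0, addr0, add0r).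
have dc (f : R -> R) a : is_derive (b 0 it) 1 f a ->
    differentiable (fun b : 'rV[R]_3 => f (b 0 it)) b.
  move=> fa; apply: (@differentiable_comp _ _ _ _ (fun b : 'rV[R]_3 => b 0 it) f).
    exact: differentiable_coord.
  by apply/derivable1_diffP; apply: ex_derive.
apply: differentiableD; first apply: differentiableD.
- apply: differentiableZl; exact: (dc _ _ (smooth1_is_derive sa Ib)).
- apply: differentiableZl; apply: differentiableM; last exact: differentiable_cst.
  by apply: differentiableD; [exact: differentiable_coord|exact: differentiable_cst].
- apply: differentiableZl; apply: differentiableM; last exact: differentiable_coord.
  exact: (dc _ _ (smooth1_is_derive smooth_multiplier Ib)).
Qed.

Lemma jacobian_point_map (b : 'rV[R]_3) i j : I (b 0 it) ->
  ('J point_map b) i j = partial i (fun c => point_map c 0 j) b.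
Proof.
move=> Ib; have dP := differentiable_point_map Ib.
have := deriveEjacobian (delta_mx 0 i) dP.
rewrite derive_mx; last exact: diff_derivable.
by rewrite -rowE => /rowP/(_ j); rewrite !mxE /partial => <-.
Qed.

(** Only the new u involves two variables, t and u. The matrix is therefore upper triangular with
    diagonal alpha_t, e^e1, e^(e1 - er r); [det_trig] concerns lower triangular matrices, hence the
    transpose. *)
Lemma det_point_map b : dom b -> \det ('J point_map b) != 0.
Proof.
move=> db; have Ib := db.1.
have D1 i : i != it -> ('J point_map b) i it = 0.
  move=> ni; rewrite jacobian_point_map // (funext map_t).
  exact: (partialE setT (is_derive_coord_off alpha b ni)).
have D2 i : i != ix -> ('J point_map b) i ix = 0.
  move=> ni; rewrite jacobian_point_map // (funext map_x).
  exact: (partialE setT (is_derive_coord_off (fun y => (y + e2) * expR e1) b ni)).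
have D11 : ('J point_map b) it it != 0.
  rewrite jacobian_point_map // (funext map_t).
  have D := is_derive_compf (is_derive_coord b (delta_mx 0 it) it) (smooth1_is_derive sa Ib).
  by rewrite (partialE setT D) mxE /= mulr1 a0.
have D22 : ('J point_map b) ix ix != 0.
  rewrite jacobian_point_map // (funext map_x).
  have D := is_deriveMf (is_derive_addr e2 (is_derive_coord b (delta_mx 0 ix) ix))
    (is_derive_cst (expR e1) b (delta_mx 0 ix)).
  by rewrite (partialE setT D) mxE /= mul1r mulr0 addr0 expR_eq0.
have D33 : ('J point_map b) iu iu != 0.
  rewrite jacobian_point_map // (funext map_u).
  have ut : iu != it by [].
  have D := is_deriveMf (is_derive_coord_off (fun y => expR (e1 - er * r y)) b ut)
    (is_derive_coord b (delta_mx 0 iu) iu).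
  by rewrite (partialE setT D) mxE /= mul0r add0r mulr1 expR_eq0.
rewrite -det_tr det_trig.
  apply/prodf_neq0 => i _; rewrite mxE; move: i; exact: ord3P.
apply/is_trig_mxP; apply: ord3P => j; rewrite [_^T _ _]mxE => ij.
- by rewrite D1 // -val_eqE /= gt_eqF.
- by rewrite D2 // -val_eqE /= gt_eqF.
- by move: ij; rewrite ltnNge -ltnS ltn_ord.
Qed.

Lemma alpha_inj s t : I s -> I t -> alpha s = alpha t -> s = t.
Proof.
move=> Is It; apply: (derive_neq0_inj oI.2 _ a0) => // x Ix.
exact: (smooth1_is_derive sa Ix).
Qed.

Lemma point_map_inj b b' : dom b -> dom b' -> point_map b = point_map b' -> b = b'.
Proof.
move=> [Ib _] [Ib' _] E.
have Et : b 0 it = b' 0 it.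
  by apply: alpha_inj => //; have := congr1 (fun v : 'rV[R]_3 => v 0 it) E; rewrite !row3E.
have Ex : b 0 ix = b' 0 ix.
  have := congr1 (fun v : 'rV[R]_3 => v 0 ix) E; rewrite !row3E => /mulIf.
  by rewrite expR_eq0 => /(_ isT) /addIr.
have Eu : b 0 iu = b' 0 iu.
  have := congr1 (fun v : 'rV[R]_3 => v 0 iu) E; rewrite !row3E Et => /mulfI.
  by rewrite expR_eq0 => /(_ isT).
by rewrite [b]row3_eta [b']row3_eta Et Ex Eu.
Qed.

Section Solutions.
Variables (O O' : set 'rV[R]_2).
Hypotheses (oO : open O) (oO' : open O') (OI : forall z : 'rV[R]_2, O z -> I (z 0 ord0)).
Notation dt := (partial (ord0 : 'I_2)).
Notation dx := (partial (ord_max : 'I_2)).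
Let et : 'rV[R]_2 := delta_mx 0 ord0.
Let ex : 'rV[R]_2 := delta_mx 0 ord_max.

(** The new t and x do not involve u, so graphs lie over the image of this map of the (t, x)-plane,
    and the value of the function is multiplied by a function of t. *)
Definition plane_map (z : 'rV[R]_2) : 'rV[R]_2 :=
  alpha (z 0 ord0) *: et + ((z 0 ord_max + e2) * expR e1) *: ex.

Lemma plane_mapE z : (plane_map z 0 ord0 = alpha (z 0 ord0)) *
  (plane_map z 0 ord_max = (z 0 ord_max + e2) * expR e1).
Proof. by split; rewrite !mxE /= !(mulr1, mulr0, addr0, add0r). Qed.

Lemma row2_ext (y z : 'rV[R]_2) : y 0 ord0 = z 0 ord0 ->
  y 0 ord_max = z 0 ord_max -> y = z.
Proof.
move=> E0 E1; apply/rowP => -[[|[|//]] Hi].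
  by rewrite (_ : Ordinal Hi = ord0) //; apply: val_inj.
by rewrite (_ : Ordinal Hi = ord_max) //; apply: val_inj.
Qed.

Hypothesis plane_O : forall z, O z -> O' (plane_map z).

(** Since [m] does not depend on x, the conclusion has the form of the hypothesis with the
    multiplier e^(-e1) m. The lemma can thus be iterated up to the third derivative. *)
Lemma plane_dx (w w' : 'rV[R]_2 -> R) (m : R -> R) : smooth_on O w ->
  smooth_on O' w' -> (forall z, O z -> w' (plane_map z) = m (z 0 ord0) * w z) ->
  forall z, O z -> dx w' (plane_map z) = expR (- e1) * m (z 0 ord0) * dx w z.
Proof.
move=> sw sw' E z Oz.
have D1 : is_derive z ex (fun y => w' (plane_map y)) (dx w' (plane_map z) * expR e1).
  apply/is_derive_line.
  have -> : (fun h : R => w' (plane_map (h *: ex + z))) =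
      (fun h : R => w' ((expR e1 * h) *: ex + plane_map z)).
    apply/funext => h; congr w'; apply: row2_ext; rewrite !plane_mapE !mxE /=.
      by rewrite !(mulr0, mulr1, add0r, addr0).
    by rewrite !(mulr0, mulr1, add0r, addr0); ring.
  have Dw : is_derive (expR e1 * 0) 1 (fun h : R => w' (h *: ex + plane_map z))
      (dx w' (plane_map z)).
    rewrite mulr0; apply: (is_derive_line _ _ _ _).1.
    exact: (@smooth_is_derive R 2 O' w' (plane_map z) ord_max sw' (plane_O Oz)).
  exact: (is_derive_compf (is_derive_scale (expR e1) 0) Dw).
have D2 : is_derive z ex (fun y => m (y 0 ord0) * w y) (m (z 0 ord0) * dx w z).
  have Dm : is_derive z ex (fun y => m (y 0 ord0)) 0.
    apply/is_derive_line; have -> : (fun h : R => m ((h *: ex + z) 0 ord0)) = cst (m (z 0 ord0)).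
      by apply/funext => h; rewrite !mxE /= mulr0 add0r.
    exact: is_derive_cst.
  have := is_deriveMf Dm (smooth_is_derive ord_max sw Oz).
  by move/is_derive_eq; apply; rewrite mul0r add0r.
have D3 := is_derive_on oO Oz E D1.
have := etrans (esym (partialE setT D3)) (partialE setT D2).
move=> E4; rewrite -mulrA -E4 expRN mulrCA mulVf ?mulr1 //.
by rewrite expR_eq0.
Qed.

(** The term with m' is the one that the shift of Q by er r_t later absorbs. *)
Lemma plane_dt (w w' : 'rV[R]_2 -> R) (m : R -> R) : smooth_on O w ->
  smooth_on O' w' -> smooth1_on I m ->
  (forall z, O z -> w' (plane_map z) = m (z 0 ord0) * w z) ->
  forall z, O z -> derive1 alpha (z 0 ord0) * dt w' (plane_map z) =
    derive1 m (z 0 ord0) * w z + m (z 0 ord0) * dt w z.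
Proof.
move=> sw sw' sm E z Oz; have Iz := OI Oz.
have D1 : is_derive z et (fun y => w' (plane_map y))
    (dt w' (plane_map z) * derive1 alpha (z 0 ord0)).
  apply/is_derive_line.
  have -> : (fun h : R => w' (plane_map (h *: et + z))) =
      (fun h : R => w' ((alpha (h + z 0 ord0) - alpha (z 0 ord0)) *: et + plane_map z)).
    apply/funext => h; congr w'; apply: row2_ext; rewrite !plane_mapE !mxE /=.
      by rewrite !(mulr0, mulr1, add0r, addr0) subrK.
    by rewrite !(mulr0, mulr1, add0r, addr0).
  have Dw : is_derive (alpha (0 + z 0 ord0) - alpha (z 0 ord0)) 1
      (fun h : R => w' (h *: et + plane_map z)) (dt w' (plane_map z)).
    rewrite add0r subrr; apply: (is_derive_line _ _ _ _).1.
    exact: (@smooth_is_derive R 2 O' w' (plane_map z) ord0 sw' (plane_O Oz)).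
  have Da : is_derive (0 + z 0 ord0) 1 alpha (derive1 alpha (z 0 ord0)).
    by rewrite add0r; exact: (smooth1_is_derive sa Iz).
  have Dh := is_derive_compf (is_derive_addr (z 0 ord0) (is_derive_id (0 : R) 1)) Da.
  by have := is_derive_compf (is_derive_addr (- alpha (z 0 ord0)) Dh) Dw; rewrite mulr1.
have D2 : is_derive z et (fun y => m (y 0 ord0) * w y)
    (derive1 m (z 0 ord0) * w z + m (z 0 ord0) * dt w z).
  have Dm := is_derive_compf (is_derive_coord z et ord0) (smooth1_is_derive sm Iz).
  have := is_deriveMf Dm (smooth_is_derive ord0 sw Oz).
  by move/is_derive_eq; apply; rewrite mxE /= mulr1.
have D3 := is_derive_on oO Oz E D1.
by rewrite mulrC; exact: (etrans (esym (partialE setT D3)) (partialE setT D2)).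
Qed.

End Solutions.
Notation P := point_map.

Definition time_inverse (y : R) : R := xget 0 [set t | I t /\ alpha t = y].

Lemma time_inverseK t : I t -> time_inverse (alpha t) = t.
Proof.
move=> It; rewrite /time_inverse; case: xgetP => [x _ /= [Ix fx]|/(_ t) /=]; last by case.
exact: (alpha_inj).
Qed.

Definition new_elements (th : elements R) : elements R :=
  let k := time_inverse in
  let n := eln th in
  Elements
    (fun y => expR (n * er * r (k y) + (1 - n) * e1) / derive1 alpha (k y) * elA th (k y))
    (fun y => expR (3 * e1) / derive1 alpha (k y) * elB th (k y))
    (fun y => expR (2 * n * er * r (k y) + (1 - 2 * n) * e1) / derive1 alpha (k y) * elC th (k y))
    (fun y => (elQ th (k y) + er * derive1 r (k y)) / derive1 alpha (k y))
    n.

Lemma new_timesE (K : set R) : new_times P K = alpha @` K.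
Proof.
apply/seteqP; split=> [t' [b [Kb b0 ->]]|_ [t Kt <-]].
  by rewrite row3E; exists (b 0 it).
by exists (row3 t 0 1); rewrite /base_space /= !row3E; split.
Qed.

Lemma new_elements_class_form (K : set R) th : K `<=` I -> class_form K th ->
  class_form (new_times P K) (new_elements th).
Proof.
move=> KI [oK n0 [sA sB sC sQ] BC]; rewrite new_timesE.
have saK := smooth1_sub KI sa; have srK := smooth1_sub KI sr.
have aK t : K t -> derive1 alpha t != 0 by move=> /KI; apply: a0.
have [oJ iJ] := smooth1_image oK saK aK.
have kK t : K t -> time_inverse (alpha t) = t by move=> /KI; apply: time_inverseK.
have sk : smooth1_on (alpha @` K) time_inverse by exact: (smooth1_inverse oK saK aK kK).
have Jk y : (alpha @` K) y -> K (time_inverse y) by move=> [t Kt <-]; rewrite kK.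
have pull (f : R -> R) : smooth1_on K f -> smooth1_on (alpha @` K) (fun y => f (time_inverse y)).
  by move=> sf; exact: (smooth1_comp oJ sk sf Jk).
have sV : smooth1_on (alpha @` K) (fun y => (derive1 alpha (time_inverse y))^-1).
  apply: (pull (fun t => (derive1 alpha t)^-1)).
  exact: (smooth1V oK.1 (smooth1_derive1 saK) aK).
have sE (c d : R) : smooth1_on (alpha @` K) (fun y => expR (c * r (time_inverse y) + d)).
  apply: (pull (fun t => expR (c * r t + d))).
  have s1 : smooth1_on K (fun t => c * r t + d).
    exact: (smooth1D oK.1 (@smooth1Z R K r c oK.1 srK) (@smooth1_cst R K d)).
  exact: (smooth1_comp oK.1 s1 (@smooth1_expR R setT) (fun _ _ => Logic.I)).
split; [by split|exact: n0|split|].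
- exact: (smooth1M oJ (smooth1M oJ (sE _ _) sV) (pull _ sA)).
- exact: (smooth1M oJ (smooth1M oJ (@smooth1_cst R _ _) sV) (pull _ sB)).
- exact: (smooth1M oJ (smooth1M oJ (sE _ _) sV) (pull _ sC)).
- apply: (smooth1M oJ _ sV); apply: (pull (fun t => elQ th t + er * derive1 r t)).
  exact: (smooth1D oK.1 sQ (@smooth1Z R K (derive1 r) er oK.1 (smooth1_derive1 srK))).
move=> _ [t Kt <-] /=; rewrite kK //; have [B0 C0] := BC t Kt.
have E (x : R) : expR x != 0 by rewrite expR_eq0.
by split; rewrite !mulf_neq0 // invr_neq0 // aK.
Qed.

Lemma listed_values (K : set R) th (b : 'rV[R]_3) : K `<=` I -> K (b 0 it) ->
  rsubmx (listed e1 e2 er alpha r (row_mx b (values th (b 0 it)))) =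
  values (new_elements th) (P b 0 it).
Proof.
move=> KI Kb; rewrite /listed /values !row_mxKl !row_mxKr !row5E row3E /=.
by rewrite time_inverseK //; apply: KI.
Qed.

(** All terms acquire the same factor e^(e1 - er r) / alpha_t: the exponentials in the new A, B, C
    cancel those coming from u^n, u^(2n) and the x-derivatives, and the shift of Q cancels the extra
    term of the new u_t. *)
Lemma kdv_transformed (th : elements R) (t u ut ux uxxx ut' : R) : I t -> 0 < u ->
  derive1 alpha t * ut' = expR (e1 - er * r t) * (ut - er * derive1 r t * u) ->
  kdv (values (new_elements th) (alpha t)) (expR (e1 - er * r t) * u) ut'
    (expR (- e1) * expR (e1 - er * r t) * ux)
    (expR (- e1) * (expR (- e1) * (expR (- e1) * expR (e1 - er * r t))) * uxxx) =
  expR (e1 - er * r t) / derive1 alpha t * kdv (values th t) u ut ux uxxx.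
Proof.
move=> It u0 Et; have an := a0 It.
have {Et}-> : ut' = expR (e1 - er * r t) * (ut - er * derive1 r t * u) / derive1 alpha t.
  by rewrite -Et mulrAC mulfV ?mul1r.
rewrite /kdv /values !row5E /= time_inverseK // !powR_expRM //.
set n := eln th; set d := derive1 alpha t; set m := expR (e1 - er * r t).
have EA : expR (n * er * r t + (1 - n) * e1) * expR (n * (e1 - er * r t)) * expR (- e1) = 1.
  by rewrite -!expRD -[RHS]expR0; congr expR; ring.
have EC : expR (2 * n * er * r t + (1 - 2 * n) * e1) * expR (2 * n * (e1 - er * r t)) * expR (- e1) = 1.
  by rewrite -!expRD -[RHS]expR0; congr expR; ring.
have EB : expR (3 * e1) * (expR (- e1) * (expR (- e1) * expR (- e1))) = 1.
  by rewrite -!expRD -[RHS]expR0; congr expR; ring.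
set U := u `^ n; set U2 := u `^ (2 * n).
rewrite -/n in EA EC *.
set a1 := expR (n * er * r t + _) in EA *; set a2 := expR (n * _) in EA *.
set c1 := expR (2 * n * er * r t + _) in EC *; set c2 := expR (2 * n * _) in EC *.
set b1 := expR (3 * e1) in EB *; set em := expR (- e1) in EA EB EC *.
rewrite [X in _ + X + _ + _ + _](_ : _ = (a1 * a2 * em) * (m / d * (elA th t * U * ux))); last by ring.
rewrite [X in _ + X + _ + _](_ : _ = (c1 * c2 * em) * (m / d * (elC th t * U2 * ux))); last by ring.
rewrite [X in _ + X + _](_ : _ = (b1 * (em * (em * em))) * (m / d * (elB th t * uxxx))); last by ring.
rewrite EA EB EC; ring.
Qed.

Lemma graph_image (v v' : 'rV[R]_2 -> R) (z z' : 'rV[R]_2) :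
  P (graph_pt v z) = graph_pt v' z' ->
  z' = plane_map z /\ v' z' = expR (e1 - er * r (z 0 ord0)) * v z.
Proof.
move=> E; split; last first.
  by have := congr1 (fun w : 'rV[R]_3 => w 0 iu) E; rewrite !row3E.
apply: row2_ext; rewrite plane_mapE.
  by have := congr1 (fun w : 'rV[R]_3 => w 0 it) E; rewrite !row3E.
by have := congr1 (fun w : 'rV[R]_3 => w 0 ix) E; rewrite !row3E.
Qed.

Lemma solves_at_iff (K : set R) th O v O' v' : K `<=` I ->
  smooth_positive O v -> smooth_positive O' v' ->
  (forall z : 'rV[R]_2, O z -> K (z 0 ord0)) -> maps_graph P O v O' v' ->
  forall z z', O z -> O' z' -> P (graph_pt v z) = graph_pt v' z' ->
    (solves_at th v z <-> solves_at (new_elements th) v' z').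
Proof.
move=> KI [oO sv v0] [oO' sv' _] OK PO z z' Oz Oz' /graph_image[-> _].
have OI y : O y -> I (y 0 ord0) by move=> /OK /KI.
have PO' y : O y -> O' (plane_map y).
  by move=> /PO[y' Oy' /graph_image[<-]].
pose m t := expR (e1 - er * r t).
have sm : smooth1_on I m := smooth_multiplier.
have E0 y : O y -> v' (plane_map y) = m (y 0 ord0) * v y.
  by move=> /PO[y' Oy' /graph_image[<-]].
have E1 := plane_dx oO PO' sv sv' E0.
have sv1 := smooth_partial ord_max sv; have sv1' := smooth_partial ord_max sv'.
have E2 := @plane_dx _ _ oO PO' _ _ (fun t => expR (- e1) * m t) sv1 sv1' E1.
have sv2 := smooth_partial ord_max sv1; have sv2' := smooth_partial ord_max sv1'.
have E3 := @plane_dx _ _ oO PO' _ _ (fun t => expR (- e1) * (expR (- e1) * m t)) sv2 sv2' E2.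
have Et := plane_dt oO OI PO' sv sv' sm E0 Oz.
have Iz := OI z Oz.
have Dm : derive1 m (z 0 ord0) = m (z 0 ord0) * (0 - er * derive1 r (z 0 ord0)).
  apply: is_derive1E; apply: is_derive_expRf.
  exact: (is_deriveBf (is_derive_cst e1 (z 0 ord0) (1 : R)) (is_deriveZf er (smooth1_is_derive sr Iz))).
have Ht : derive1 alpha (z 0 ord0) * partial ord0 v' (plane_map z) =
    m (z 0 ord0) * (partial ord0 v z - er * derive1 r (z 0 ord0) * v z).
  by rewrite Et Dm; ring.
have kdv_eq (e e' : 'rV[R]_5) (u u' w x x' y y' : R) : e = e' -> u = u' -> x = x' ->
    y = y' -> kdv e u w x y = kdv e' u' w x' y' by move=> -> -> -> ->.
have F := etrans (kdv_eq _ _ _ _ _ _ _ _ _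
    (congr1 (values (new_elements th)) (plane_mapE z).1)
    (E0 z Oz) (E1 z Oz) (E3 z Oz))
  (@kdv_transformed th _ _ _ _ _ _ Iz (v0 z Oz) Ht).
rewrite /solves_at F.
have mn : m (z 0 ord0) / derive1 alpha (z 0 ord0) != 0.
  by rewrite mulf_neq0 ?invr_neq0 ?a0 // expR_eq0.
split=> [->|/eqP]; first by rewrite mulr0.
by rewrite mulf_eq0 (negbTE mn) /= => /eqP.
Qed.

Theorem listed_equivalence : equivalence_transformation I (listed e1 e2 er alpha r).
Proof.
exists P; split.
- by move=> p _; rewrite /listed row_mxKl.
- move=> i; by apply: smooth_point_map.
- move=> b [Ib b0]; split; last by apply: det_point_map.
  by rewrite /base_space /= row3E mulr_gt0 // expR_gt0.
- by move=> b b'; apply: point_map_inj.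
move=> K th KI [cK _]; exists (new_elements th); split.
- exact: new_elements_class_form.
- move=> b Kb _; exact: (listed_values th KI Kb).
- move=> O v O' v' sv sv' OK PO; exact: (@solves_at_iff K th O v O' v').
Qed.

End PointTransformation.

(** * Determining equations *)

Section TotalDerivatives.
Variable R : realType.
Notation jet := 'rV[R]_(3 + 6).
Notation ux := (jcoord jx).
Notation uxx := (jcoord jxx).
Notation uxxx := (jcoord jxxx).
Notation px := (partial ix).
Notation pu := (partial iu).
Implicit Types (F G : jet -> R) (z : jet) (f : 'rV[R]_3 -> R).

Definition jet_space : set jet := [set z | base_space (lsubmx z)].

Lemma open_jet_space : open jet_space.
Proof.
rewrite (_ : jet_space = (fun z : jet => z 0 (lshift 6 iu)) @^-1` [set x | 0 < x]).
  by apply: open_comp; [move=> b _; apply: continuous_coord|exact: open_gt].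
by apply/seteqP; split=> z; rewrite /jet_space /base_space /= !mxE.
Qed.

Lemma on_jets_is_derive_base f z i (a : R) :
  is_derive (lsubmx z) (delta_mx 0 i) f a ->
  is_derive z (delta_mx 0 (jbase i)) (on_jets f) a.
Proof.
move=> /is_derive_line fa; apply/is_derive_line; move: fa.
congr is_derive; apply/funext => h; rewrite /on_jets; congr f.
by apply/rowP => k; rewrite !mxE /= /jbase (inj_eq (@lshift_inj _ _)).
Qed.

Lemma on_jets_is_derive_der f z j :
  is_derive z (delta_mx 0 (jder j)) (on_jets f) 0.
Proof.
apply/is_derive_line.
have -> : (fun h : R => on_jets f (h *: delta_mx 0 (jder j) + z)) = cst (on_jets f z).
  apply/funext => h; rewrite /on_jets /cst; congr f; apply/rowP => k.
  by rewrite !mxE /= /jder eq_lrshift mulr0 add0r.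
exact: is_derive_cst.
Qed.

(** A value of [Dx] bundled with the existence of the coordinate derivatives. The sum and product
    rules depend on that existence, so the calculus is done on the relation and read off by
    [has_DxE]. *)
Definition has_Dx F z (d : R) := exists2 a : 'I_(3 + 6) -> R,
  forall i, is_derive z (delta_mx 0 i) F (a i) &
  d = a (jbase ix) + ux z * a (jbase iu) + jcoord jtx z * a (jder jt)
    + uxx z * a (jder jx) + jcoord jtxx z * a (jder jtx) + uxxx z * a (jder jxx).

Lemma has_DxE F z d : has_Dx F z d -> Dx F z = d.
Proof. by move=> [a Fa ->]; rewrite /Dx !(partialE setT (Fa _)). Qed.

Lemma has_Dx_on F G z d : jet_space z -> (forall y, jet_space y -> F y = G y) ->
  has_Dx F z d -> has_Dx G z d.
Proof.
move=> Jz FG [a Fa ->]; exists a => // i.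
exact: (is_derive_on open_jet_space Jz FG (Fa i)).
Qed.

Lemma has_DxD F G z d d' : has_Dx F z d -> has_Dx G z d' ->
  has_Dx (fun y => F y + G y) z (d + d').
Proof.
move=> [a Fa ->] [b Gb ->]; exists (fun i => a i + b i); last by ring.
by move=> i; exact: (is_deriveDf (Fa i) (Gb i)).
Qed.

Lemma has_DxB F G z d d' : has_Dx F z d -> has_Dx G z d' ->
  has_Dx (fun y => F y - G y) z (d - d').
Proof.
move=> [a Fa ->] [b Gb ->]; exists (fun i => a i - b i); last by ring.
by move=> i; exact: (is_deriveBf (Fa i) (Gb i)).
Qed.

Lemma has_DxM F G z d d' : has_Dx F z d -> has_Dx G z d' ->
  has_Dx (fun y => F y * G y) z (d * G z + F z * d').
Proof.
move=> [a Fa ->] [b Gb ->]; exists (fun i => a i * G z + F z * b i); last by ring.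
by move=> i; exact: (is_deriveMf (Fa i) (Gb i)).
Qed.

Lemma has_DxZ (c : R) F z d : has_Dx F z d -> has_Dx (fun y => c * F y) z (c * d).
Proof.
move=> [a Fa ->]; exists (fun i => c * a i); last by ring.
by move=> i; exact: (is_deriveZf c (Fa i)).
Qed.

Lemma has_Dx_ux z : has_Dx ux z (uxx z).
Proof.
exists (fun i => (delta_mx 0 i : 'rV[R]_(3 + 6)) 0 (jder jx)).
  by move=> i; exact: (is_derive_coord z (delta_mx 0 i) (jder jx)).
by rewrite !mxE /= !(mulr1, mulr0, addr0, add0r).
Qed.

Lemma has_Dx_uxx z : has_Dx uxx z (uxxx z).
Proof.
exists (fun i => (delta_mx 0 i : 'rV[R]_(3 + 6)) 0 (jder jxx)).
  by move=> i; exact: (is_derive_coord z (delta_mx 0 i) (jder jxx)).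
by rewrite !mxE /= !(mulr1, mulr0, addr0, add0r).
Qed.

(** The total derivative in x of a function of (t, x, u). *)
Definition Xd f z := on_jets (px f) z + ux z * on_jets (pu f) z.

Lemma has_Dx_on_jets f z : smooth_on (@base_space R) f -> jet_space z ->
  has_Dx (on_jets f) z (Xd f z).
Proof.
move=> sf Jz.
exists (fun i : 'I_(3 + 6) => match fintype.split i with
   inl k => partial k f (lsubmx z) | inr _ => 0 end).
  move=> i; rewrite -[i](@splitK 3 6); case: (fintype.split i) => k /=.
    rewrite (@unsplitK 3 6 (inl k)); apply: on_jets_is_derive_base.
    exact: (smooth_is_derive k sf Jz).
  by rewrite (@unsplitK 3 6 (inr k)); exact: on_jets_is_derive_der.
have L (k : 'I_3) : fintype.split (jbase k) = inl k by exact: (@unsplitK 3 6 (inl k)).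
have S (k : 'I_6) : fintype.split (jder k) = inr k by exact: (@unsplitK 3 6 (inr k)).
by rewrite !L !S /Xd /on_jets !mulr0 !addr0.
Qed.

Lemma Dt_on_jets f z : smooth_on (@base_space R) f -> jet_space z ->
  Dt (on_jets f) z = on_jets (partial it f) z + jcoord jt z * on_jets (pu f) z.
Proof.
move=> sf Jz; rewrite /Dt.
have D i := partialE setT (on_jets_is_derive_base (smooth_is_derive i sf Jz)).
by rewrite !D.
Qed.

(* Keeps unification from unfolding iterated partial derivatives. *)
Opaque partial.

Section Prolong.
Variable Y : generator R.
Hypothesis sY : forall i, smooth_on (@base_space R) (zeta Y i).
Notation tau := (zeta Y it).
Notation xi := (zeta Y ix).
Notation eta := (zeta Y iu).
Notation oj := (@on_jets R).

Lemma eta_tE z : jet_space z -> eta_t Y z =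
  oj (partial it eta) z + jcoord jt z * oj (pu eta) z
  - jcoord jt z * (oj (partial it tau) z + jcoord jt z * oj (pu tau) z)
  - ux z * (oj (partial it xi) z + jcoord jt z * oj (pu xi) z).
Proof. by move=> Jz; rewrite /eta_t !Dt_on_jets. Qed.

Hypothesis tau_x : forall b, base_space b -> px tau b = 0.
Hypothesis tau_u : forall b, base_space b -> pu tau b = 0.

Let Dx_tau z : jet_space z -> Dx (oj tau) z = 0.
Proof.
move=> Jz; rewrite (has_DxE (has_Dx_on_jets (sY it) Jz)) /Xd /on_jets.
by rewrite tau_x ?tau_u // mulr0 addr0.
Qed.

Let sx i : smooth_on (@base_space R) (px (zeta Y i)) := smooth_partial ix (sY i).
Let su i : smooth_on (@base_space R) (pu (zeta Y i)) := smooth_partial iu (sY i).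
Let sxx i : smooth_on (@base_space R) (px (px (zeta Y i))) := smooth_partial ix (sx i).
Let sxu i : smooth_on (@base_space R) (px (pu (zeta Y i))) := smooth_partial ix (su i).
Let suu i : smooth_on (@base_space R) (pu (pu (zeta Y i))) := smooth_partial iu (su i).

Let xuC i z : jet_space z -> oj (pu (px (zeta Y i))) z = oj (px (pu (zeta Y i))) z.
Proof. move=> Jz; exact: (partialC iu ix (@open_base_space R) (sY i) Jz). Qed.

(** As tau depends on t only, its total x-derivative is 0 and the term with u_t drops out. The mixed
    derivatives u_tx and u_txx disappear from the two higher coefficients for the same reason. *)
Lemma eta_xE z : jet_space z -> eta_x Y z =
  oj (px eta) z + ux z * oj (pu eta) z - ux z * oj (px xi) z
  - ux z * ux z * oj (pu xi) z.
Proof.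
move=> Jz; have Tz := Dx_tau Jz.
have Ez := has_DxE (has_Dx_on_jets (sY iu) Jz).
have Xz := has_DxE (has_Dx_on_jets (sY ix) Jz).
have -> : eta_x Y z = Dx (oj eta) z - jcoord jt z * Dx (oj tau) z
  - ux z * Dx (oj xi) z by [].
move: Tz Ez Xz; rewrite /Xd.
generalize (Dx (oj tau) z) (Dx (oj eta) z) (Dx (oj xi) z).
generalize (oj (px eta) z) (oj (pu eta) z) (oj (px xi) z) (oj (pu xi) z).
by move=> *; subst; ring.
Qed.

Lemma eta_xxE z : jet_space z -> eta_xx Y z =
  oj (px (px eta)) z + 2 * (ux z * oj (px (pu eta)) z)
  + ux z * ux z * oj (pu (pu eta)) z
  + uxx z * (oj (pu eta) z - 2 * oj (px xi) z) - ux z * oj (px (px xi)) z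
  - 2 * (ux z * ux z * oj (px (pu xi)) z)
  - ux z * ux z * ux z * oj (pu (pu xi)) z - 3 * (ux z * uxx z * oj (pu xi) z).
Proof.
move=> Jz; have Tz := Dx_tau Jz.
have Xz := has_DxE (has_Dx_on_jets (sY ix) Jz).
have -> : eta_xx Y z = Dx (eta_x Y) z - jcoord jtx z * Dx (oj tau) z
  - uxx z * Dx (oj xi) z by [].
have H := fun f sf => @has_Dx_on_jets f z sf Jz.
have D := has_DxB (has_DxB (has_DxD (H _ (sx iu)) (has_DxM (has_Dx_ux z) (H _ (su iu))))
   (has_DxM (has_Dx_ux z) (H _ (sx ix))))
  (has_DxM (has_DxM (has_Dx_ux z) (has_Dx_ux z)) (H _ (su ix))).
have E y : jet_space y -> _ := fun Jy => esym (@eta_xE y Jy).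
have Dz := has_DxE (has_Dx_on Jz E D).
move: Tz Xz Dz (xuC iu Jz) (xuC ix Jz); rewrite /Xd; cbv beta.
generalize (Dx (eta_x Y) z) (Dx (oj tau) z) (Dx (oj xi) z).
generalize (oj (px (px eta)) z) (oj (px (pu eta)) z) (oj (pu (px eta)) z) (oj (pu (pu eta)) z)
  (oj (px (px xi)) z) (oj (px (pu xi)) z) (oj (pu (px xi)) z) (oj (pu (pu xi)) z).
generalize (oj (px eta) z) (oj (pu eta) z) (oj (px xi) z) (oj (pu xi) z).
by move=> *; subst; ring.
Qed.

Lemma eta_xxxE z : jet_space z -> eta_xxx Y z =
  Xd (px (px eta)) z + 2 * (uxx z * oj (px (pu eta)) z)
  + 2 * (ux z * Xd (px (pu eta)) z) + 2 * (ux z * uxx z * oj (pu (pu eta)) z)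
  + ux z * ux z * Xd (pu (pu eta)) z
  + uxxx z * (oj (pu eta) z - 3 * oj (px xi) z)
  + uxx z * (oj (px (pu eta)) z + ux z * oj (pu (pu eta)) z)
  - 2 * (uxx z * (oj (px (px xi)) z + ux z * oj (px (pu xi)) z))
  - uxx z * oj (px (px xi)) z - ux z * Xd (px (px xi)) z
  - 4 * (ux z * uxx z * oj (px (pu xi)) z)
  - 2 * (ux z * ux z * Xd (px (pu xi)) z)
  - 3 * (ux z * ux z * uxx z * oj (pu (pu xi)) z)
  - ux z * ux z * ux z * Xd (pu (pu xi)) z
  - 3 * (uxx z * uxx z * oj (pu xi) z) - 4 * (ux z * uxxx z * oj (pu xi) z)
  - 3 * (ux z * uxx z * (oj (px (pu xi)) z + ux z * oj (pu (pu xi)) z)).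
Proof.
move=> Jz; have Tz := Dx_tau Jz.
have Xz := has_DxE (has_Dx_on_jets (sY ix) Jz).
have -> : eta_xxx Y z = Dx (eta_xx Y) z - jcoord jtxx z * Dx (oj tau) z
  - uxxx z * Dx (oj xi) z by [].
have H := fun f sf => @has_Dx_on_jets f z sf Jz.
have U := has_Dx_ux z; have U2 := has_DxM U U; have V := has_Dx_uxx z.
have D1 := has_DxD (H _ (sxx iu)) (has_DxZ 2 (has_DxM U (H _ (sxu iu)))).
have D2 := has_DxD D1 (has_DxM U2 (H _ (suu iu))).
have D3 := has_DxD D2 (has_DxM V (has_DxB (H _ (su iu)) (has_DxZ 2 (H _ (sx ix))))).
have D4 := has_DxB D3 (has_DxM U (H _ (sxx ix))).
have D5 := has_DxB D4 (has_DxZ 2 (has_DxM U2 (H _ (sxu ix)))).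
have D6 := has_DxB D5 (has_DxM (has_DxM U2 U) (H _ (suu ix))).
have D7 := has_DxB D6 (has_DxZ 3 (has_DxM (has_DxM U V) (H _ (su ix)))).
have E y : jet_space y -> _ := fun Jy => esym (@eta_xxE y Jy).
have Dz := has_DxE (has_Dx_on Jz E D7).
have Xuu i : Xd (pu (zeta Y i)) z = oj (px (pu (zeta Y i))) z + ux z * oj (pu (pu (zeta Y i))) z by [].
have Xx i : Xd (px (zeta Y i)) z = oj (px (px (zeta Y i))) z + ux z * oj (pu (px (zeta Y i))) z by [].
have X1 : Xd xi z = oj (px xi) z + ux z * oj (pu xi) z by [].
move: Tz Xz Dz X1 (Xuu iu) (Xuu ix) (Xx ix) (xuC ix Jz); cbv beta.
generalize (Dx (eta_xx Y) z) (Dx (oj tau) z) (Dx (oj xi) z).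
generalize (Xd (px (px eta)) z) (Xd (px (pu eta)) z) (Xd (pu (pu eta)) z)
  (Xd (px (px xi)) z) (Xd (px (pu xi)) z) (Xd (pu (pu xi)) z)
  (Xd (pu eta) z) (Xd (px xi) z) (Xd (pu xi) z) (Xd xi z).
generalize (oj (px (px eta)) z) (oj (px (pu eta)) z) (oj (pu (pu eta)) z)
  (oj (px (px xi)) z) (oj (px (pu xi)) z) (oj (pu (px xi)) z) (oj (pu (pu xi)) z).
generalize (oj (px eta) z) (oj (pu eta) z) (oj (px xi) z) (oj (pu xi) z).
by move=> *; subst; ring.
Qed.

End Prolong.

(** Base and exponent both vary, because n is an arbitrary element with a coefficient of its own;
    this is where ln u enters the determining equations. *)
Lemma powR_is_derive (f g : R -> R) (t a b : R) : 0 < f t ->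
  is_derive t 1 f a -> is_derive t 1 g b ->
  is_derive t 1 (fun h => f h `^ g h) (f t `^ g t * (b * ln (f t) + g t * a / f t)).
Proof.
move=> f0 fa gb.
have E : \forall h \near t, expR (g h * ln (f h)) = f h `^ g h.
  have cf : {for t, continuous f} := is_derive_cvg fa.
  have : \forall h \near t, 0 < f h by apply: (cvgr_gt _ cf).
  by apply: filterS => h fh; rewrite /powR gt_eqF.
apply: (near_eq_is_derive E).
have := is_derive_expRf (is_deriveMf gb (is_derive_lnf f0 fa)).
by move/is_derive_eq; apply; rewrite /powR gt_eqF // mulrA.
Qed.

(** [L] is the logarithmic derivative of u^n along the generator; that of u^(2n) is therefore 2
    L. *)
Lemma pr_kdvE (Y : generator R) z (e : 'rV[R]_5) : jet_space z ->
  let u := lsubmx z 0 iu in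
  let om i := omega Y i (row_mx (lsubmx z) e) in
  let n := e 0 iN in
  let L := om iN * ln u + n * on_jets (zeta Y iu) z / u in
  pr_kdv Y z e = eta_t Y z
   + (om iA * u `^ n * ux z + e 0 iA * (u `^ n * L) * ux z + e 0 iA * u `^ n * eta_x Y z)
   + (om iC * u `^ (2 * n) * ux z + e 0 iC * (u `^ (2 * n) * (2 * L)) * ux z
      + e 0 iC * u `^ (2 * n) * eta_x Y z)
   + (om iB * uxxx z + e 0 iB * eta_xxx Y z)
   + (om iQ * u + e 0 iQ * on_jets (zeta Y iu) z).
Proof.
move=> Jz u om n L; apply: is_derive1E.
have zu : z 0 (jbase iu) = u by rewrite /u lsubmx_coord.
have aff (c d : R) : is_derive (0 : R) 1 (fun h : R => c + h * d) d.
  have := is_deriveDf (is_derive_cst c (0 : R) (1 : R))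
    (is_deriveMf (is_derive_id (0 : R) (1 : R)) (is_derive_cst d (0 : R) (1 : R))).
  by move/is_derive_eq; apply; rewrite /= mul1r mul0r addr0 add0r.
have u0 : 0 < u by exact: Jz.
have -> : (fun h : R => kdv (e + h *: \row_i omega Y i (row_mx (lsubmx z) e))
        (z 0 (jbase iu) + h * on_jets (zeta Y iu) z)
        (jcoord jt z + h * eta_t Y z) (jcoord jx z + h * eta_x Y z)
        (jcoord jxxx z + h * eta_xxx Y z)) = (fun h : R =>
   jcoord jt z + h * eta_t Y z
   + (e 0 iA + h * om iA) * (u + h * on_jets (zeta Y iu) z) `^ (n + h * om iN)
     * (jcoord jx z + h * eta_x Y z)
   + (e 0 iC + h * om iC) * (u + h * on_jets (zeta Y iu) z) `^ (2 * (n + h * om iN))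
     * (jcoord jx z + h * eta_x Y z)
   + (e 0 iB + h * om iB) * (jcoord jxxx z + h * eta_xxx Y z)
   + (e 0 iQ + h * om iQ) * (u + h * on_jets (zeta Y iu) z)).
  by apply/funext => h; rewrite /kdv zu !mxE.
have u00 : 0 < u + 0 * on_jets (zeta Y iu) z by rewrite mul0r addr0.
have P g b := @powR_is_derive (fun h => u + h * on_jets (zeta Y iu) z) g 0 _ b u00
  (aff u (on_jets (zeta Y iu) z)).
have P1 := P _ _ (aff n (om iN)); have P2 := P _ _ (is_deriveZf 2 (aff n (om iN))).
have D := is_deriveDf (is_deriveDf (is_deriveDf (is_deriveDf (aff (jcoord jt z) (eta_t Y z))
  (is_deriveMf (is_deriveMf (aff (e 0 iA) (om iA)) P1) (aff (jcoord jx z) (eta_x Y z))))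
  (is_deriveMf (is_deriveMf (aff (e 0 iC) (om iC)) P2) (aff (jcoord jx z) (eta_x Y z))))
  (is_deriveMf (aff (e 0 iB) (om iB)) (aff (jcoord jxxx z) (eta_xxx Y z))))
  (is_deriveMf (aff (e 0 iQ) (om iQ)) (aff u (on_jets (zeta Y iu) z))).
move/is_derive_eq: D; apply; rewrite !mul0r !addr0 /L; clearbody u om n.
generalize (eta_t Y z) (eta_x Y z) (eta_xxx Y z) (on_jets (zeta Y iu) z).
generalize (u `^ n) (u `^ (2 * n)) (ln u) (jcoord jx z) (jcoord jxxx z).
by move=> *; ring.
Qed.

End TotalDerivatives.

(** * Coefficients of the invariance condition *)

Section LiePolynomial.
Variables (R : realType) (A B C Q u U V L oA oB oC oQ : R).
Variables (h ht hx hu hxu huu tt kt kx ku kxx kxu kuu : R).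
Variables Xhxx Xhxu Xhuu Xkxx Xkxu Xkuu : R -> R.

(* The prolonged generator applied to the equation, at the jet with u_x = a1,
   u_xx = a2, u_xxx = a3, when tau = tau(t); h, tt and k stand for eta, tau_t
   and xi, indices denote partial derivatives, and Xf is f_x + a1 f_u. *)
Definition lie_poly (ut a1 a2 a3 : R) : R :=
  let eX := hx + a1 * hu - a1 * kx - a1 * a1 * ku in
  let eXXX :=
    Xhxx a1 + 2 * (a2 * hxu) + 2 * (a1 * Xhxu a1) + 2 * (a1 * a2 * huu)
    + a1 * a1 * Xhuu a1 + a3 * (hu - 3 * kx) + a2 * (hxu + a1 * huu)
    - 2 * (a2 * (kxx + a1 * kxu)) - a2 * kxx - a1 * Xkxx a1
    - 4 * (a1 * a2 * kxu) - 2 * (a1 * a1 * Xkxu a1)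
    - 3 * (a1 * a1 * a2 * kuu) - a1 * a1 * a1 * Xkuu a1
    - 3 * (a2 * a2 * ku) - 4 * (a1 * a3 * ku)
    - 3 * (a1 * a2 * (kxu + a1 * kuu)) in
  (ht + ut * hu - ut * (tt + ut * 0) - a1 * (kt + ut * ku))
  + (oA * U * a1 + A * (U * L) * a1 + A * U * eX)
  + (oC * V * a1 + C * (V * (2 * L)) * a1 + C * V * eX)
  + (oB * a3 + B * eXXX) + (oQ * u + Q * h).

Hypothesis poly0 : forall a1 a2 a3,
  lie_poly (- (A * U * a1 + C * V * a1 + B * a3 + Q * u)) a1 a2 a3 = 0.
Hypothesis B0 : B != 0.

Let P a1 a2 a3 : _ := poly0 a1 a2 a3.

(** At u_x = u_xxx = 0 the polynomial is quadratic in u_xx, and a second difference isolates the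
    coefficient - 3 B ku of its square. The other coefficients are isolated by similar
    differences. *)
Lemma lie_poly_ku : ku = 0.
Proof.
have := P 0 1 0; have := P 0 (-1) 0; have := P 0 0 0; rewrite /lie_poly => H1 H2 H3.
by apply: (mulfI B0); rewrite mulr0; lra.
Qed.

(** The coefficient of u_xx at u_x = u_xxx = 0 is 3 B (hxu - kxx). *)
Lemma lie_poly_hxu : hxu = kxx.
Proof.
have := P 0 1 0; have := P 0 (-1) 0; rewrite /lie_poly => H1 H2.
by apply: (mulfI B0); lra.
Qed.

(** Coefficient of u_xxx. The terms with [hu] cancel because u_t has been replaced by an expression
    containing - B u_xxx. *)
Lemma lie_poly_oB : oB = (3 * kx - tt) * B.
Proof.
have := P 0 0 1; have := P 0 0 0; rewrite /lie_poly => H1 H2; lra.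
Qed.

(** Once the derivatives of [ku] vanish, the coefficient of u_x u_xx is 3 B huu. *)
Lemma lie_poly_huu : kxu = 0 -> kuu = 0 -> huu = 0.
Proof.
move=> kxu0 kuu0; have ku0 := lie_poly_ku; have E := lie_poly_hxu.
have := P 1 1 0; have := P 1 (-1) 0; have := P 0 1 0; have := P 0 (-1) 0.
rewrite /lie_poly kxu0 kuu0 ku0 E => H1 H2 H3 H4.
by apply: (mulfI B0); rewrite mulr0; lra.
Qed.

Lemma lie_poly_ux : ku = 0 -> Xhxx 1 = Xhxx 0 -> Xhxu 1 = 0 -> Xhuu 1 = 0 ->
  Xkxx 1 = 0 -> Xkxu 1 = 0 -> Xkuu 1 = 0 ->
  - kt + (A * U + C * V) * (tt - kx) + oA * U + oC * V
  + L * (A * U + 2 * C * V) = 0.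
Proof.
move=> ku0 E1 E2 E3 E4 E5 E6.
have := P 1 0 0; have := P 0 0 0.
by rewrite /lie_poly ku0 E1 E2 E3 E4 E5 E6 => H1 H2; lra.
Qed.

Lemma lie_poly_const : hx = 0 -> Xhxx 0 = 0 ->
  ht - Q * u * (hu - tt) + oQ * u + Q * h = 0.
Proof. by move=> E1 E2; have := P 0 0 0; rewrite /lie_poly E1 E2 => H; lra. Qed.

End LiePolynomial.

Section PowerCoefficients.
Variable R : realType.

(** The equation for u_x at n = 3 and u = 2^j: [k] stands for the part free of u, 8^j and 64^j for
    u^n and u^(2n), the factor j for ln u, and 4^j, 32^j for u^n / u and u^(2n) / u. With n = 3 the
    exponents 0, 3, 6, 2, 5 are distinct, and five values of j determine the five unknowns. *)
Lemma powers_n3 (k a b w g : R) :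
  (forall j, k + 8 ^+ j * a + 64 ^+ j * b + j%:R * (8 ^+ j + 2 * 64 ^+ j) * w
     + 3 * g * (4 ^+ j + 2 * 32 ^+ j) = 0) -> k = 0 /\ g = 0.
Proof.
move=> H; have := H 0%N; have := H 1%N; have := H 2%N; have := H 3%N; have := H 4%N.
by rewrite !expr0 !expr1 !exprS !expr0 => H0 H1 H2 H3 H4; split; lra.
Qed.

(** The same equation for a general n, sampled at u^n = 2^j and divided by u^n. The nonzero [C]
    excludes the logarithmic part, which shows that n is not transformed. *)
Lemma powers_n (A C a b w : R) : C != 0 ->
  (forall j, a + 2 ^+ j * b + j%:R * w * (A + 2 * C * 2 ^+ j) = 0) ->
  [/\ w = 0, a = 0 & b = 0].
Proof.
move=> C0 H; have := H 0%N; have := H 1%N; have := H 2%N; have := H 3%N.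
rewrite !expr0 !expr1 !exprS !expr0 => H0 H1 H2 H3.
have w0 : w = 0 by apply: (mulfI C0); rewrite mulr0; nra.
by rewrite w0 in H0 H1 H2 H3; split=> //; lra.
Qed.

End PowerCoefficients.

Section BaseSpace.
Variable R : realType.
Implicit Types (f g : 'rV[R]_3 -> R) (b : 'rV[R]_3) (t x u : R).
Notation base := (@base_space R).

Lemma base_row3 t x u : 0 < u -> base (row3 t x u).
Proof. by rewrite /base_space /= row3E. Qed.

Lemma row3_line (h t x u : R) :
  (h *: delta_mx 0 it + row3 t x u = row3 (h + t) x u) *
  (h *: delta_mx 0 ix + row3 t x u = row3 t (h + x) u) *
  (h *: delta_mx 0 iu + row3 t x u = row3 t x (h + u)).
Proof.
by split; [split|]; apply/rowP; apply: ord3P;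
  rewrite row3E !mxE /= (tnth_nth 0) /= !(mulr1, mulr0, add0r).
Qed.

Lemma const_u g : (forall b, base b -> is_derive b (delta_mx 0 iu) g 0) ->
  forall t x u, 0 < u -> g (row3 t x u) = g (row3 t x 1).
Proof.
move=> gu t x u u0.
have iP : is_interval [set y : R | 0 < y].
  by move=> y z /= y0 _ w /andP[yw _]; apply: lt_le_trans y0 yw.
have D (y : R) : 0 < y -> is_derive y 1 (fun h => g (h *: delta_mx 0 iu + row3 t x 0)) 0.
  move=> y0; apply: (is_derive_lineE g (row3 t x 0) (delta_mx 0 iu) y 0).1.
  by rewrite row3_line addr0; apply: gu; apply: base_row3.
by have := derive0_const iP D u0 (ltr01 : [set y : R | 0 < y] 1); rewrite !row3_line !addr0.
Qed.

Lemma const_x g : (forall b, base b -> is_derive b (delta_mx 0 ix) g 0) ->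
  forall t x u, 0 < u -> g (row3 t x u) = g (row3 t 0 u).
Proof.
move=> gx t x u u0.
have D (y : R) : setT y -> is_derive y 1 (fun h => g (h *: delta_mx 0 ix + row3 t 0 u)) 0.
  move=> _; apply: (is_derive_lineE g (row3 t 0 u) (delta_mx 0 ix) y 0).1.
  by rewrite row3_line addr0; apply: gx; apply: base_row3.
by have := derive0_const (@is_intervalT R) D (Logic.I : setT x) (Logic.I : setT 0); rewrite !row3_line !addr0.
Qed.

Lemma const_t g : (forall b, base b -> is_derive b (delta_mx 0 it) g 0) ->
  forall t x u, 0 < u -> g (row3 t x u) = g (row3 0 x u).
Proof.
move=> gt t x u u0.
have D (y : R) : setT y -> is_derive y 1 (fun h => g (h *: delta_mx 0 it + row3 0 x u)) 0.
  move=> _; apply: (is_derive_lineE g (row3 0 x u) (delta_mx 0 it) y 0).1.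
  by rewrite row3_line addr0; apply: gt; apply: base_row3.
by have := derive0_const (@is_intervalT R) D (Logic.I : setT t) (Logic.I : setT 0); rewrite !row3_line !addr0.
Qed.

Lemma const_xu g : (forall b, base b -> is_derive b (delta_mx 0 ix) g 0) ->
  (forall b, base b -> is_derive b (delta_mx 0 iu) g 0) ->
  forall b, base b -> g b = g (row3 (b 0 it) 0 1).
Proof.
move=> gx gu b b0; rewrite {1}[b]row3_eta (const_u gu) ?(const_x gx) //; exact: ltr01.
Qed.

Lemma partial_on f g i b : base b -> (forall b, base b -> f b = g b) ->
  partial i f b = partial i g b.
Proof. exact: (eq_partial i (@open_base_space R)). Qed.

Lemma partial_zero f i : (forall b, base b -> f b = 0) ->
  forall b, base b -> partial i f b = 0.
Proof.
move=> f0 b b0; rewrite (@partial_on f (cst 0)) //.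
exact: (partialE setT (is_derive_cst 0 b (delta_mx 0 i))).
Qed.

Lemma smooth_is_derive0 f i : smooth_on base f ->
  (forall b, base b -> partial i f b = 0) ->
  forall b, base b -> is_derive b (delta_mx 0 i) f 0.
Proof.
move=> sf f0 b b0; rewrite -[X in is_derive _ _ _ X](f0 b b0).
exact: (smooth_is_derive i sf b0).
Qed.

Lemma smooth_time f : smooth_on base f -> smooth1_on setT (fun t => f (row3 t 0 1)).
Proof.
move=> sf; have S := @smooth_line R 3 base f it (row3 0 0 1) (@open_base_space R) sf.
have E : (fun t => f (row3 t 0 1)) = (fun h => f (h *: delta_mx 0 it + row3 0 0 1)).
  by apply/funext => t; rewrite row3_line addr0.
rewrite E; apply: smooth1_sub S => t _ /=.
by rewrite row3_line; apply: base_row3; exact: ltr01.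
Qed.

Lemma time_is_derive (g : R -> R) b i (a : R) : is_derive (b 0 it) 1 g a ->
  is_derive b (delta_mx 0 i) (fun b => g (b 0 it)) (a * (i == it)%:R).
Proof.
move=> ga; have := is_derive_compf (is_derive_coord b (delta_mx 0 i) it) ga.
by rewrite mxE eqxx /= eq_sym.
Qed.

Lemma time_partial f (g : R -> R) i b : base b -> smooth1_on setT g ->
  (forall b, base b -> f b = g (b 0 it)) ->
  partial i f b = derive1 g (b 0 it) * (i == it)%:R.
Proof.
move=> b0 sg fg; rewrite (partial_on i b0 fg).
exact: (partialE setT (time_is_derive i (smoothT_is_derive sg (b 0 it)))).
Qed.

End BaseSpace.

(** The general solution of the determining equations. The coefficients at A, B, C and Q give every
    term of the equation the weight of u_t; the summand - f_t at Q offsets the term f_t u produced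
    by prolonging eta = f u. *)
Definition affine_generator (R : realType) (tau : R -> R) (c1 c2 : R) (f : R -> R) :
    generator R :=
  Generator
    (fun i b => row3 (tau (b 0 it)) (c1 * b 0 ix + c2) (f (b 0 it) * b 0 iu) 0 i)
    (fun i p =>
       let t := lsubmx p 0 it in let n := rsubmx p 0 iN in
       row5 ((c1 - derive1 tau t - n * f t) * rsubmx p 0 iA)
            ((3 * c1 - derive1 tau t) * rsubmx p 0 iB)
            ((c1 - derive1 tau t - 2 * n * f t) * rsubmx p 0 iC)
            (- derive1 tau t * rsubmx p 0 iQ - derive1 f t) 0 0 i).

(** * Solving the determining equations *)

Section Determining.
Variables (R : realType) (Y : generator R).
Hypothesis HY : equivalence_generator Y.
Notation base := (@base_space R).
Notation tau := (zeta Y it).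
Notation xi := (zeta Y ix).
Notation eta := (zeta Y iu).
Notation pt := (partial it).
Notation px := (partial ix).
Notation pu := (partial iu).
Implicit Types (b : 'rV[R]_3) (e : 'rV[R]_5).

Definition make_jet b (ut a1 a2 a3 : R) : 'rV[R]_(3 + 6) :=
  row_mx b (\row_i tnth [tuple ut; a1; 0; a2; 0; a3] i).

Lemma make_jetE b ut a1 a2 a3 : (lsubmx (make_jet b ut a1 a2 a3) = b) *
  (jcoord jt (make_jet b ut a1 a2 a3) = ut) * (jcoord jx (make_jet b ut a1 a2 a3) = a1) *
  (jcoord jxx (make_jet b ut a1 a2 a3) = a2) * (jcoord jxxx (make_jet b ut a1 a2 a3) = a3).
Proof.
by rewrite /make_jet row_mxKl; do !split; rewrite /jcoord /jder row_mxEr mxE (tnth_nth 0).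
Qed.

Definition regular e := [/\ 0 < e 0 iN, e 0 iB != 0, e 0 iC != 0 & e 0 iQ != 0].

Let sz i : smooth_on base (zeta Y i) := HY.1.1 i.

(** The equation can be solved for u_t, so the point, the elements and u_x, u_xx, u_xxx are free
    parameters of the criterion. *)
Lemma criterion b e a1 a2 a3 (Th : 'M[R]_(5, 3)) : base b -> regular e ->
  (forall i j, auxiliary i j -> Th i j = 0) ->
  let u := b 0 iu in
  let ut := - (e 0 iA * u `^ e 0 iN * a1 + e 0 iC * u `^ (2 * e 0 iN) * a1
    + e 0 iB * a3 + e 0 iQ * u) in
  pr_kdv Y (make_jet b ut a1 a2 a3) e = 0 /\
  forall i j, auxiliary i j -> pr_element Y (row_mx b e) Th i j = 0.
Proof.
move=> b0 [n0 B0 C0 Q0] Th0 u ut.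
have [] // := HY.2 (make_jet b ut a1 a2 a3) e Th.
- by rewrite /aug_space /= row_mxKl row_mxKr make_jetE.
- have -> : make_jet b ut a1 a2 a3 0 (jbase iu) = u by rewrite /make_jet row_mxEl.
  by rewrite !make_jetE /kdv /ut; ring.
- by rewrite make_jetE.
Qed.

Lemma pr_element_eq0 b e (Th : 'M[R]_(5, 3)) : base b -> regular e ->
  (forall i j, auxiliary i j -> Th i j = 0) ->
  forall i j, auxiliary i j -> pr_element Y (row_mx b e) Th i j = 0.
Proof. by move=> b0 re Th0; have [] := criterion 0 0 0 b0 re Th0. Qed.

(** Setting all derivatives of the arbitrary elements to 0 respects the auxiliary system and removes
    both sums from the prolongation formula. *)
Lemma omega_partial0 b e i j : base b -> regular e -> auxiliary i j ->
  partial (lshift 5 j) (omega Y i) (row_mx b e) = 0.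
Proof.
move=> b0 re aij.
have Z : forall i j, auxiliary i j -> (0 : 'M[R]_(5, 3)) i j = 0 by move=> *; rewrite mxE.
have := pr_element_eq0 b0 re Z aij.
rewrite /pr_element !big1 ?subr0 ?addr0 //; by move=> k _; rewrite mxE mul0r.
Qed.

Definition unit_elements : 'rV[R]_5 := row5 1 1 1 1 1.

Lemma regular_unit : regular unit_elements.
Proof. by rewrite /regular !row5E oner_neq0. Qed.

Lemma tau_partial0 b j : base b -> j != it -> partial j tau b = 0.
Proof.
(* The auxiliary system leaves A_t free. With A_t = 1 and all other derivatives 0, and the
   derivative of the coefficient at A already known to vanish, the prolongation formula reduces to
   minus the derivative of tau. *)
move=> b0 jt; pose Th : 'M[R]_(5, 3) := delta_mx iA it.
have Th0 i k : auxiliary i k -> Th i k = 0.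
  rewrite /auxiliary mxE => /orP[/eqP -> //|/negbTE ->].
  by rewrite andbF.
have aij : auxiliary iA j by rewrite /auxiliary jt orbT.
have := pr_element_eq0 b0 regular_unit Th0 aij.
rewrite /pr_element (omega_partial0 b0 regular_unit aij) row_mxKl add0r.
rewrite big1 ?add0r; last by move=> l _; rewrite mxE (negbTE jt) andbF mul0r.
rewrite (bigD1 it) //= big1 ?addr0; last first.
  by move=> k kt; rewrite mxE (negbTE kt) andbF mul0r.
by rewrite mxE !eqxx mul1r => /eqP; rewrite oppr_eq0 => /eqP.
Qed.

Let tau_x b : base b -> px tau b = 0.
Proof. by move=> b0; apply: tau_partial0. Qed.
Let tau_u b : base b -> pu tau b = 0.
Proof. by move=> b0; apply: tau_partial0. Qed.

Definition om i b e := omega Y i (row_mx b e).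

Let L b e := om iN b e * ln (b 0 iu) + e 0 iN * eta b / b 0 iu.

Lemma lie_equation b e : base b -> regular e ->
  let u := b 0 iu in let A := e 0 iA in let B := e 0 iB in let C := e 0 iC in
  let Q := e 0 iQ in let U := u `^ e 0 iN in let V := u `^ (2 * e 0 iN) in
  forall a1 a2 a3,
  lie_poly A B C Q u U V (L b e) (om iA b e) (om iB b e) (om iC b e) (om iQ b e)
    (eta b) (pt eta b) (px eta b) (pu eta b) (px (pu eta) b)
    (pu (pu eta) b) (pt tau b) (pt xi b) (px xi b) (pu xi b) (px (px xi) b)
    (px (pu xi) b) (pu (pu xi) b)
    (fun a => px (px (px eta)) b + a * pu (px (px eta)) b)
    (fun a => px (px (pu eta)) b + a * pu (px (pu eta)) b)
    (fun a => px (pu (pu eta)) b + a * pu (pu (pu eta)) b)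
    (fun a => px (px (px xi)) b + a * pu (px (px xi)) b)
    (fun a => px (px (pu xi)) b + a * pu (px (pu xi)) b)
    (fun a => px (pu (pu xi)) b + a * pu (pu (pu xi)) b)
    (- (A * U * a1 + C * V * a1 + B * a3 + Q * u)) a1 a2 a3 = 0.
Proof.
move=> b0 re u A B C Q U V a1 a2 a3.
have Z : forall i j, auxiliary i j -> (0 : 'M[R]_(5, 3)) i j = 0 by move=> *; rewrite mxE.
have [+ _] := criterion a1 a2 a3 b0 re Z.
rewrite -/u -/A -/B -/C -/Q -/U -/V; set ut := - _; set z := make_jet _ _ _ _ _.
have Jz : jet_space z by rewrite /jet_space /= make_jetE.
have E1 := eta_tE sz Jz; have E2 := eta_xE sz tau_x tau_u Jz.
have E3 := eta_xxxE sz tau_x tau_u Jz.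
have E4 := pr_kdvE Y e Jz.
move: E1 E2 E3 E4; rewrite /Xd /on_jets !make_jetE tau_u // => E1 E2 E3 E4.
rewrite E4 E1 E2 E3 => <-; rewrite /lie_poly -/u -/A -/B -/C -/Q -/U -/V /L /om.
by rewrite mulr0.
Qed.

Let oB : open base := @open_base_space R.
Let sp i j : smooth_on base (partial j (zeta Y i)) := smooth_partial j (sz i).
Let e1 := unit_elements.
Let re1 : regular e1 := regular_unit.
Let e1B : e1 0 iB = 1. Proof. by rewrite row5E. Qed.

Lemma xi_u b : base b -> pu xi b = 0.
Proof.
move=> b0; apply: (lie_poly_ku (lie_equation b0 re1)).
by rewrite e1B oner_neq0.
Qed.

Lemma eta_xu b : base b -> px (pu eta) b = px (px xi) b.
Proof.
move=> b0; apply: (lie_poly_hxu (lie_equation b0 re1)).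
by rewrite e1B oner_neq0.
Qed.

Lemma om_B b e : base b -> regular e -> om iB b e = (3 * px xi b - pt tau b) * e 0 iB.
Proof. by move=> b0 re; apply: (lie_poly_oB (lie_equation b0 re)). Qed.

Lemma eta_uu b : base b -> pu (pu eta) b = 0.
Proof.
move=> b0; apply: (lie_poly_huu (lie_equation b0 re1)).
- by rewrite e1B oner_neq0.
- exact: (partial_zero _ xi_u).
- exact: (partial_zero _ xi_u).
Qed.

Lemma om_line_is_derive i b e j : base b -> regular e -> j != it ->
  is_derive b (delta_mx 0 j) (fun b => om i b e) 0.
Proof.
move=> b0 re jt; apply/is_derive_line.
have -> : (fun h : R => om i (h *: delta_mx 0 j + b) e) =
   (fun h => omega Y i (h *: delta_mx 0 (lshift 5 j) + row_mx b e)).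
  apply/funext => h; rewrite /om; congr (omega Y i _).
  apply/rowP; apply: ord8P => k.
    by rewrite row_mxEl !mxE (@unsplitK 3 5 (inl k)) (inj_eq (@lshift_inj _ _)).
  by rewrite row_mxEr !mxE (@unsplitK 3 5 (inr k)) eq_rlshift andbF mulr0 add0r.
apply: (is_derive_line _ _ _ _).1.
have aij : auxiliary i j by rewrite /auxiliary jt orbT.
rewrite -[X in is_derive _ _ _ X](omega_partial0 b0 re aij).
apply: (smooth_is_derive _ (HY.1.2 i)).
by rewrite /aug_space /= row_mxKl row_mxKr; split=> //; case: re.
Qed.

Lemma om_time i b e : base b -> regular e -> om i b e = om i (row3 (b 0 it) 0 1) e.
Proof.
move=> b0 re; exact: (@const_xu R (fun b => om i b e)
  (fun c c0 => om_line_is_derive i c0 re (isT : ix != it))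
  (fun c c0 => om_line_is_derive i c0 re (isT : iu != it)) b b0).
Qed.

Lemma tau_time b : base b -> tau b = tau (row3 (b 0 it) 0 1).
Proof.
by move=> b0; apply: const_xu => //; apply: smooth_is_derive0 => // c c0;
  apply: tau_partial0.
Qed.

Let tau1 t := tau (row3 t 0 1).
Let stau1 : smooth1_on setT tau1 := smooth_time (sz it).

Lemma tau_t b : base b -> pt tau b = derive1 tau1 (b 0 it).
Proof.
by move=> b0; rewrite (time_partial it b0 stau1 tau_time) eqxx mulr1.
Qed.

(** At unit elements [om_B] expresses 3 xi_x as the coefficient at B plus tau_t, and neither of
    these depends on x. *)
Lemma xi_xx b : base b -> px (px xi) b = 0.
Proof.
move=> b0.
have E c : base c -> px xi c = 3^-1 * (om iB c e1 + derive1 tau1 (c 0 it)).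
  by move=> c0; rewrite om_B // e1B mulr1 tau_t //; field.
rewrite (partial_on ix b0 E).
have Dt := time_is_derive ix (smoothT_is_derive (smooth1_derive1 stau1) (b 0 it)).
have D := is_deriveZf 3^-1 (is_deriveDf (om_line_is_derive iB b0 re1 (isT : ix != it)) Dt).
by rewrite (partialE setT D) mulr0 addr0 mulr0.
Qed.

Lemma xi_x_time b : base b -> px xi b = px xi (row3 (b 0 it) 0 1).
Proof.
move=> b0; apply: const_xu => //; apply: smooth_is_derive0 => // c c0.
  exact: xi_xx.
rewrite (partialC iu ix oB (sz ix) c0); exact: (partial_zero _ xi_u).
Qed.

Lemma eta_xu0 b : base b -> px (pu eta) b = 0.
Proof. by move=> b0; rewrite eta_xu // xi_xx. Qed.

Let phi t := pu eta (row3 t 0 1).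
Let sphi : smooth1_on setT phi := smooth_time (sp iu iu).

Lemma eta_u b : base b -> pu eta b = phi (b 0 it).
Proof.
by move=> b0; apply: const_xu => //; apply: smooth_is_derive0 => // c c0;
  [exact: eta_xu0|exact: eta_uu].
Qed.

Lemma eta_affine t x u : 0 < u ->
  eta (row3 t x u) = phi t * u + (eta (row3 t x 1) - phi t).
Proof.
move=> u0; have D c : base c -> is_derive c (delta_mx 0 iu)
    (fun c => eta c - phi (c 0 it) * c 0 iu) 0.
  move=> c0.
  have Dp := time_is_derive iu (smoothT_is_derive sphi (c 0 it)).
  have := is_deriveBf (smooth_is_derive iu (sz iu) c0)
    (is_deriveMf Dp (is_derive_coord c (delta_mx 0 iu) iu)).
  move/is_derive_eq; apply; rewrite eta_u // mxE /=; ring.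
have := const_u D t x u0; rewrite !row3E; lra.
Qed.

Lemma ux_equation b e : base b -> regular e ->
  let U := b 0 iu `^ e 0 iN in let V := b 0 iu `^ (2 * e 0 iN) in
  - pt xi b + (e 0 iA * U + e 0 iC * V) * (pt tau b - px xi b)
  + om iA b e * U + om iC b e * V
  + (om iN b e * ln (b 0 iu) + e 0 iN * eta b / b 0 iu) * (e 0 iA * U + 2 * e 0 iC * V) = 0.
Proof.
move=> b0 re.
have Zx i f : (forall c, base c -> f c = 0) -> partial i f b = 0.
  by move=> f0; exact: (partial_zero i f0 b0).
have Eu c : base c -> pu (px eta) c = 0.
  by move=> c0; rewrite (partialC iu ix oB (sz iu) c0) eta_xu0.
have Z2 f : (forall c, base c -> f c = 0) -> px f b + 1 * pu f b = 0.
  by move=> f0; rewrite (Zx ix f f0) (Zx iu f f0) mulr0 addr0.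
have Q : pu (px (px eta)) b = 0 := etrans (partialC iu ix oB (sp iu ix) b0) (Zx ix _ Eu).
have E1 : px (px (px eta)) b + 1 * pu (px (px eta)) b =
          px (px (px eta)) b + 0 * pu (px (px eta)) b.
  by congr (_ + _); rewrite Q !mulr0.
exact: (lie_poly_ux (lie_equation b0 re) (xi_u b0) E1 (Z2 _ eta_xu0)
  (Z2 _ eta_uu) (Z2 _ xi_xx) (Z2 _ (fun c c0 => partial_zero ix xi_u c0))
  (Z2 _ (fun c c0 => partial_zero iu xi_u c0))).
Qed.

Lemma xi_t_time t x u : 0 < u -> pt xi (row3 t x u) = pt xi (row3 t x 1).
Proof.
move=> u0; apply: const_u u0 => c c0; apply: smooth_is_derive0 c0; first exact: sp.
move=> d d0; rewrite (partialC iu it oB (sz ix) d0); exact: (partial_zero _ xi_u).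
Qed.

(** With eta = phi u + g, where g does not depend on u, the equation for u_x at n = 3 and u = 2^j
    becomes the system of [powers_n3]; both xi_t and g are among its unknowns. *)
Lemma xi_t_eta0 t x : pt xi (row3 t x 1) = 0 /\ eta (row3 t x 1) - phi t = 0.
Proof.
pose e3 : 'rV[R]_5 := row5 1 1 1 1 3%:R.
have re3 : regular e3 by rewrite /regular !row5E oner_neq0 ltr0n.
set k := pt xi _; set g := _ - _.
pose tt := pt tau (row3 t 0 1); pose kx := px xi (row3 t 0 1).
pose o i := om i (row3 t 0 1) e3.
have [] // := @powers_n3 R (- k) ((tt - kx) + o iA + 3 * phi t) ((tt - kx) + o iC + 6 * phi t)
  (o iN * ln 2) g; last by move=> /eqP; rewrite oppr_eq0 => /eqP -> ->.
move=> j; set u : R := 2 ^+ j.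
have u0 : 0 < u by rewrite exprn_gt0.
have b0 := base_row3 t x u0.
have := ux_equation b0 re3.
rewrite !(om_time _ b0 re3) tau_t // (xi_x_time b0) !row3E !row5E.
have -> : derive1 tau1 t = tt by rewrite /tt tau_t ?row3E //; apply: base_row3.
rewrite (xi_t_time t x u0) -/k eta_affine // -/g -/kx -/(o iA) -/(o iC) -/(o iN).
have -> : (2 * 3%:R : R) = 6%:R by ring.
rewrite !powR_mulrn ?ltW // lnXn ?ltr0n //.
have E8 : u ^+ 3 = 8 ^+ j by rewrite /u -exprM mulnC exprM; congr (_ ^+ _); ring.
have E64 : u ^+ 6 = 64 ^+ j by rewrite /u -exprM mulnC exprM; congr (_ ^+ _); ring.
have E4 : u ^+ 2 = 4 ^+ j by rewrite /u -exprM mulnC exprM; congr (_ ^+ _); ring.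
have E32 : u ^+ 5 = 32 ^+ j by rewrite /u -exprM mulnC exprM; congr (_ ^+ _); ring.
rewrite -E8 -E64 -E4 -E32 -[ln 2 *+ j]mulr_natl.
have un : u != 0 by rewrite gt_eqF.
move: un; generalize (tt : R) kx (o iA) (o iC) (o iN) (phi t) g k u (ln 2 : R) (j%:R : R).
move=> tt' kx' oA oC oN p g' k' u' l n un <-; field.
exact: un.
Qed.

Lemma xi_t b : base b -> pt xi b = 0.
Proof.
by move=> b0; rewrite [b]row3_eta xi_t_time // (xi_t_eta0 _ _).1.
Qed.

Lemma eta_linear b : base b -> eta b = phi (b 0 it) * b 0 iu.
Proof.
by move=> b0; rewrite {1}[b]row3_eta eta_affine // (xi_t_eta0 _ _).2 addr0.
Qed.

Let c1 := px xi (row3 0 0 1).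
Let c2 := xi (row3 0 0 1).

Lemma xi_x b : base b -> px xi b = c1.
Proof.
move=> b0; rewrite (xi_x_time b0); apply: const_t; last exact: ltr01.
apply: smooth_is_derive0; first exact: sp.
move=> c c0; rewrite (partialC it ix oB (sz ix) c0); exact: (partial_zero _ xi_t).
Qed.

Lemma xi_affine b : base b -> xi b = c1 * b 0 ix + c2.
Proof.
move=> b0; pose g c := xi c - c1 * c 0 ix.
have Dg i c : base c -> is_derive c (delta_mx 0 i) g (partial i xi c - c1 * (ix == i)%:R).
  move=> c0; have := is_deriveBf (smooth_is_derive i (sz ix) c0)
    (is_deriveZf c1 (is_derive_coord c (delta_mx 0 i) ix)).
  by rewrite mxE.
have gt c : base c -> is_derive c (delta_mx 0 it) g 0.
  by move=> c0; have := Dg it c c0; rewrite xi_t // mulr0 subr0.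
have gx c : base c -> is_derive c (delta_mx 0 ix) g 0.
  by move=> c0; have := Dg ix c c0; rewrite xi_x // mulr1 subrr.
have gu c : base c -> is_derive c (delta_mx 0 iu) g 0.
  by move=> c0; have := Dg iu c c0; rewrite xi_u // mulr0 subr0.
have := const_xu gx gu b0.
rewrite (const_t gt (b 0 it) 0 ltr01) /g row3E mulr0 subr0 => H.
by rewrite -[LHS](subrK (c1 * b 0 ix)) H addrC.
Qed.

Lemma om_ACN b e : base b -> regular e ->
  [/\ om iN b e = 0,
      om iA b e = (c1 - derive1 tau1 (b 0 it) - e 0 iN * phi (b 0 it)) * e 0 iA &
      om iC b e = (c1 - derive1 tau1 (b 0 it) - 2 * e 0 iN * phi (b 0 it)) * e 0 iC].
Proof.
move=> b0 re; have [n0 B0 C0 Q0] := re.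
rewrite !(om_time _ b0 re); set t := b 0 it; set A := e 0 iA; set C := e 0 iC.
set n := e 0 iN in n0 *; set f := phi t; set d := derive1 tau1 t.
set oA := om iA _ e; set oC := om iC _ e; set oN := om iN _ e.
have l2 : ln 2 != 0 :> R by rewrite gt_eqF // ln_gt0 // ltr1n.
have nn : n != 0 by rewrite gt_eqF.
have [] := @powers_n R A C (A * (d - c1) + oA + n * f * A) (C * (d - c1) + oC + 2 * n * f * C)
  (oN * ln 2 / n) C0.
  (* Here u^n = 2^j and ln u = j ln 2 / n, so dividing the equation by u^n gives the shape of
     [powers_n]. *)
  move=> j; pose u : R := expR (j%:R * ln 2 / n).
  have u0 : 0 < u by apply: expR_gt0.
  have c0 := base_row3 t 0 u0.
  have := ux_equation c0 re; cbv zeta.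
  rewrite xi_t // oppr0 add0r !(om_time _ c0 re) tau_t // xi_x // eta_linear // !row3E.
  rewrite -/oA -/oC -/oN -/A -/C -/n -/f -/d.
  have E2 : expR (j%:R * ln 2) = 2 ^+ j :> R.
    by rewrite expRM_natl lnK // posrE ltr0n.
  have EU : u `^ n = 2 ^+ j by rewrite /u -expRM divfK.
  have EV : u `^ (2 * n) = 2 ^+ j * 2 ^+ j.
    rewrite /u -expRM -{1 2}E2 -expRD; congr expR; field; exact: nn.
  have El : ln u = j%:R * ln 2 / n by rewrite /u expRK.
  have Ef : n * (f * u) / u = n * f by field; rewrite gt_eqF.
  rewrite EU EV El Ef => H.
  have p0 : (2 ^+ j : R) != 0 by rewrite expf_neq0.
  apply: (mulfI p0); rewrite mulr0 -[RHS]H; ring.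
move=> w a0 c0'; split.
- move/eqP: w; rewrite !mulf_eq0 invr_eq0 (negbTE nn) (negbTE l2) !orbF; exact: eqP.
- by lra.
- by lra.
Qed.

(** This is the part of the condition free of u_x, u_xx and u_xxx; since eta = phi u, each of its
    terms is a multiple of u. *)
Lemma om_Q b e : base b -> regular e ->
  om iQ b e = - derive1 tau1 (b 0 it) * e 0 iQ - derive1 phi (b 0 it).
Proof.
move=> b0 re; have u0 : 0 < b 0 iu := b0.
have hx c : base c -> px eta c = 0.
  move=> c0; rewrite (partial_on ix c0 eta_linear).
  have Dp := time_is_derive ix (smoothT_is_derive sphi (c 0 it)).
  rewrite (partialE setT (is_deriveMf Dp (is_derive_coord c (delta_mx 0 ix) iu))).
  by rewrite mxE /= !mulr0 mul0r addr0.
have ht : pt eta b = derive1 phi (b 0 it) * b 0 iu.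
  rewrite (partial_on it b0 eta_linear).
  have Dp := time_is_derive it (smoothT_is_derive sphi (b 0 it)).
  rewrite (partialE setT (is_deriveMf Dp (is_derive_coord b (delta_mx 0 it) iu))).
  by rewrite mxE /= mulr0 addr0 mulr1.
have := lie_poly_const (lie_equation b0 re) (hx b b0).
rewrite (partial_zero ix (fun c c0 => partial_zero ix hx c0) b0) mul0r addr0 => /(_ erefl).
rewrite ht eta_linear // eta_u // tau_t // => H.
have un : b 0 iu != 0 by rewrite gt_eqF.
apply: (mulIf un); move: H.
generalize (om iQ b e) (b 0 iu) (e 0 iQ) (derive1 tau1 (b 0 it)) (derive1 phi (b 0 it)) (phi (b 0 it)).
move=> *; lra.
Qed.

Theorem determining_equations : exists (ta : R -> R) (k1 k2 : R) (f : R -> R),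
  [/\ smooth1_on setT ta, smooth1_on setT f,
      forall i b, base b -> zeta Y i b = zeta (affine_generator ta k1 k2 f) i b
    & forall i b e, base b -> regular e ->
        omega Y i (row_mx b e) = omega (affine_generator ta k1 k2 f) i (row_mx b e)].
Proof.
exists tau1, c1, c2, phi; split=> //.
  apply: ord3P => b b0 /=; rewrite row3E.
  - exact: tau_time.
  - exact: xi_affine.
  - exact: eta_linear.
move=> i b e b0 re; have [oN oA oC] := om_ACN b0 re.
move: i; apply: ord5P; rewrite /= row_mxKl row_mxKr row5E -/(om _ b e).
- exact: oA.
- by rewrite om_B // xi_x // tau_t.
- exact: oC.
- exact: om_Q.
- exact: oN.
Qed.

End Determining.

(** * Sufficiency of the determining equations *)

Section AffineGenerators.
Variables (R : realType) (ta : R -> R) (c1 c2 : R) (f : R -> R).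
Hypotheses (sta : smooth1_on setT ta) (sf : smooth1_on setT f).
Notation Y := (affine_generator ta c1 c2 f).
Notation base := (@base_space R).
Notation aug := (@aug_space R).
Let oB : open base := @open_base_space R.
Let oA : open aug := @open_aug_space R.

Lemma affine_zetaE (b : 'rV[R]_3) : (zeta Y it b = ta (b 0 it)) *
  (zeta Y ix b = c1 * b 0 ix + c2) * (zeta Y iu b = f (b 0 it) * b 0 iu).
Proof. by rewrite /= !row3E. Qed.

Lemma affine_zeta_smooth i : smooth_on base (zeta Y i).
Proof.
have sc j := @smooth_coord R 3 base j oB.
have st (g : R -> R) : smooth1_on setT g -> smooth_on base (fun b => g (b 0 it)).
  by move=> sg; exact: (smooth_comp1 oB (sc it) sg (fun _ _ => Logic.I)).
move: i; apply: ord3P.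
- by rewrite (funext (fun b => (affine_zetaE b).1.1)); apply: st.
- rewrite (funext (fun b => (affine_zetaE b).1.2)).
  exact: (smoothD oB (@smoothZ R 3 base _ c1 oB (sc ix)) (@smooth_cst R 3 base c2 oB)).
- rewrite (funext (fun b => (affine_zetaE b).2)).
  exact: (smoothM oB (st f sf) (sc iu)).
Qed.

Lemma affine_omegaE (p : 'rV[R]_(3 + 5)) :
  let t := p 0 (lshift 5 it) in let n := p 0 (rshift 3 iN) in
  (omega Y iA p = (c1 - derive1 ta t - n * f t) * p 0 (rshift 3 iA)) *
  (omega Y iB p = (3 * c1 - derive1 ta t) * p 0 (rshift 3 iB)) *
  (omega Y iC p = (c1 - derive1 ta t - 2 * n * f t) * p 0 (rshift 3 iC)) *
  (omega Y iQ p = - derive1 ta t * p 0 (rshift 3 iQ) - derive1 f t) *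
  (omega Y iN p = 0).
Proof. by cbv zeta; rewrite -!lsubmx_coord -!rsubmx_coord /= !row5E. Qed.

Lemma affine_omega_smooth i : smooth_on aug (omega Y i).
Proof.
have sc j := @smooth_coord R (3 + 5) aug j oA.
have st (g : R -> R) : smooth1_on setT g -> smooth_on aug (fun p => g (p 0 (lshift 5 it))).
  by move=> sg; exact: (smooth_comp1 oA (sc (lshift 5 it)) sg (fun _ _ => Logic.I)).
have sk c := @smooth_cst R (3 + 5) aug c oA.
have std := st _ (smooth1_derive1 sta).
have sN := sc (rshift 3 iN).
move: i; apply: ord5P.
- rewrite (funext (fun p => (affine_omegaE p).1.1.1.1)).
  exact: (smoothM oA (smoothB oA (smoothB oA (sk c1) std) (smoothM oA sN (st f sf))) (sc (rshift 3 iA))).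
- rewrite (funext (fun p => (affine_omegaE p).1.1.1.2)).
  exact: (smoothM oA (smoothB oA (sk (3 * c1)) std) (sc (rshift 3 iB))).
- rewrite (funext (fun p => (affine_omegaE p).1.1.2)).
  exact: (smoothM oA (smoothB oA (smoothB oA (sk c1) std) (smoothM oA (smoothM oA (sk 2) sN)
    (st f sf))) (sc (rshift 3 iC))).
- rewrite (funext (fun p => (affine_omegaE p).1.2)).
  exact: (smoothB oA (smoothM oA (smoothN oA std) (sc (rshift 3 iQ))) (st _ (smooth1_derive1 sf))).
- rewrite (funext (fun p => (affine_omegaE p).2)); exact: sk.
Qed.

Let sz i := affine_zeta_smooth i.

Lemma affine_tau b j : base b ->
  partial j (zeta Y it) b = derive1 ta (b 0 it) * (j == it)%:R.
Proof.
by move=> b0; apply: (time_partial j b0 sta) => c _; rewrite affine_zetaE.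
Qed.

Lemma affine_xi b j : base b -> partial j (zeta Y ix) b = c1 * (ix == j)%:R.
Proof.
move=> b0; rewrite (funext (fun b => (affine_zetaE b).1.2)).
have := partialE setT (is_derive_addr c2 (is_deriveZf c1 (is_derive_coord b (delta_mx 0 j) ix))).
by rewrite mxE.
Qed.

Lemma affine_eta b j : base b -> partial j (zeta Y iu) b =
  derive1 f (b 0 it) * (j == it)%:R * b 0 iu + f (b 0 it) * (iu == j)%:R.
Proof.
move=> b0; rewrite (funext (fun b => (affine_zetaE b).2)).
have Dt := time_is_derive j (smoothT_is_derive sf (b 0 it)).
have := partialE setT (is_deriveMf Dt (is_derive_coord b (delta_mx 0 j) iu)).
by rewrite mxE.
Qed.

(** The prolonged generator multiplies the left-hand side of the equation by f - tau_t, hence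
    annihilates it on solutions. *)
Lemma affine_pr_kdv (z : 'rV[R]_(3 + 6)) (e : 'rV[R]_5) :
  aug (row_mx (lsubmx z) e) ->
  kdv e (z 0 (jbase iu)) (jcoord jt z) (jcoord jx z) (jcoord jxxx z) = 0 ->
  pr_kdv Y z e = 0.
Proof.
move=> pz kdv0; have Jz : jet_space z.
  by move: pz; rewrite /aug_space /= row_mxKl => -[].
have b0 : base (lsubmx z) := Jz.
have tx b : base b -> partial ix (zeta Y it) b = 0 by move=> c0; rewrite affine_tau // mulr0.
have tu b : base b -> partial iu (zeta Y it) b = 0 by move=> c0; rewrite affine_tau // mulr0.
have xu b : base b -> partial iu (zeta Y ix) b = 0 by move=> c0; rewrite affine_xi // mulr0.
have xx b : base b -> partial ix (zeta Y ix) b = c1 by move=> c0; rewrite affine_xi // mulr1.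
have xt b : base b -> partial it (zeta Y ix) b = 0 by move=> c0; rewrite affine_xi // mulr0.
have hx b : base b -> partial ix (zeta Y iu) b = 0.
  by move=> c0; rewrite affine_eta // !mulr0 mul0r addr0.
have hu b : base b -> partial iu (zeta Y iu) b = f (b 0 it).
  by move=> c0; rewrite affine_eta // !mulr0 mul0r add0r mulr1.
have Dk i b : base b -> partial i (partial ix (zeta Y ix)) b = 0.
  move=> c0; rewrite (@partial_on _ _ (cst c1) i b c0 xx).
  exact: (partialE setT (is_derive_cst c1 b (delta_mx 0 i))).
have Dh i b : base b -> i != it -> partial i (partial iu (zeta Y iu)) b = 0.
  by move=> c0 ni; rewrite (time_partial i c0 sf hu) (negbTE ni) mulr0.
have Z i g : (forall c, base c -> g c = 0) -> partial i g (lsubmx z) = 0.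
  by move=> g0; exact: (partial_zero i g0 b0).
have Z2 i j g : (forall c, base c -> g c = 0) -> partial i (partial j g) (lsubmx z) = 0.
  by move=> g0; exact: (Z i _ (partial_zero j g0)).
have X2 : partial ix (partial iu (zeta Y iu)) (lsubmx z) = 0 by exact: Dh.
have X3 : partial iu (partial iu (zeta Y iu)) (lsubmx z) = 0 by exact: Dh.
have E1 : eta_t Y z = derive1 f (lsubmx z 0 it) * lsubmx z 0 iu
    + jcoord jt z * f (lsubmx z 0 it) - jcoord jt z * derive1 ta (lsubmx z 0 it).
  rewrite (eta_tE sz Jz) /on_jets (hu _ b0) (tu _ b0) (xt _ b0) (xu _ b0).
  rewrite (affine_eta it b0) (affine_tau it b0) /=; ring.
have E2 : eta_x Y z = jcoord jx z * f (lsubmx z 0 it) - jcoord jx z * c1.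
  rewrite (eta_xE sz tx tu Jz) /on_jets (hx _ b0) (hu _ b0) (xx _ b0) (xu _ b0); ring.
have E3 : eta_xxx Y z = jcoord jxxx z * (f (lsubmx z 0 it) - 3 * c1).
  move: (eta_xxxE sz tx tu Jz); rewrite /Xd /on_jets.
  move: (hu _ b0) (xx _ b0) (xu _ b0) X2 X3 (Dk ix _ b0) (Z ix _ xu) (Z iu _ xu).
  move: (Z2 ix ix _ hx) (Z2 iu ix _ hx) (Z2 ix ix _ xu) (Z2 iu ix _ xu)
    (Z2 ix iu _ xu) (Z2 iu iu _ xu) (Z ix _ (Dk ix)) (Z iu _ (Dk ix)).
  move: (Z ix _ (fun c c0 => Dh ix c c0 isT)) (Z iu _ (fun c c0 => Dh ix c c0 isT))
    (Z ix _ (fun c c0 => Dh iu c c0 isT)) (Z iu _ (fun c c0 => Dh iu c c0 isT)).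
  set px := partial ix; set pu := partial iu; set h := zeta Y iu; set k := zeta Y ix.
  generalize (px (px (px h)) (lsubmx z)) (pu (px (px h)) (lsubmx z))
    (px (px (pu h)) (lsubmx z)) (pu (px (pu h)) (lsubmx z))
    (px (pu (pu h)) (lsubmx z)) (pu (pu (pu h)) (lsubmx z))
    (px (px (px k)) (lsubmx z)) (pu (px (px k)) (lsubmx z))
    (px (px (pu k)) (lsubmx z)) (pu (px (pu k)) (lsubmx z))
    (px (pu (pu k)) (lsubmx z)) (pu (pu (pu k)) (lsubmx z)).
  generalize (px (pu h) (lsubmx z)) (pu (pu h) (lsubmx z)) (px (px k) (lsubmx z))
    (px (pu k) (lsubmx z)) (pu (pu k) (lsubmx z)) (pu h (lsubmx z)) (px k (lsubmx z))
    (pu k (lsubmx z)) (eta_xxx Y z) (jcoord jx z) (jcoord jxx z) (jcoord jxxx z).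
  by move=> * ; subst; ring.
rewrite (pr_kdvE Y e Jz) E1 E2 E3.
have EN : omega Y iN (row_mx (lsubmx z) e) = 0 by rewrite affine_omegaE.
have EA := (affine_omegaE (row_mx (lsubmx z) e)).1.1.1.1.
have EB := (affine_omegaE (row_mx (lsubmx z) e)).1.1.1.2.
have EC := (affine_omegaE (row_mx (lsubmx z) e)).1.1.2.
have EQ := (affine_omegaE (row_mx (lsubmx z) e)).1.2.
move: EA EB EC EQ; rewrite !row_mxEl !row_mxEr => -> -> -> ->; rewrite EN.
rewrite /on_jets (affine_zetaE (lsubmx z)).
move: kdv0; rewrite /kdv (_ : z 0 (jbase iu) = lsubmx z 0 iu); last by rewrite lsubmx_coord.
have un : lsubmx z 0 iu != 0 by rewrite gt_eqF.
move: un; generalize (jcoord jt z) (jcoord jx z) (jcoord jxxx z) (derive1 f (lsubmx z 0 it))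
   (derive1 ta (lsubmx z 0 it)) (f (lsubmx z 0 it)).
generalize (lsubmx z 0 iu `^ e 0 iN) (lsubmx z 0 iu `^ (2 * e 0 iN)) (ln (lsubmx z 0 iu)).
generalize (lsubmx z 0 iu) (e 0 iA) (e 0 iB) (e 0 iC) (e 0 iQ) (e 0 iN).
move=> u A B C Q n U V l ut ux uxxx f' d g un H.
have -> : n * (g * u) / u = n * g by field.
apply: (etrans (_ : _ = (g - d) * (ut + A * U * ux + C * V * ux + B * uxxx + Q * u))).
  by ring.
by rewrite H mulr0.
Qed.

Lemma affine_equivalence_generator : equivalence_generator Y.
Proof.
split; first by split=> i; [exact: affine_zeta_smooth|exact: affine_omega_smooth].
move=> z e Th pz _ _ _ kdv0 Th0; split; first exact: affine_pr_kdv.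
move=> i j aij; rewrite /pr_element.
have b0 : base (lsubmx z) by move: pz; rewrite /aug_space /= row_mxKl => -[].
have oN (k : 'I_(3 + 5)) p : partial k (omega Y iN) p = 0.
  rewrite (funext (fun p => (affine_omegaE p).2)).
  exact: (partialE setT (is_derive_cst 0 p (delta_mx 0 k))).
have [iNE|iNE] := eqVneq i iN.
  rewrite iNE oN !big1 ?addr0 ?subr0 //.
  - by move=> k _; rewrite Th0 ?mul0r // /auxiliary eqxx.
  - by move=> k _; rewrite oN mulr0.
have jt : j != it by move: aij; rewrite /auxiliary (negbTE iNE).
rewrite (@big1 _ _ _ _ _ _ (fun l => Th l j * _)); last first.
  by move=> l _; rewrite Th0 ?mul0r // /auxiliary jt orbT.
rewrite addr0 (bigD1 it) //= big1 ?addr0; last first.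
  by move=> k kt; rewrite Th0 ?mul0r // /auxiliary kt orbT.
rewrite row_mxKl affine_tau // (negbTE jt) !mulr0 subr0.
have line (h : R) : omega Y i (h *: delta_mx 0 (lshift 5 j) + row_mx (lsubmx z) e)
    = omega Y i (row_mx (lsubmx z) e).
  have C1 : (h *: delta_mx 0 (lshift 5 j) + row_mx (lsubmx z) e) 0 (lshift 5 it) =
      row_mx (lsubmx z) e 0 (lshift 5 it) :> R.
    by rewrite !mxE (inj_eq (@lshift_inj _ _)) [it == j]eq_sym (negbTE jt) andbF mulr0 add0r.
  have C2 k : (h *: delta_mx 0 (lshift 5 j) + row_mx (lsubmx z) e) 0 (rshift 3 k) =
      row_mx (lsubmx z) e 0 (rshift 3 k) :> R.
    by rewrite !mxE eq_rlshift andbF mulr0 add0r.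
  by move: i {aij iNE}; apply: ord5P; rewrite !affine_omegaE ?C1 ?C2.
apply: (partialE setT); apply/is_derive_line; rewrite (funext line).
exact: is_derive_cst.
Qed.

End AffineGenerators.

(** * Extension across zeros of B, C and Q *)

Section Extension.
Variable R : realType.
Notation base := (@base_space R).
Notation aug := (@aug_space R).

Lemma continuous_eq0_dnbhs (g : R -> R) : {for 0, continuous g} ->
  (\forall h \near 0^', g h = 0) -> g 0 = 0.
Proof.
move=> cg g0.
have L1 : g @ 0^' --> g 0 by apply/continuous_withinNx.
have L2 : g @ 0^' --> (0 : R).
  by apply/cvgrPdist_lt => e e0; apply: filterS g0 => h ->; rewrite subrr normr0.
exact: (cvg_unique _ L1 L2).
Qed.

Lemma near_shift_neq0 (c : R) : \forall h \near (0 : R)^', h + c != 0.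
Proof.
have [->|c0] := eqVneq c 0.
  by near=> h; rewrite addr0; near: h; exact: nbhs_dnbhs_neq.
have H : \forall h \near (0 : R), h + c != 0.
  have oS : open [set x : R | x != 0] by exact: open_neq.
  have cc : {for (0 : R), continuous (fun h : R => h + c)}.
    by apply: continuousD; [exact: cvg_id|exact: cvg_cst].
  apply: (cc [set x | x != 0]); rewrite /= add0r.
  exact: (near_in_open oS c0).
exact: (nbhs_dnbhs H).
Unshelve. all: by end_near. Qed.

Theorem determining_equations_aug (Y : generator R) : equivalence_generator Y ->
  exists (ta : R -> R) (k1 k2 : R) (f : R -> R),
  [/\ smooth1_on setT ta, smooth1_on setT f &
      forall p, aug p -> gen_field Y p = gen_field (affine_generator ta k1 k2 f) p].
Proof.
move=> HY; have [ta [k1 [k2 [f [sta sf Ez Eo]]]]] := determining_equations HY.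
exists ta, k1, k2, f; split=> // p [u0 n0]; rewrite /gen_field.
congr row_mx; apply/rowP => i; rewrite !mxE; first exact: Ez.
(* This direction moves B, C and Q only. For small nonzero h none of the three vanishes at
   [h *: d + p], so the formulas hold there and pass to the limit h = 0. *)
pose d : 'rV[R]_(3 + 5) := row_mx 0 (row5 0 1 1 1 0).
have pd h : lsubmx (h *: d + p) = lsubmx p.
  by rewrite linearD linearZ /= row_mxKl scaler0 add0r.
have qd h j : rsubmx (h *: d + p) 0 j = h * row5 0 1 1 1 0 0 j + rsubmx p 0 j.
  by rewrite linearD linearZ /= row_mxKr !mxE.
pose g h := omega Y i (h *: d + p) - omega (affine_generator ta k1 k2 f) i (h *: d + p).
have augd h : aug (h *: d + p).
  by split; rewrite ?pd // qd row5E mulr0 add0r.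
suff : g 0 = 0 by rewrite /g scale0r add0r => /eqP; rewrite subr_eq0 => /eqP.
apply: continuous_eq0_dnbhs.
  have cl F : smooth_on aug F -> {for 0, continuous (fun h : R => F (h *: d + p))}.
    move=> sF; apply: (@continuous_comp _ _ _ (fun h : R => h *: d + p) F).
      exact: continuous_line.
    exact: (smooth_continuous sF (augd 0)).
  apply: continuousB; first exact: (cl _ (HY.1.2 i)).
  exact: (cl _ (affine_omega_smooth k1 k2 sta sf i)).
near=> h; apply/eqP; rewrite subr_eq0; apply/eqP.
rewrite -[h *: d + p]hsubmxK pd; apply: Eo; first exact: u0.
split; rewrite qd row5E ?mulr1 ?mulr0 ?add0r //.
- by near: h; exact: near_shift_neq0.
- by near: h; exact: near_shift_neq0.
- by near: h; exact: near_shift_neq0.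
Unshelve. all: by end_near. Qed.

End Extension.

(** * Flows of equivalence generators *)

Section FlowOfAffineGenerator.
Variables (R : realType) (ta : R -> R) (c1 c2 : R) (f : R -> R).
Hypotheses (sta : smooth1_on setT ta) (sf : smooth1_on setT f).
Notation aff := (affine_generator ta c1 c2 f).
Variables (J : set R) (s : R) (Phi : 'rV[R]_(1 + (3 + 5)) -> 'rV[R]_(3 + 5)).
Variable W : set 'rV[R]_(1 + (3 + 5)).
Hypotheses (oJ : open J) (oW : open W).
Hypothesis WE : forall p (c : R), aug_over J p -> 0 <= c <= 1 -> W (at_time (c * s) p).
Hypothesis Phi0 : forall p, aug_over J p -> Phi (at_time 0 p) = p.
Hypothesis sPhi : forall k, smooth_on W (fun w => Phi w 0 k).
Hypothesis augPhi : forall w, W w -> aug_space (Phi w).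
Hypothesis flowPhi : forall w, W w -> forall k,
  partial ord0 (fun w' => Phi w' 0 k) w = gen_field aff (Phi w) 0 k.

(** Index of the initial time t among the arguments of the flow. *)
Let kt : 'I_(1 + (3 + 5)) := rshift 1 (lshift 5 it).
Let T w := Phi w 0 (lshift 5 it).
Let X w := Phi w 0 (lshift 5 ix).
Let U w := Phi w 0 (lshift 5 iu).
Let A w := Phi w 0 (rshift 3 iA).
Let B w := Phi w 0 (rshift 3 iB).
Let C w := Phi w 0 (rshift 3 iC).
Let Q w := Phi w 0 (rshift 3 iQ).
Let N w := Phi w 0 (rshift 3 iN).
Let V := partial kt T.
Let Ut := partial kt U.
Let sT : smooth_on W T := sPhi _.
Let sU : smooth_on W U := sPhi _.

Let flow_zeta w i : W w -> partial ord0 (fun w' => Phi w' 0 (lshift 5 i)) w = zeta aff i (lsubmx (Phi w)).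
Proof. by move=> Ww; rewrite flowPhi // row_mxEl mxE. Qed.

Let flow_omega w i : W w -> partial ord0 (fun w' => Phi w' 0 (rshift 3 i)) w = omega aff i (Phi w).
Proof. by move=> Ww; rewrite flowPhi // row_mxEr mxE. Qed.

Let dT w : W w -> partial ord0 T w = ta (T w).
Proof. by move=> Ww; rewrite (flow_zeta it Ww) affine_zetaE lsubmx_coord. Qed.
Let dX w : W w -> partial ord0 X w = c1 * X w + c2.
Proof. by move=> Ww; rewrite (flow_zeta ix Ww) affine_zetaE !lsubmx_coord. Qed.
Let dU w : W w -> partial ord0 U w = f (T w) * U w.
Proof. by move=> Ww; rewrite (flow_zeta iu Ww) affine_zetaE !lsubmx_coord. Qed.
Let dA w : W w -> partial ord0 A w = (c1 - derive1 ta (T w) - N w * f (T w)) * A w.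
Proof. by move=> Ww; rewrite (flow_omega iA Ww) affine_omegaE. Qed.
Let dB w : W w -> partial ord0 B w = (3 * c1 - derive1 ta (T w)) * B w.
Proof. by move=> Ww; rewrite (flow_omega iB Ww) affine_omegaE. Qed.
Let dC w : W w -> partial ord0 C w = (c1 - derive1 ta (T w) - 2 * N w * f (T w)) * C w.
Proof. by move=> Ww; rewrite (flow_omega iC Ww) affine_omegaE. Qed.
Let dQ w : W w -> partial ord0 Q w = - derive1 ta (T w) * Q w - derive1 f (T w).
Proof. by move=> Ww; rewrite (flow_omega iQ Ww) affine_omegaE. Qed.
Let dN w : W w -> partial ord0 N w = 0.
Proof. by move=> Ww; rewrite (flow_omega iN Ww) affine_omegaE. Qed.

(* Mixed partials commute, so V = dT/dt0 and Ut = dU/dt0 solve the linearized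
   equations along the flow. *)
Let dV w : W w -> partial ord0 V w = derive1 ta (T w) * V w.
Proof.
move=> Ww; rewrite (partialC ord0 kt oW sT Ww).
have D := is_derive_compf (smooth_is_derive kt sT Ww) (smoothT_is_derive sta (T w)).
exact: (partialE setT (is_derive_on oW Ww (fun x Wx => esym (dT Wx)) D)).
Qed.

Let dUt w : W w -> partial ord0 Ut w =
  derive1 f (T w) * V w * U w + f (T w) * Ut w.
Proof.
move=> Ww; rewrite (partialC ord0 kt oW sU Ww).
have D := is_deriveMf (is_derive_compf (smooth_is_derive kt sT Ww)
   (smoothT_is_derive sf (T w))) (smooth_is_derive kt sU Ww).
exact: (partialE setT (is_derive_on oW Ww (fun x Wx => esym (dU Wx)) D)).
Qed.

Let at_time_line (c : R) p : at_time c p = c *: delta_mx 0 ord0 + at_time 0 p.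
Proof.
apply/rowP => k; rewrite -[k](@splitK 1 (3 + 5)); case: (fintype.split k) => i /=.
  by rewrite ord1 !mxE (@unsplitK 1 (3 + 5) (inl ord0)) !mxE /= mulr1 addr0.
by rewrite !mxE (@unsplitK 1 (3 + 5) (inr i)) /= mulr0 add0r.
Qed.

(** The parameter is written [c * s] with c in [0, 1], so that both signs of [s] are treated
    alike. *)
Let trajectory (G : 'rV[R]_(1 + (3 + 5)) -> R) p (c : R) : smooth_on W G ->
  aug_over J p -> 0 <= c <= 1 ->
  is_derive c 1 (fun c => G (at_time (c * s) p)) (s * partial ord0 G (at_time (c * s) p)).
Proof.
move=> sG Ep c01; have Wc := WE Ep c01.
have D : is_derive (s * c) 1 (fun h : R => G (h *: delta_mx 0 ord0 + at_time 0 p))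
    (partial ord0 G (at_time (c * s) p)).
  apply: (is_derive_lineE _ _ _ _ _).1; rewrite -at_time_line [s * c]mulrC.
  exact: (smooth_is_derive ord0 sG Wc).
have := is_derive_compf (is_derive_scale s c) D.
rewrite mulrC; congr is_derive; apply/funext => h.
by rewrite -at_time_line mulrC.
Qed.

Let const01 (g : R -> R) : (forall c : R, 0 <= c <= 1 -> is_derive c 1 g 0) ->
  forall c : R, 0 <= c <= 1 -> g c = g 0.
Proof.
move=> g0 c c01; apply: (derive0_const (@is_interval_segment R 0 1) g0 c01) => /=.
by rewrite lexx ler01.
Qed.

Let c01_1 : 0 <= (1 : R) <= 1. Proof. by rewrite ler01 lexx. Qed.

Let space_line (h : R) c p : h *: delta_mx 0 kt + at_time c p =
  at_time c (h *: delta_mx 0 (lshift 5 it) + p).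
Proof.
apply/rowP => k; rewrite -[k](@splitK 1 (3 + 5)); case: (fintype.split k) => i /=.
  rewrite [in RHS]row_mxEl mxE row_mxEl !mxE eqxx /=.
  by rewrite /kt eq_lrshift mulr0 add0r.
rewrite [in RHS]row_mxEr mxE row_mxEr !mxE eqxx /=.
by rewrite /kt (inj_eq (@rshift_inj _ _)).
Qed.

(** The flow at parameter 0 is the identity on an open set, so its derivative is the identity there
    as well. *)
Let initial_partial k p : aug_over J p ->
  partial kt (fun w => Phi w 0 k) (at_time 0 p) = (k == lshift 5 it)%:R.
Proof.
move=> Ep; apply: (partialE setT); apply/is_derive_line.
have oE : open [set h : R | aug_over J (h *: delta_mx 0 (lshift 5 it) + p)].
  exact: (@open_line R (3 + 5) (aug_over J) (delta_mx 0 (lshift 5 it)) p (open_aug_over oJ)).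
have E0 : [set h : R | aug_over J (h *: delta_mx 0 (lshift 5 it) + p)] 0.
  by rewrite /= scale0r add0r.
have D : is_derive (0 : R) 1 (fun h : R => (h *: delta_mx 0 (lshift 5 it) + p) 0 k) (k == lshift 5 it)%:R.
  apply: (is_derive_line (fun q : 'rV[R]_(3 + 5) => q 0 k) _ _ _).1.
  by have := is_derive_coord p (delta_mx 0 (lshift 5 it)) k; rewrite mxE.
apply: (is_derive_on oE E0 _ D) => h Eh.
by rewrite space_line Phi0.
Qed.

(** A reference point over the time t: alpha and r must be functions of t alone, so the new time and
    the multiplier of u are taken from here. The values 1 of u and B normalize their initial
    data. *)
Let ref (t : R) : 'rV[R]_(3 + 5) := row_mx (row3 t 0 1) (row5 1 1 1 1 1).

Let ref_over t : J t -> aug_over J (ref t).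
Proof.
by move=> Jt; rewrite /aug_over /aug_space /= row_mxKl row_mxKr !row3E row5E ltr01.
Qed.

Let at_c (G : 'rV[R]_(1 + (3 + 5)) -> R) p (c : R) := G (at_time (c * s) p).

(** Both sides solve t' = ta(t), up to the factor [s], with the same initial value. *)
Let T_ref p : aug_over J p -> forall c : R, 0 <= c <= 1 ->
  at_c T p c = at_c T (ref (p 0 (lshift 5 it))) c.
Proof.
move=> Ep; have Jt : J (p 0 (lshift 5 it)) by have := Ep.1; rewrite lsubmx_coord.
have Er := ref_over Jt.
apply: (@ode_unique R ta _ _ s sta).
- move=> c c01; rewrite /at_c -dT; last exact: WE.
  exact: (trajectory sT Ep c01).
- move=> c c01; rewrite /at_c -dT; last exact: WE.
  exact: (trajectory sT Er c01).
- by rewrite /at_c mul0r /T !Phi0 // /ref row_mxEl row3E.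
Qed.

Let posU p (c : R) : aug_over J p -> 0 <= c <= 1 -> 0 < at_c U p c.
Proof.
move=> Ep c01; have := (augPhi (WE Ep c01)).1; by rewrite lsubmx_coord.
Qed.

Let N_const p (c : R) : aug_over J p -> 0 <= c <= 1 -> at_c N p c = p 0 (rshift 3 iN).
Proof.
move=> Ep c01.
have D (d : R) : 0 <= d <= 1 -> is_derive d 1 (at_c N p) 0.
  move=> d01; have := trajectory (sPhi (rshift 3 iN)) Ep d01.
  by rewrite dN ?mulr0 //; exact: WE.
by rewrite (const01 D c01) /at_c mul0r /N Phi0.
Qed.

Section AtPoint.
Variable p : 'rV[R]_(3 + 5).
Hypothesis Ep : aug_over J p.
Let t := p 0 (lshift 5 it).
Let Jt : J t. Proof. by have := Ep.1; rewrite lsubmx_coord. Qed.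
Let Er := ref_over Jt.
Let v := V (at_time s (ref t)).
Let u1 := U (at_time s (ref t)).
Let ut1 := Ut (at_time s (ref t)).

Let along G (F : 'rV[R]_(1 + (3 + 5)) -> R) q (c : R) : smooth_on W G ->
  (forall w, W w -> partial ord0 G w = F w) -> aug_over J q -> 0 <= c <= 1 ->
  is_derive c 1 (at_c G q) (s * F (at_time (c * s) q)).
Proof.
move=> sG GF Eq c01; rewrite -GF; last exact: WE.
exact: trajectory.
Qed.

Let DV (c : R) : 0 <= c <= 1 -> is_derive c 1 (at_c V (ref t))
  (s * (derive1 ta (at_c T p c) * at_c V (ref t) c)).
Proof. by move=> c01; rewrite T_ref //; exact: (along (smooth_partial kt sT) dV). Qed.

Let DU (c : R) : 0 <= c <= 1 -> is_derive c 1 (at_c U (ref t))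
  (s * (f (at_c T p c) * at_c U (ref t) c)).
Proof. by move=> c01; rewrite T_ref //; exact: (along sU dU). Qed.

Let V0 : at_c V (ref t) 0 = 1.
Proof. by rewrite /at_c mul0r /V initial_partial // eqxx. Qed.

Let U0 : at_c U (ref t) 0 = 1.
Proof. by rewrite /at_c mul0r /U Phi0 // /ref row_mxEl row3E. Qed.

(** For c1 nonzero, (x~ + c2 / c1) e^(-c1 s) is conserved; for c1 = 0 it is x~ - c2 s. Since a
    listed map translates before scaling, e2 is the final displacement divided by e^(c1 s). *)
Lemma flow_x : X (at_time s p) = (p 0 (lshift 5 ix) +
  (if c1 == 0 then c2 * s else c2 / c1 * (1 - expR (- (c1 * s))))) * expR (c1 * s).
Proof.
have DX (c : R) : 0 <= c <= 1 -> is_derive c 1 (at_c X p) (s * (c1 * at_c X p c + c2)).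
  by move=> c01; exact: (along (sPhi _) dX).
have X0 : at_c X p 0 = p 0 (lshift 5 ix) by rewrite /at_c mul0r /X Phi0.
have X1 : X (at_time s p) = at_c X p 1 by rewrite /at_c mul1r.
have [c10|c10] := eqVneq c1 0.
  have D (c : R) : 0 <= c <= 1 -> is_derive c 1 (fun c => at_c X p c - (c2 * s) * c) 0.
    move=> c01; have := is_deriveBf (DX c c01) (is_derive_scale (c2 * s) c).
    by move/is_derive_eq; apply; rewrite c10; ring.
  have := const01 D c01_1; rewrite mulr0 mulr1 subr0 X0 -X1 => H.
  by rewrite -[LHS](subrK (c2 * s)) H c10 mul0r expR0 mulr1.
have D (c : R) : 0 <= c <= 1 ->
    is_derive c 1 (fun c => (at_c X p c + c2 / c1) * expR (- (c1 * s) * c)) 0.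
  move=> c01.
  have := is_deriveMf (is_derive_addr (c2 / c1) (DX c c01))
    (is_derive_expRf (is_derive_scale (- (c1 * s)) c)).
  by move/is_derive_eq; apply; rewrite /=; field.
have e0 : expR (c1 * s) != 0 by rewrite expR_eq0.
have := const01 D c01_1; rewrite mulr0 mulr1 expR0 mulr1 X0 -X1 expRN => H.
have -> : X (at_time s p) = (p 0 (lshift 5 ix) + c2 / c1) * expR (c1 * s) - c2 / c1.
  by rewrite -H divfK // addrK.
by field; rewrite c10 e0.
Qed.

(** The new u and its reference value solve the same linear equation, so their quotient is
    conserved. *)
Lemma flow_u : U (at_time s p) = p 0 (lshift 5 iu) * u1.
Proof.
have DUp (c : R) : 0 <= c <= 1 -> is_derive c 1 (at_c U p) (s * (f (at_c T p c) * at_c U p c)).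
  by move=> c01; exact: (along sU dU).
have Un (c : R) : 0 <= c <= 1 -> at_c U (ref t) c != 0 by move=> c01; rewrite gt_eqF // posU.
have D (c : R) : 0 <= c <= 1 ->
    is_derive c 1 (fun c => at_c U p c * (at_c U (ref t) c)^-1) 0.
  move=> c01; have := is_deriveMf (DUp c c01) (is_deriveVf (Un c c01) (DU c01)).
  move/is_derive_eq; apply; have := Un c c01.
  by move: (at_c U p c) (at_c U (ref t) c) (f _) => *; field.
have un : u1 != 0 by have := Un 1 c01_1; rewrite /at_c mul1r.
have Up0 : at_c U p 0 = p 0 (lshift 5 iu) by rewrite /at_c mul0r /U Phi0.
have := const01 D c01_1; rewrite U0 divr1 Up0 /at_c mul1r => <-.
by rewrite divfK.
Qed.

(** One invariant serves three elements: A, C and B are the cases where the exponent of U is n, 2 n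
    and 0, with k = c1, c1 and 3 c1. The power of U is written as an exponential of its
    logarithm. *)
Lemma flow_scaled_const (G : 'rV[R]_(1 + (3 + 5)) -> R) (k n : R) : smooth_on W G ->
  (forall c : R, 0 <= c <= 1 -> partial ord0 G (at_time (c * s) p) =
    (k - derive1 ta (at_c T p c) - n * f (at_c T p c)) * at_c G p c) ->
  forall c : R, 0 <= c <= 1 -> at_c G p c * at_c V (ref t) c *
    expR (n * ln (at_c U (ref t) c) - (k * s) * c) = G (at_time 0 p).
Proof.
move=> sG dG c c01.
have D (d : R) : 0 <= d <= 1 -> is_derive d 1 (fun c => at_c G p c * at_c V (ref t) c *
    expR (n * ln (at_c U (ref t) c) - (k * s) * c)) 0.
  move=> d01; have DG := trajectory sG Ep d01; rewrite dG // in DG.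
  have Ud := posU Er d01.
  have := is_deriveMf (is_deriveMf DG (DV d01)) (is_derive_expRf
    (is_deriveBf (is_deriveZf n (is_derive_lnf Ud (DU d01))) (is_derive_scale (k * s) d))).
  move/is_derive_eq; apply; have : at_c U (ref t) d != 0 by rewrite gt_eqF.
  move: (ln _) => l un; rewrite -/(at_c G p d).
  move: (at_c U (ref t) d) un (at_c V (ref t) d) (at_c G p d) (f _) (derive1 ta _) (expR _).
  by move=> u un *; field.
rewrite (const01 D c01) V0 U0 ln1 !mulr0 subr0 expR0 !mulr1 /at_c mul0r //.
Qed.

Let flow_scaled (G : 'rV[R]_(1 + (3 + 5)) -> R) (k n : R) : smooth_on W G ->
  (forall c : R, 0 <= c <= 1 -> partial ord0 G (at_time (c * s) p) =
    (k - derive1 ta (at_c T p c) - n * f (at_c T p c)) * at_c G p c) ->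
  G (at_time s p) * v * expR (n * ln u1 - k * s) = G (at_time 0 p).
Proof.
by move=> sG dG; have := flow_scaled_const sG dG c01_1; rewrite /at_c !mul1r mulr1.
Qed.

Lemma flow_A : A (at_time s p) * v * expR (p 0 (rshift 3 iN) * ln u1 - c1 * s) = p 0 (rshift 3 iA).
Proof.
rewrite (flow_scaled (k := c1) (n := p 0 (rshift 3 iN)) (sPhi (rshift 3 iA))); first by rewrite Phi0.
move=> c c01; rewrite dA; last exact: WE.
by rewrite -[N _]/(at_c N p c) N_const.
Qed.

Lemma flow_C : C (at_time s p) * v * expR (2 * p 0 (rshift 3 iN) * ln u1 - c1 * s) = p 0 (rshift 3 iC).
Proof.
rewrite (flow_scaled (k := c1) (n := 2 * p 0 (rshift 3 iN)) (sPhi (rshift 3 iC))); first by rewrite Phi0.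
move=> c c01; rewrite dC; last exact: WE.
by rewrite -[N _]/(at_c N p c) N_const.
Qed.

Lemma flow_B : B (at_time s p) * v * expR (- (3 * c1 * s)) = p 0 (rshift 3 iB).
Proof.
have := flow_scaled (k := 3 * c1) (n := 0) (sPhi (rshift 3 iB)).
rewrite mul0r sub0r Phi0 //; apply => c c01; rewrite dB; last exact: WE.
by rewrite mul0r subr0.
Qed.

Lemma flow_Q : Q (at_time s p) * v + ut1 / u1 = p 0 (rshift 3 iQ).
Proof.
have DQ (c : R) : 0 <= c <= 1 -> is_derive c 1 (at_c Q p)
    (s * (- derive1 ta (at_c T p c) * at_c Q p c - derive1 f (at_c T p c))).
  by move=> c01; exact: (along (sPhi _) dQ).
have DUt (c : R) : 0 <= c <= 1 -> is_derive c 1 (at_c Ut (ref t))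
    (s * (derive1 f (at_c T p c) * at_c V (ref t) c * at_c U (ref t) c
          + f (at_c T p c) * at_c Ut (ref t) c)).
  by move=> c01; rewrite T_ref //; exact: (along (smooth_partial kt sU) dUt).
have Ut0 : at_c Ut (ref t) 0 = 0.
  by rewrite /at_c mul0r /Ut initial_partial.
have Un (c : R) : 0 <= c <= 1 -> at_c U (ref t) c != 0 by move=> c01; rewrite gt_eqF // posU.
have D (c : R) : 0 <= c <= 1 -> is_derive c 1
    (fun c => at_c Q p c * at_c V (ref t) c + at_c Ut (ref t) c * (at_c U (ref t) c)^-1) 0.
  move=> c01; have := is_deriveDf (is_deriveMf (DQ c c01) (DV c01))
    (is_deriveMf (DUt c c01) (is_deriveVf (Un c c01) (DU c01))).
  move/is_derive_eq; apply; have := Un c c01.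
  rewrite -/(at_c Q p c) -/(at_c V (ref t) c) -/(at_c U (ref t) c) -/(at_c Ut (ref t) c).
  move: (at_c U (ref t) c) (at_c V (ref t) c) (at_c Q p c) (at_c Ut (ref t) c)
    (f _) (derive1 ta _) (derive1 f _).
  by move=> u V' Q' u' a b d un; field.
have Q0 : at_c Q p 0 = p 0 (rshift 3 iQ) by rewrite /at_c mul0r /Q Phi0.
by have := const01 D c01_1; rewrite V0 Ut0 mul0r addr0 mulr1 Q0 /at_c !mul1r.
Qed.

End AtPoint.

(** At the reference point the invariant of B equals 1 and contains V as a factor. So V has no zero
    along the trajectory and keeps the sign of its initial value 1. *)
Let v_gt0 t : J t -> 0 < V (at_time s (ref t)).
Proof.
move=> Jt; have Er := ref_over Jt.
have tE : ref t 0 (lshift 5 it) = t by rewrite /ref row_mxEl row3E.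
have V0 : at_c V (ref t) 0 = 1 by rewrite /at_c mul0r /V initial_partial // eqxx.
have Vn (c : R) : [set c : R | 0 <= c <= 1] c -> at_c V (ref t) c != 0.
  move=> c01; apply/eqP => Vc.
  have dBr (d : R) : 0 <= d <= 1 -> partial ord0 B (at_time (d * s) (ref t)) =
      (3 * c1 - derive1 ta (at_c T (ref t) d) - 0 * f (at_c T (ref t) d)) * at_c B (ref t) d.
    by move=> d01; rewrite dB; [rewrite mul0r subr0|exact: WE].
  have := @flow_scaled_const (ref t) Er B (3 * c1) 0 (sPhi _) dBr c c01.
  rewrite tE Vc mulr0 mul0r /B Phi0 // /ref row_mxEr row5E => /eqP.
  by rewrite eq_sym oner_eq0.
have cV (c : R) : [set c : R | 0 <= c <= 1] c -> {for c, continuous (at_c V (ref t))}.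
  move=> c01; exact: (is_derive_cvg (trajectory (smooth_partial kt sT) Er c01)).
have := nonvanishing_sign (@is_interval_segment R 0 1) cV Vn (a := 0) (b := 1).
rewrite V0 mul1r /at_c mul1r; apply => /=; by rewrite ?lexx ?ler01.
Qed.

Theorem flow_is_listed : exists (e1 e2 : R) (beta q : R -> R),
  [/\ smooth1_on J beta, smooth1_on J q, forall t, J t -> 0 < derive1 beta t &
      forall p, aug_over J p -> Phi (at_time s p) = listed e1 e2 1 beta q p].
Proof.
pose beta t := T (at_time s (ref t)).
(* Forced by the requirement that u be multiplied by e^(e1 - q) with e1 = c1 s. *)
pose q t := c1 * s - ln (U (at_time s (ref t))).
(* The reference points form a line in the direction of the initial time, so [beta] and [q] inherit
   smoothness and derivatives from restrictions of the flow to that line. *)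
have refE t : at_time s (ref t) = t *: delta_mx 0 kt + at_time s (ref 0).
  have lineE (p : 'rV[R]_(3 + 5)) k : (t *: delta_mx 0 (lshift 5 it) + p) 0 k =
      t * (k == lshift 5 it)%:R + p 0 k by rewrite !mxE.
  rewrite space_line; congr at_time; apply/rowP; apply: ord8P => i; rewrite lineE.
    rewrite /ref !row_mxEl (inj_eq (@lshift_inj _ _)).
    by move: i; apply: ord3P; rewrite !row3E /= ?mulr1 ?mulr0 ?addr0 ?add0r.
  by rewrite /ref !row_mxEr eq_rlshift mulr0 add0r.
have Wr t : J t -> W (at_time s (ref t)).
  by move=> Jt; have := WE (ref_over Jt) c01_1; rewrite mul1r.
have line G t : smooth_on W G -> J t ->
    is_derive t 1 (fun t => G (at_time s (ref t))) (partial kt G (at_time s (ref t))).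
  move=> sG Jt; have Wt : W (t *: delta_mx 0 kt + at_time s (ref 0)) by rewrite -refE; apply: Wr.
  rewrite (funext (fun t => congr1 G (refE t))) (refE t).
  exact: (line_is_derive sG Wt).
have sline G : smooth_on W G -> smooth1_on J (fun t => G (at_time s (ref t))).
  move=> sG; rewrite (funext (fun t => congr1 G (refE t))).
  apply: (smooth1_sub _ (@smooth_line R _ W G kt (at_time s (ref 0)) oW sG)) => t Jt.
  by rewrite /= -refE; apply: Wr.
have Up t : J t -> 0 < U (at_time s (ref t)).
  by move=> Jt; have := posU (ref_over Jt) c01_1; rewrite /at_c mul1r.
have db t : J t -> derive1 beta t = V (at_time s (ref t)).
  by move=> Jt; exact: (is_derive1E (line T t sT Jt)).
have dq t : J t -> derive1 q t = - (Ut (at_time s (ref t)) / U (at_time s (ref t))).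
  move=> Jt; have D := is_derive1E (is_deriveBf (is_derive_cst (c1 * s) t (1 : R))
    (@is_derive_lnf _ _ (fun t => U (at_time s (ref t))) t _ _ (Up t Jt) (line U t sU Jt))).
  by rewrite D sub0r.
exists (c1 * s), (if c1 == 0 then c2 * s else c2 / c1 * (1 - expR (- (c1 * s)))), beta, q.
split.
- exact: (sline T sT).
- have sl : smooth1_on J (fun t => ln (U (at_time s (ref t)))).
    exact: (smooth1_comp oJ (sline U sU) (@smooth1_ln R) Up).
  exact: (smooth1B oJ (@smooth1_cst R J (c1 * s)) sl).
- by move=> t Jt; rewrite db //; exact: v_gt0.
move=> p Ep.
have Jt : J (p 0 (lshift 5 it)) by have := Ep.1; rewrite lsubmx_coord.
set t := p 0 (lshift 5 it) in Jt.
have vn : V (at_time s (ref t)) != 0 by rewrite gt_eqF // v_gt0.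
have un : U (at_time s (ref t)) != 0 by rewrite gt_eqF // Up.
have Eln : ln (U (at_time s (ref t))) = c1 * s - q t by rewrite /q; ring.
have EU : U (at_time s (ref t)) = expR (c1 * s - q t) by rewrite -Eln lnK // posrE Up.
have expn (x : R) : expR x != 0 by rewrite expR_eq0.
have key (a b x v : R) : a * b = 1 -> v != 0 -> x = a / v * (x * v * b).
  move=> ab v0; have -> : a / v * (x * v * b) = (a * b) * x by field.
  by rewrite ab mul1r.
apply: aug_ext; [apply: ord3P|apply: ord5P];
  rewrite ?lsubmx_coord ?rsubmx_coord /listed ?row_mxEl ?row_mxEr ?row3E ?row5E
  ?lsubmx_coord ?rsubmx_coord -/t ?db ?dq //.
- have := T_ref Ep c01_1; by rewrite /at_c !mul1r.
- exact: flow_x.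
- by rewrite -[LHS]/(U (at_time s p)) flow_u // -/t EU mul1r mulrC.
- have := flow_A Ep; rewrite -/t Eln => <-.
  rewrite -[LHS]/(A (at_time s p)); set n := p 0 _.
  have E1 : expR (n * 1 * q t + (1 - n) * (c1 * s)) * expR (n * (c1 * s - q t) - c1 * s) = 1.
    by rewrite -expRD -[RHS]expR0; congr expR; ring.
  exact: (key _ _ _ _ E1 vn).
- have := flow_B Ep; rewrite -/t => <-.
  rewrite -[LHS]/(B (at_time s p)).
  have E1 : expR (3 * (c1 * s)) * expR (- (3 * c1 * s)) = 1.
    by rewrite -expRD -[RHS]expR0; congr expR; ring.
  exact: (key _ _ _ _ E1 vn).
- have := flow_C Ep; rewrite -/t Eln => <-.
  rewrite -[LHS]/(C (at_time s p)); set n := p 0 _.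
  have E1 : expR (2 * n * 1 * q t + (1 - 2 * n) * (c1 * s)) * expR (2 * n * (c1 * s - q t) - c1 * s) = 1.
    by rewrite -expRD -[RHS]expR0; congr expR; ring.
  exact: (key _ _ _ _ E1 vn).
- have := flow_Q Ep; rewrite -/t => <-.
  by rewrite -[LHS]/(Q (at_time s p)) mul1r addrK mulfK.
- by have := N_const Ep c01_1; rewrite /at_c mul1r.
Qed.

End FlowOfAffineGenerator.

(** * Generating the listed transformations *)

Section ExplicitFlows.
Variable R : realType.
Notation ext := 'rV[R]_(1 + (3 + 5)).
Notation e0 := (delta_mx 0 ord0 : ext).
Implicit Types (w : ext) (p : 'rV[R]_(3 + 5)).

Definition co (k : 'I_(3 + 5)) w : R := w 0 (rshift 1 k).
Notation ct := (co (lshift 5 it)).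
Notation cx := (co (lshift 5 ix)).
Notation cu := (co (lshift 5 iu)).
Notation ce i := (co (rshift 3 i)).

Lemma at_timeE (c : R) p : (at_time c p 0 ord0 = c) * (forall k, co k (at_time c p) = p 0 k).
Proof.
split=> [|k]; last by rewrite /co /at_time row_mxEr.
have E : ord0 = lshift (3 + 5) ord0 :> 'I_(1 + (3 + 5)) by apply: val_inj.
by rewrite E /at_time row_mxEl mxE.
Qed.

Lemma co_is_derive w k : is_derive w e0 (co k) 0.
Proof.
have := is_derive_coord w e0 (rshift 1 k); rewrite mxE.
by rewrite (_ : (rshift 1 k == ord0) = false) // andbF.
Qed.

Lemma time_coord_is_derive w : is_derive w e0 (fun w => w 0 ord0) 1.
Proof. by have := is_derive_coord w e0 ord0; rewrite mxE !eqxx. Qed.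

Lemma open_positive : open [set w | 0 < cu w /\ 0 < ce iN w].
Proof.
rewrite (_ : [set w | _] = (cu @^-1` [set x : R | 0 < x]) `&`
  ((ce iN) @^-1` [set x : R | 0 < x])) //.
by apply: openI; (apply: open_comp; [move=> b _; apply: continuous_coord|exact: open_gt]).
Qed.

Section TimeFlow.
Variables (h k : R -> R).
Hypotheses (sh : smooth1_on setT h) (h0 : forall t, 0 < derive1 h t).
Hypotheses (kh : forall t, k (h t) = t) (sk : smooth1_on (range h) k).
Let dh := derive1 h.
Let tau t := (dh t)^-1.
Notation Y := (affine_generator tau 0 0 (fun=> 0)).
Let hn t : dh t != 0. Proof. by rewrite gt_eqF // h0. Qed.
Let sdh : smooth1_on setT dh := smooth1_derive1 sh.
Let stau : smooth1_on setT tau.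
Proof. exact: (smooth1V openT sdh (fun t _ => hn t)). Qed.
Let oRh : open_interval (range h).
Proof. exact: (smooth1_image (conj openT (@is_intervalT R)) sh (fun t _ => hn t)). Qed.

Let phi w := k (h (ct w) + w 0 ord0).
Let ratio w := dh (phi w) * (dh (ct w))^-1.

(** The new time [phi] has t-derivative h'(t) / h'(phi), and [ratio] is its reciprocal, the factor 1
    / alpha_t of the list. *)
Definition time_flow w : 'rV[R]_(3 + 5) :=
  row_mx (row3 (phi w) (cx w) (cu w))
    (row5 (ratio w * ce iA w) (ratio w * ce iB w) (ratio w * ce iC w)
       (ratio w * ce iQ w) (ce iN w)).

Let W : set ext := [set w | (range h) (h (ct w) + w 0 ord0) /\
  (0 < cu w /\ 0 < ce iN w)].

Let s_ht U : open U -> smooth_on U (fun w => h (ct w) + w 0 ord0).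
Proof.
move=> oU; apply: (smoothD oU); last exact: (@smooth_coord R _ U ord0 oU).
by apply: (smooth_comp1 oU (@smooth_coord R _ U (rshift 1 (lshift 5 it)) oU) sh).
Qed.

Let oW : open W.
Proof.
rewrite (_ : W = ((fun w => h (ct w) + w 0 ord0) @^-1` range h) `&`
  [set w | 0 < cu w /\ 0 < ce iN w]) //.
apply: openI; last exact: open_positive.
apply: open_comp; last exact: oRh.1.
by move=> w _; exact: (smooth_continuous (s_ht openT)).
Qed.

Let h_phi w : W w -> h (phi w) = h (ct w) + w 0 ord0.
Proof. by move=> [[y _ E] _]; rewrite /phi -E kh. Qed.

Let phi_is_derive w : W w -> is_derive w e0 phi (tau (phi w)).
Proof.
move=> Ww.
have D1 := is_deriveDf (is_derive_compf (co_is_derive w (lshift 5 it)) (smoothT_is_derive sh (ct w)))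
  (time_coord_is_derive w).
have Dk : is_derive (h (ct w) + w 0 ord0) 1 k (tau (phi w)).
  rewrite -(h_phi Ww).
  exact: (inverse_is_derive openT sh (fun t _ => hn t) (fun t _ => kh t) (Logic.I : setT (phi w))).
have := is_derive_compf D1 Dk.
by rewrite mulr0 add0r mulr1.
Qed.

Let ratio_is_derive w : W w ->
  is_derive w e0 ratio (- derive1 tau (phi w) * ratio w).
Proof.
move=> Ww.
have D1 := is_derive_compf (phi_is_derive Ww) (smoothT_is_derive sdh (phi w)).
have dt : dh (ct w) != 0 := hn _.
have D2 := @is_deriveVf _ _ (fun w => dh (ct w)) w e0 _ dt
  (is_derive_compf (co_is_derive w (lshift 5 it)) (smoothT_is_derive sdh (ct w))).
have Dtau := is_derive1E (is_deriveVf (hn (phi w)) (smoothT_is_derive sdh (phi w))).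
have key (a b c d : R) : a != 0 -> c != 0 ->
    b * a^-1 * c^-1 + a * (- (d * 0) / c ^+ 2) = - (- b / a ^+ 2) * (a * c^-1).
  by move=> a0 c0; field; rewrite a0 c0.
apply: (is_derive_eq (is_deriveMf D1 D2)); rewrite Dtau.
exact: (key _ _ _ _ (hn (phi w)) dt).
Qed.

Let sphi : smooth_on W phi.
Proof. by apply: (smooth_comp1 oW (s_ht oW) sk) => w []. Qed.

Let sco k' : smooth_on W (co k'). Proof. exact: (@smooth_coord R _ W _ oW). Qed.

Let sratio : smooth_on W ratio.
Proof.
apply: (smoothM oW); first by apply: (smooth_comp1 oW sphi sdh).
by apply: (smooth_comp1 oW (sco (lshift 5 it)) stau).
Qed.

Let ratio_scaled i w : W w ->
  is_derive w e0 (fun w => ratio w * ce i w) (- derive1 tau (phi w) * (ratio w * ce i w)).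
Proof.
move=> Ww; have := is_deriveMf (ratio_is_derive Ww) (co_is_derive w (rshift 3 i)).
by move/is_derive_eq; apply; rewrite mulr0 addr0 -mulrA.
Qed.

Lemma time_local_flow (J : set R) (s : R) : (forall t, J t -> (range h) (h t + s)) ->
  local_flow Y (aug_over J) s time_flow.
Proof.
move=> Jh; exists W; split; first exact: oW.
- move=> p c Ep /andP[c0 c1]; have Jt := Ep.1; rewrite lsubmx_coord in Jt.
  rewrite /W /= !at_timeE; split; last first.
    by have := Ep.2; rewrite /aug_space /= lsubmx_coord rsubmx_coord.
  set t := p 0 _ in Jt *; have [oR iR] := oRh.
  have Rt : (range h) (h t) by exists t.
  (* The range of [h] is an interval, so a flow that reaches the parameter [s] is defined at all
     parameters in between. *)
  apply: (interval_between iR Rt (Jh t Jt)).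
  by rewrite /Num.min /Num.max; case: (ltP (h t) (h t + s)) => ?; apply/andP; split; nra.
- move=> p Ep; have E k' := (at_timeE 0 p).2 k'.
  have P0 : phi (at_time 0 p) = p 0 (lshift 5 it) by rewrite /phi !at_timeE addr0 kh.
  have R0 : ratio (at_time 0 p) = 1 by rewrite /ratio P0 E mulfV.
  apply/rowP; apply: ord8P => i; rewrite ?row_mxEl ?row_mxEr; move: i.
    by apply: ord3P; rewrite row3E ?P0 ?E.
  by apply: ord5P; rewrite row5E ?R0 ?mul1r ?E.
- apply: ord8P; [apply: ord3P|apply: ord5P].
  + by rewrite (_ : (fun w => _) = phi) //; apply/funext => w; rewrite row_mxEl row3E.
  + by rewrite (_ : (fun w => _) = cx) //; apply/funext => w; rewrite row_mxEl row3E.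
  + by rewrite (_ : (fun w => _) = cu) //; apply/funext => w; rewrite row_mxEl row3E.
  + rewrite (_ : (fun w => _) = (fun w => ratio w * ce iA w));
      first exact: (smoothM oW sratio (sco (rshift 3 iA))).
    by apply/funext => w; rewrite row_mxEr row5E.
  + rewrite (_ : (fun w => _) = (fun w => ratio w * ce iB w));
      first exact: (smoothM oW sratio (sco (rshift 3 iB))).
    by apply/funext => w; rewrite row_mxEr row5E.
  + rewrite (_ : (fun w => _) = (fun w => ratio w * ce iC w));
      first exact: (smoothM oW sratio (sco (rshift 3 iC))).
    by apply/funext => w; rewrite row_mxEr row5E.
  + rewrite (_ : (fun w => _) = (fun w => ratio w * ce iQ w));
      first exact: (smoothM oW sratio (sco (rshift 3 iQ))).
    by apply/funext => w; rewrite row_mxEr row5E.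
  + by rewrite (_ : (fun w => _) = ce iN) //; apply/funext => w; rewrite row_mxEr row5E.
move=> w Ww; split.
  by rewrite /aug_space /= row_mxKl row_mxKr row3E row5E; case: Ww.
have G : forall i (F : ext -> R) a, (forall w, time_flow w 0 i = F w) ->
    is_derive w e0 F a -> partial ord0 (fun w' => time_flow w' 0 i) w = a.
  by move=> i F a FE Fa; rewrite (funext FE); exact: (partialE setT Fa).
apply: ord8P => i; rewrite /gen_field ?row_mxEl ?row_mxEr mxE; move: i.
  apply: ord3P; rewrite affine_zetaE /time_flow row_mxKl !row3E.
  - by apply: G (phi_is_derive Ww) => v; rewrite row_mxEl row3E.
  - rewrite mul0r addr0; apply: G (co_is_derive w _) => v; by rewrite row_mxEl row3E.
  - rewrite mul0r; apply: G (co_is_derive w _) => v; by rewrite row_mxEl row3E.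
apply: ord5P; rewrite affine_omegaE /time_flow ?row_mxEl ?row_mxEr ?row3E ?row5E ?derive1_zero.
- have := ratio_scaled iA Ww; move/is_derive_eq => D.
  apply: (G _ (fun w => ratio w * ce iA w)) => [v|]; first by rewrite row_mxEr row5E.
  by apply: D; rewrite mulr0 subr0 sub0r.
- have := ratio_scaled iB Ww; move/is_derive_eq => D.
  apply: (G _ (fun w => ratio w * ce iB w)) => [v|]; first by rewrite row_mxEr row5E.
  by apply: D; rewrite mulr0 sub0r.
- have := ratio_scaled iC Ww; move/is_derive_eq => D.
  apply: (G _ (fun w => ratio w * ce iC w)) => [v|]; first by rewrite row_mxEr row5E.
  by apply: D; rewrite mulr0 subr0 sub0r.
- have := ratio_scaled iQ Ww; move/is_derive_eq => D.
  apply: (G _ (fun w => ratio w * ce iQ w)) => [v|]; first by rewrite row_mxEr row5E.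
  by apply: D; rewrite subr0.
- by apply: G (co_is_derive w _) => v; rewrite row_mxEr row5E.
Qed.

Lemma time_flow_listed (J : set R) (s : R) p : open J ->
  (forall t, J t -> (range h) (h t + s)) -> J (p 0 (lshift 5 it)) ->
  time_flow (at_time s p) = listed 0 0 1 (fun t => k (h t + s)) (fun=> 0) p.
Proof.
move=> oJ Jh; set t := p 0 _ => Jt.
have [y _ hy] := Jh t Jt.
have Dk : is_derive (h t + s) 1 k (dh y)^-1.
  rewrite -hy; exact: (inverse_is_derive openT sh (fun t _ => hn t) (fun t _ => kh t) (Logic.I : setT y)).
have dg := is_derive1E (is_derive_compf
  (is_derive_addr s (smoothT_is_derive sh t)) Dk).
have P0 : phi (at_time s p) = k (h t + s) by rewrite /phi !at_timeE.
have ky : k (h t + s) = y by rewrite -hy kh.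
have R0 : ratio (at_time s p) = (derive1 (fun t => k (h t + s)) t)^-1.
  by rewrite /ratio P0 ky at_timeE dg invfM invrK.
rewrite /time_flow /listed !lsubmx_coord !rsubmx_coord -/t R0 P0 derive1_zero !at_timeE.
rewrite !(mulr0, subr0, addr0, expR0, mulr1, mul1r).
by congr row_mx; congr row5; rewrite mulrC.
Qed.

Lemma time_generator : equivalence_generator Y.
Proof. by apply: affine_equivalence_generator; [exact: stau|exact: (@smooth1_cst R setT 0)]. Qed.

End TimeFlow.

Section ScalingFlow.
Variables (c1 c2 : R) (rho : R -> R).
Hypotheses (srho : smooth1_on setT rho) (c12 : c1 * c2 = 0).
Let f t := c1 - rho t.
Notation Y := (affine_generator (fun=> 0) c1 c2 f).
Let sf : smooth1_on setT f.
Proof. exact: (smooth1B openT (@smooth1_cst R setT c1) srho). Qed.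

Notation c w := (w 0 ord0).
(** As c1 c2 = 0, the variable x is either scaled or translated, which avoids the expression (e^(c1
    s) - 1) / c1; compositions yield the remaining affine maps. With f = c1 - rho the map at
    parameter 1 multiplies u by e^(c1 - rho). *)
Definition scaling_flow w : 'rV[R]_(3 + 5) :=
  row_mx (row3 (ct w) (expR (c1 * c w) * cx w + c2 * c w) (expR (f (ct w) * c w) * cu w))
    (row5 (expR ((c1 - ce iN w * f (ct w)) * c w) * ce iA w)
          (expR ((3 * c1) * c w) * ce iB w)
          (expR ((c1 - 2 * ce iN w * f (ct w)) * c w) * ce iC w)
          (ce iQ w - derive1 f (ct w) * c w) (ce iN w)).

Let W : set ext := [set w | 0 < cu w /\ 0 < ce iN w].
Let oW : open W := open_positive.
Let sco k' : smooth_on W (co k'). Proof. exact: (@smooth_coord R _ W _ oW). Qed.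
Let sc : smooth_on W (fun w => c w). Proof. exact: (@smooth_coord R _ W _ oW). Qed.
Let sk (a : R) : smooth_on W (fun=> a) := @smooth_cst R _ W a oW.
Let st (g : R -> R) : smooth1_on setT g -> smooth_on W (fun w => g (ct w)).
Proof. by move=> sg; apply: (smooth_comp1 oW (sco (lshift 5 it)) sg). Qed.
Let sE (G : ext -> R) k' : smooth_on W G -> smooth_on W (fun w => expR (G w * c w) * co k' w).
Proof.
move=> sG; apply: (smoothM oW _ (sco k')).
by apply: (smooth_comp1 oW (smoothM oW sG sc) (@smooth1_expR R setT)).
Qed.

Let dE (G : ext -> R) k' w : is_derive w e0 G 0 ->
  is_derive w e0 (fun w => expR (G w * c w) * co k' w) (G w * (expR (G w * c w) * co k' w)).
Proof.
move=> dG; have := is_deriveMf (is_derive_expRf (is_deriveMf dG (time_coord_is_derive w)))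
  (co_is_derive w k').
by move/is_derive_eq; apply; rewrite mul0r add0r mulr1 mulr0 addr0; ring.
Qed.

Let dt (g : R -> R) w : smooth1_on setT g -> is_derive w e0 (fun w => g (ct w)) 0.
Proof.
move=> sg; have := is_derive_compf (co_is_derive w (lshift 5 it)) (smoothT_is_derive sg (ct w)).
by rewrite mulr0.
Qed.

Let dN (a : R) w : is_derive w e0 (fun w => c1 - a * ce iN w * f (ct w)) 0.
Proof.
have := is_deriveBf (is_derive_cst c1 w e0) (is_deriveMf (is_deriveZf a
  (co_is_derive w (rshift 3 iN))) (dt w sf)).
by rewrite !mulr0 mul0r addr0 subr0.
Qed.

Let sN (a : R) : smooth_on W (fun w => c1 - a * ce iN w * f (ct w)).
Proof.
exact: (smoothB oW (sk c1) (smoothM oW (smoothM oW (sk a) (sco (rshift 3 iN))) (st sf))).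
Qed.

Lemma scaling_local_flow (J : set R) (s : R) : local_flow Y (aug_over J) s scaling_flow.
Proof.
exists W; split; first exact: oW.
- move=> p d Ep _; rewrite /W /= !at_timeE.
  by have := Ep.2; rewrite /aug_space /= lsubmx_coord rsubmx_coord.
- move=> p Ep.
  apply/rowP; apply: ord8P => i; rewrite ?row_mxEl ?row_mxEr; move: i.
    by apply: ord3P; rewrite row3E !at_timeE ?mulr0 ?expR0 ?mul1r ?addr0.
  by apply: ord5P; rewrite row5E !at_timeE ?mulr0 ?expR0 ?mul1r ?subr0.
- apply: ord8P; [apply: ord3P|apply: ord5P].
  + by rewrite (_ : (fun w => _) = ct) //; apply/funext => w; rewrite row_mxEl row3E.
  + rewrite (_ : (fun w => _) = (fun w => expR (c1 * c w) * cx w + c2 * c w)).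
      exact: (smoothD oW (sE (lshift 5 ix) (sk c1)) (smoothM oW (sk c2) sc)).
    by apply/funext => w; rewrite row_mxEl row3E.
  + rewrite (_ : (fun w => _) = (fun w => expR (f (ct w) * c w) * cu w)); first exact: (sE _ (st sf)).
    by apply/funext => w; rewrite row_mxEl row3E.
  + rewrite (_ : (fun w => _) = (fun w => expR ((c1 - 1 * ce iN w * f (ct w)) * c w) * ce iA w)).
      exact: (sE _ (sN 1)).
    by apply/funext => w; rewrite row_mxEr row5E mul1r.
  + rewrite (_ : (fun w => _) = (fun w => expR ((3 * c1) * c w) * ce iB w)); first exact: (sE _ (sk _)).
    by apply/funext => w; rewrite row_mxEr row5E.
  + rewrite (_ : (fun w => _) = (fun w => expR ((c1 - 2 * ce iN w * f (ct w)) * c w) * ce iC w)).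
      exact: (sE _ (sN 2)).
    by apply/funext => w; rewrite row_mxEr row5E.
  + rewrite (_ : (fun w => _) = (fun w => ce iQ w - derive1 f (ct w) * c w)).
      exact: (smoothB oW (sco _) (smoothM oW (st (smooth1_derive1 sf)) sc)).
    by apply/funext => w; rewrite row_mxEr row5E.
  + by rewrite (_ : (fun w => _) = ce iN) //; apply/funext => w; rewrite row_mxEr row5E.
move=> w Ww; split.
  rewrite /aug_space /= row_mxKl row_mxKr row3E row5E; case: Ww => u0 n0; split=> //.
  by rewrite mulr_gt0 // expR_gt0.
have G : forall i (F : ext -> R) a b, (forall w, scaling_flow w 0 i = F w) ->
    is_derive w e0 F a -> a = b -> partial ord0 (fun w' => scaling_flow w' 0 i) w = b.
  by move=> i F a b FE Fa <-; rewrite (funext FE); exact: (partialE setT Fa).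
apply: ord8P => i; rewrite /gen_field ?row_mxEl ?row_mxEr mxE; move: i.
  apply: ord3P; rewrite affine_zetaE /scaling_flow ?row_mxKl ?row3E.
  - by apply: G (co_is_derive w _) _ => // v; rewrite row_mxEl row3E.
  - have D := is_deriveDf (dE (lshift 5 ix) (is_derive_cst c1 w e0))
      (is_deriveZf c2 (time_coord_is_derive w)).
    apply: (G _ _ _ _ _ D) => [v|]; first by rewrite row_mxEl row3E.
    by rewrite /cst /= mulr1; congr (_ + _); rewrite mulrDr [c1 * (c2 * _)]mulrA c12 mul0r addr0.
  - by apply: (G _ _ _ _ _ (dE (lshift 5 iu) (dt w sf))) => [v|//]; rewrite row_mxEl row3E.
apply: ord5P; rewrite affine_omegaE /scaling_flow ?row_mxEl ?row_mxEr ?row3E ?row5E ?derive1_zero.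
- apply: (G _ _ _ _ _ (dE (rshift 3 iA) (dN 1 w))) => [v|]; first by rewrite row_mxEr row5E mul1r.
  by rewrite mul1r subr0.
- apply: (G _ _ _ _ _ (dE (rshift 3 iB) (is_derive_cst (3 * c1) w e0))) => [v|];
    first by rewrite row_mxEr row5E.
  by rewrite /= subr0.
- apply: (G _ _ _ _ _ (dE (rshift 3 iC) (dN 2 w))) => [v|]; first by rewrite row_mxEr row5E.
  by rewrite subr0.
- have D := is_deriveBf (co_is_derive w (rshift 3 iQ))
      (is_deriveMf (dt w (smooth1_derive1 sf)) (time_coord_is_derive w)).
  apply: (G _ _ _ _ _ D) => [v|]; first by rewrite row_mxEr row5E.
  by rewrite !(mul0r, add0r, mulr1, oppr0, sub0r).
- by apply: G (co_is_derive w _) _ => // v; rewrite row_mxEr row5E.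
Qed.

Lemma scaling_flow_listed p : scaling_flow (at_time 1 p) = listed c1 c2 1 id rho p.
Proof.
have d1 x : derive1 (@id R) x = 1 by apply: is_derive1E; apply: is_derive_id.
have df x : derive1 f x = - derive1 rho x.
  rewrite -[RHS]add0r; apply: is_derive1E.
  exact: (is_deriveBf (is_derive_cst c1 x (1 : R)) (smoothT_is_derive srho x)).
rewrite /scaling_flow /listed !lsubmx_coord !rsubmx_coord !at_timeE d1 df !mulr1 !mul1r !divr1.
congr row_mx; [congr row3|congr row5].
- rewrite mulrDl mulrC; congr (_ + _).
  have [->|c10] := eqVneq c1 0; first by rewrite expR0 mulr1.
  by move/eqP: c12; rewrite mulf_eq0 (negbTE c10) /= => /eqP ->; rewrite mul0r.
- by congr (expR _ * _); rewrite /f; ring.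
- by congr (expR _ * _); rewrite /f; ring.
- by rewrite opprK.
Qed.

Lemma scaling_generator : equivalence_generator Y.
Proof. by apply: affine_equivalence_generator; [exact: (@smooth1_cst R setT 0)|exact: sf]. Qed.

End ScalingFlow.

End ExplicitFlows.

(** * The group generated by the flows *)

Section ContinuousEquivalence.
Variables (R : realType) (I : set R).
Hypothesis oI : open_interval I.
Implicit Types (alpha r : R -> R) (T : 'rV[R]_(3 + 5) -> 'rV[R]_(3 + 5)).
Notation CE := (continuous_equivalence (aug_over I)).

Lemma ce_eq T T' : (forall p, aug_over I p -> T p = T' p) -> CE T -> CE T'.
Proof.
move=> TT' ceT; case: ceT TT' => [{}T Tid|T0 {}T Y s Phi ce0 HY fl E] TT'.
  by apply: ce_id => p Ep; rewrite -TT' // Tid.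
by apply: (ce_flow ce0 HY fl) => p Ep; rewrite -TT' // E.
Qed.

Lemma listed_comp_smooth (e1 e2 e1' e2' : R) alpha r alpha' r' p :
  smooth1_on I alpha -> smooth1_on I r -> (forall t, I t -> derive1 alpha t != 0) ->
  smooth1_on (alpha @` I) alpha' -> smooth1_on (alpha @` I) r' -> aug_over I p ->
  listed e1' e2' 1 alpha' r' (listed e1 e2 1 alpha r p) =
  listed (e1 + e1') (e2 + e2' * expR (- e1)) 1 (fun t => alpha' (alpha t))
    (fun t => r t + r' (alpha t)) p.
Proof.
move=> sa sr a0 sa' sr' [It _].
have Jt : (alpha @` I) (alpha (lsubmx p 0 it)) by exists (lsubmx p 0 it).
exact: (listed_comp e1 e2 e1' e2' (smooth1_is_derive sa It) (smooth1_is_derive sr It)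
  (smooth1_is_derive sa' Jt) (smooth1_is_derive sr' Jt) (a0 _ It)).
Qed.

(** [listed_image] identifies the set on which the next flow must be defined, and the composition
    law keeps the accumulated map in listed form. *)
Lemma ce_listed_step (e1 e2 e1' e2' s : R) alpha r alpha' r' Y Phi :
  smooth1_on I alpha -> smooth1_on I r -> (forall t, I t -> derive1 alpha t != 0) ->
  smooth1_on (alpha @` I) alpha' -> smooth1_on (alpha @` I) r' ->
  CE (listed e1 e2 1 alpha r) -> equivalence_generator Y ->
  local_flow Y (aug_over (alpha @` I)) s Phi ->
  (forall p : 'rV[R]_(3 + 5), (alpha @` I) (p 0 (lshift 5 it)) ->
     Phi (at_time s p) = listed e1' e2' 1 alpha' r' p) ->
  CE (listed (e1 + e1') (e2 + e2' * expR (- e1)) 1 (fun t => alpha' (alpha t))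
    (fun t => r t + r' (alpha t))).
Proof.
move=> sa sr a0 sa' sr' ceT HY fl E.
have fl' : local_flow Y (listed e1 e2 1 alpha r @` aug_over I) s Phi.
  by rewrite (listed_image e1 e2 oI.1 sa sr a0).
apply: (ce_flow ceT HY fl') => p Ep.
rewrite -listed_comp_smooth // E //.
by have [] := listed_aug_over e1 e2 1 alpha r Ep; rewrite lsubmx_coord.
Qed.

Lemma smooth1_comp_image alpha g : smooth1_on I alpha -> smooth1_on (alpha @` I) g ->
  smooth1_on I (fun t => g (alpha t)).
Proof.
move=> sa sg; apply: (smooth1_comp oI.1 sa sg) => t It; by exists t.
Qed.

Lemma ce_scaling (e1 e2 c1 c2 : R) alpha r rho : smooth1_on I alpha -> smooth1_on I r ->
  (forall t, I t -> derive1 alpha t != 0) -> smooth1_on setT rho -> c1 * c2 = 0 ->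
  CE (listed e1 e2 1 alpha r) ->
  CE (listed (e1 + c1) (e2 + c2 * expR (- e1)) 1 alpha (fun t => r t + rho (alpha t))).
Proof.
move=> sa sr a0 srho c12 ceT.
have sid : smooth1_on (alpha @` I) id by exact: smooth1_id.
have srho' : smooth1_on (alpha @` I) rho by apply: smooth1_sub srho.
apply: (ce_listed_step (alpha' := id) (r' := rho) sa sr a0 sid srho' ceT
  (scaling_generator c1 c2 srho) (scaling_local_flow srho c12 (alpha @` I) 1)) => p _.
exact: scaling_flow_listed.
Qed.

(** Each step of [tflows] is lifted to a [time_flow] over the times reached so far; such a flow has
    trivial scaling, translation and r, so these parameters are preserved. *)
Lemma ce_tflows (e1 e2 : R) alpha r g : smooth1_on I alpha -> smooth1_on I r ->
  (forall t, I t -> derive1 alpha t != 0) -> tflows (alpha @` I) g ->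
  CE (listed e1 e2 1 alpha r) ->
  CE (listed e1 e2 1 (fun t => g (alpha t)) r).
Proof.
move=> sa sr a0 tg ceT; have oJ := smooth1_image oI sa a0.
have comp f : tflows (alpha @` I) f -> smooth1_on I (fun t => f (alpha t)) /\
    forall t, I t -> derive1 (fun t => f (alpha t)) t != 0.
  move=> /(tflows_smooth oJ.1)[sf f0]; split; first exact: smooth1_comp_image.
  move=> t It; have Jt : (alpha @` I) (alpha t) by exists t.
  rewrite (is_derive1E (is_derive_compf (smooth1_is_derive sa It) (smooth1_is_derive sf Jt))).
  exact: (mulf_neq0 (lt0r_neq0 (f0 _ Jt)) (a0 t It)).
elim: tg => {g} [f fE|f g h s tf IH sh h0 E].
  apply: (ce_eq _ ceT) => p [It _].
  apply: (listed_near e1 e2 oI.1 It) => // t Jt; by rewrite fE //; exists t.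
have [k kh sk] := increasing_inverse sh h0.
have [sfa fa0] := comp f tf.
set fa := fun t => f (alpha t) in IH sfa fa0.
have Jh y : (fa @` I) y -> (range h) (h y + s).
  by move=> [t It <-]; exists (g (alpha t)) => //; rewrite E //; exists t.
have oK := smooth1_image oI sfa fa0.
have shs : smooth1_on (fa @` I) (fun y => h y + s).
  apply: (smooth1D oK.1); last exact: (@smooth1_cst R _ s).
  by apply: smooth1_sub sh.
have sg' : smooth1_on (fa @` I) (fun y => k (h y + s)) by exact: (smooth1_comp oK.1 shs sk Jh).
have s0 : smooth1_on (fa @` I) (fun=> 0 : R) by exact: (@smooth1_cst R _ 0).
have H := ce_listed_step (e1' := 0) (e2' := 0) sfa sr fa0 sg' s0 IH
  (time_generator sh h0) (time_local_flow sh h0 kh sk Jh)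
  (fun p Kp => time_flow_listed sh h0 kh oK.1 Jh Kp).
apply: (ce_eq _ H) => p [It _].
rewrite addr0 mul0r addr0; apply: (listed_near e1 e2 oI.1 It).
- by move=> t Jt; rewrite /fa -E ?kh //; exists t.
- by move=> t _; rewrite addr0.
- exact: (smooth1_comp_image sfa sg').
- exact: (smooth1D oI.1 sr (@smooth1_cst R I 0)).
Qed.

Theorem listed_continuous_equivalence (e1 e2 er : R) alpha r :
  smooth1_on I alpha -> smooth1_on I r -> (forall t, I t -> 0 < derive1 alpha t) ->
  CE (listed e1 e2 er alpha r).
Proof.
move=> sa sr a0; have [I0|nI0] := pselect (I !=set0); last first.
  by apply: ce_id => p [It _]; case: nI0; eexists; exact: It.
pose q t := er * r t; have sq : smooth1_on I q by exact: (@smooth1Z R I r er oI.1 sr).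
apply: (@ce_eq (listed e1 e2 1 alpha q)).
  by move=> p [It _]; rewrite -(listed_normalize _ _ _ _ sr It).
have [b [bi [Ib Rbi bK biK]]] := tequiv_setT oI I0.
have [sb b0] := tflows_smooth oI.1 Ib.
have [sbi bi0] := tflows_smooth openT Rbi.
have bn0 t : I t -> derive1 b t != 0 by move=> /b0 /gt_eqF ->.
have sid : smooth1_on I id by exact: smooth1_id.
have id1 t : I t -> derive1 (@id R) t != 0.
  by move=> _; rewrite (is_derive1E (is_derive_id t (1 : R))) oner_neq0.
have sI0 : smooth1_on I (fun=> 0 : R) by exact: (@smooth1_cst R I 0).
have sT0 : smooth1_on setT (fun=> 0 : R) by exact: (@smooth1_cst R setT 0).
have imid : id @` I = I by exact: image_id.
have S0 : CE (listed 0 0 1 id (fun=> 0)).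
  by apply: ce_id => p _; rewrite listed_id.
have S1 : CE (listed 0 0 1 b (fun=> 0)).
  by apply: (ce_tflows (g := b) sid sI0 id1 _ S0); rewrite imid.
have biI t : setT t -> I (bi t) by move=> /biK[].
have srho : smooth1_on setT (fun y => q (bi y)) by exact: (smooth1_comp openT sbi sq biI).
have S2 := ce_scaling (c1 := 0) (c2 := 0) sb sI0 bn0 srho (mulr0 0) S1.
have S2' : CE (listed 0 0 1 b q).
  apply: (ce_eq _ S2) => p [It _]; rewrite addr0 mul0r addr0.
  have Hr t : I t -> 0 + q (bi (b t)) = q t.
    by move=> Jt; rewrite add0r; have [_ ->] := bK t Jt.
  exact: (listed_near 0 0 oI.1 It (fun _ _ => erefl) Hr sb
    (smooth1D oI.1 sI0 (smooth1_comp oI.1 sb srho (fun _ _ => Logic.I)))).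
have add0 p (c d : R) : aug_over I p ->
    listed c d 1 b (fun t => q t + 0) p = listed c d 1 b q p.
  move=> [It _]; exact: (listed_near c d oI.1 It (fun _ _ => erefl)
    (fun t _ => addr0 (q t)) sb (smooth1D oI.1 sq sI0)).
(* Translation comes before scaling: while the scaling parameter is still 0, [e2] enters without a
   factor. *)
have S3 := ce_scaling (c1 := 0) (c2 := e2) sb sq bn0 sT0 (mul0r e2) S2'.
have S3' : CE (listed 0 e2 1 b q).
  by apply: (ce_eq _ S3) => p Ep; rewrite addr0 add0r oppr0 expR0 mulr1 add0.
have S4 := ce_scaling (c1 := e1) (c2 := 0) sb sq bn0 sT0 (mulr0 e1) S3'.
have S4' : CE (listed e1 e2 1 b q).
  by apply: (ce_eq _ S4) => p Ep; rewrite add0r mul0r addr0 add0.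
(* Now alpha is g after [b], where [g] is an increasing diffeomorphism of the whole line onto the
   image of alpha, and [diffeo_tflows] supplies the remaining flows. *)
pose g y := alpha (bi y).
have sg : smooth1_on setT g by exact: (smooth1_comp openT sbi sa biI).
have g0 t : setT t -> 0 < derive1 g t.
  move=> _; have It := biI t Logic.I.
  rewrite (is_derive1E (is_derive_compf (smoothT_is_derive sbi t) (smooth1_is_derive sa It))).
  by rewrite mulr_gt0 ?a0 // bi0.
have tg : tflows (b @` I) g.
  apply: (@tflows_sub R (b @` I) setT) => //.
  by apply: diffeo_tflows => //; split; [exact: openT|exact: is_intervalT].
have S5 := ce_tflows sb sq bn0 tg S4'.
have Ha t : I t -> g (b t) = alpha t.
  by move=> Jt; rewrite /g; have [_ ->] := bK t Jt.
apply: (ce_eq _ S5) => p [It _].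
exact: (listed_near e1 e2 oI.1 It Ha (fun _ _ => erefl)
  (smooth1_comp oI.1 sb sg (fun _ _ => Logic.I)) sq).
Qed.

Theorem continuous_equivalence_listed T : CE T ->
  exists (e1 e2 er : R) alpha r,
    [/\ smooth1_on I alpha, smooth1_on I r, forall t, I t -> 0 < derive1 alpha t
      & forall p, aug_over I p -> T p = listed e1 e2 er alpha r p].
Proof.
elim=> {T} [T Tid|T T' Y s Phi _ [e1 [e2 [er [alpha [r [sa sr a0 TE]]]]]] HY fl T'E].
  exists 0, 0, 1, id, (fun=> 0); split.
  - exact: smooth1_id.
  - exact: (@smooth1_cst R I 0).
  - by move=> t _; rewrite (is_derive1E (is_derive_id t (1 : R))) ltr01.
  - by move=> p Ep; rewrite listed_id Tid.
pose q t := er * r t; have sq : smooth1_on I q by exact: (@smooth1Z R I r er oI.1 sr).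
have {}TE p : aug_over I p -> T p = listed e1 e2 1 alpha q p.
  by move=> Ep; rewrite (TE p Ep); exact: (listed_normalize e1 e2 er alpha sr Ep.1).
have an0 t : I t -> derive1 alpha t != 0 by move=> /a0 /gt_eqF ->.
have oJ := smooth1_image oI sa an0.
have imT : T @` aug_over I = aug_over (alpha @` I).
  rewrite -(listed_image e1 e2 oI.1 sa sq an0); apply/seteqP; split=> _ [p Ep <-].
    by exists p => //; rewrite TE.
  by exists p => //; rewrite TE.
(* The trajectories may meet Q = 0, hence the version of the determining equations valid on the
   whole augmented space. *)
have [ta [c1 [c2 [f [sta sf GY]]]]] := determining_equations_aug HY.
move: fl; rewrite imT => -[W [oW WE Phi0 sPhi flow]].
have [e1' [e2' [beta [q' [sb sq' b0 PE]]]]] := @flow_is_listed R ta c1 c2 f sta sf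
  (alpha @` I) s Phi W oJ.1 oW WE Phi0 sPhi (fun w Ww => (flow w Ww).1)
  (fun w Ww k => etrans ((flow w Ww).2 k) (congr1 (fun v : 'rV[R]_(3 + 5) => v 0 k) (GY _ (flow w Ww).1))).
exists (e1 + e1'), (e2 + e2' * expR (- e1)), 1, (fun t => beta (alpha t)), (fun t => q t + q' (alpha t)).
split.
- exact: smooth1_comp_image.
- exact: (smooth1D oI.1 sq (smooth1_comp_image sa sq')).
- move=> t It; have Jt : (alpha @` I) (alpha t) by exists t.
  rewrite (is_derive1E (is_derive_compf (smooth1_is_derive sa It) (smooth1_is_derive sb Jt))).
  by rewrite mulr_gt0 ?a0 ?b0.
move=> p Ep; rewrite T'E // TE // PE; last exact: listed_aug_over.
exact: listed_comp_smooth.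
Qed.

Lemma time_reversalE p : time_reversal p = row_mx
  (row3 (- lsubmx p 0 it) (lsubmx p 0 ix) (lsubmx p 0 iu))
  (row5 (- rsubmx p 0 iA) (- rsubmx p 0 iB) (- rsubmx p 0 iC) (- rsubmx p 0 iQ)
     (rsubmx p 0 iN)) :> 'rV[R]_(3 + 5).
Proof.
rewrite /time_reversal /listed derive1_zero.
rewrite (is_derive1E (is_deriveNf (is_derive_id _ (1 : R)))).
by rewrite !(mulr0, subr0, addr0, expR0, mulr1, mul1r, invrN, invr1, mulN1r, mulrN).
Qed.

Lemma time_reversal_listed (e1 e2 er : R) alpha r p : smooth1_on I alpha ->
  aug_over I p -> time_reversal (listed e1 e2 er alpha r p) =
  listed e1 e2 er (fun t => - alpha t) r p.
Proof.
move=> sa [It _].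
have dNa : derive1 (fun t => - alpha t) (lsubmx p 0 it) = - derive1 alpha (lsubmx p 0 it).
  by rewrite (is_derive1E (is_deriveNf (smooth1_is_derive sa It))).
rewrite time_reversalE /listed !row_mxKl !row_mxKr !row3E !row5E dNa.
by rewrite !(invrN, mulrN, mulNr).
Qed.

Lemma time_reversalK p : time_reversal (time_reversal p) = p :> 'rV[R]_(3 + 5).
Proof.
rewrite !time_reversalE !row_mxKl !row_mxKr !row3E !row5E !opprK.
by rewrite -row3_eta -row5_eta hsubmxK.
Qed.

End ContinuousEquivalence.

Theorem theorem1 (R : realType) (I : set R) :
  open_interval I ->
  (* every listed transformation is an equivalence transformation *)
  (forall (eps1 eps2 epsr : R) (alpha r : R -> R),
     smooth1_on I alpha -> smooth1_on I r ->
     (forall t, I t -> derive1 alpha t != 0) ->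
     equivalence_transformation I (listed eps1 eps2 epsr alpha r)) /\
  (* the group generated by the one-parameter groups of Lie's criterion
     consists of the listed transformations with alpha_t > 0; together with
     the time reversal it consists of all those with alpha_t <> 0 *)
  (forall T : 'rV[R]_(3 + 5) -> 'rV[R]_(3 + 5),
     (continuous_equivalence (aug_over I) T <->
      exists (eps1 eps2 epsr : R) (alpha r : R -> R),
        [/\ smooth1_on I alpha, smooth1_on I r,
            (forall t, I t -> 0 < derive1 alpha t)
          & forall p, aug_over I p -> T p = listed eps1 eps2 epsr alpha r p]) /\
     ((continuous_equivalence (aug_over I) T \/
       continuous_equivalence (aug_over I) (@time_reversal R \o T)) <->
      exists (eps1 eps2 epsr : R) (alpha r : R -> R),
        [/\ smooth1_on I alpha, smooth1_on I r,
            (forall t, I t -> derive1 alpha t != 0)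
          & forall p, aug_over I p -> T p = listed eps1 eps2 epsr alpha r p])).
Proof.
move=> oI; split.
  by move=> e1 e2 er alpha r sa sr a0; exact: (listed_equivalence e1 e2 er oI sa sr a0).
have characterization T : continuous_equivalence (aug_over I) T <->
    exists (eps1 eps2 epsr : R) (alpha r : R -> R),
      [/\ smooth1_on I alpha, smooth1_on I r, (forall t, I t -> 0 < derive1 alpha t)
        & forall p, aug_over I p -> T p = listed eps1 eps2 epsr alpha r p].
  split; first exact: (continuous_equivalence_listed oI).
  move=> [e1 [e2 [er [alpha [r [sa sr a0 TE]]]]]].
  apply: (@ce_eq R I (listed e1 e2 er alpha r)) => [p /TE //|].
  exact: (listed_continuous_equivalence oI).
move=> T; split; first exact: characterization.
have dN alpha t : smooth1_on I alpha -> I t ->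
    derive1 (fun t => - alpha t) t = - derive1 alpha t.
  by move=> sa It; exact: (is_derive1E (is_deriveNf (smooth1_is_derive sa It))).
split.
  move=> [|] /characterization [e1 [e2 [er [alpha [r [sa sr a0 TE]]]]]].
    exists e1, e2, er, alpha, r; split; [exact: sa|exact: sr| |exact: TE].
    by move=> t It; rewrite gt_eqF ?a0.
  exists e1, e2, er, (fun t => - alpha t), r; split.
  - exact: (smooth1N oI.1 sa).
  - exact: sr.
  - by move=> t It; rewrite dN // oppr_eq0 gt_eqF ?a0.
  move=> p Ep; rewrite -[T p]time_reversalK -[time_reversal (T p)]/((@time_reversal R \o T) p).
  by rewrite TE // (time_reversal_listed _ _ _ _ sa Ep).
move=> [e1 [e2 [er [alpha [r [sa sr a0 TE]]]]]].
have cda t : I t -> {for t, continuous (derive1 alpha)}.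
  exact: (smooth1_continuous (smooth1_derive1 sa)).
(* On an interval alpha_t keeps its sign, so either the map itself or its composition with the time
   reversal has an increasing new time. *)
have sgn := nonvanishing_sign oI.2 cda a0.
have [[t0 [It0 at0]]|npos] := pselect (exists t, I t /\ 0 < derive1 alpha t).
  left; apply/characterization; exists e1, e2, er, alpha, r.
  split; [exact: sa|exact: sr|move=> t It|exact: TE].
  by rewrite -(pmulr_rgt0 _ at0) sgn.
right; apply/characterization; exists e1, e2, er, (fun t => - alpha t), r; split.
- exact: (smooth1N oI.1 sa).
- exact: sr.
- move=> t It; rewrite dN // oppr_gt0 lt_neqAle a0 //= leNgt; apply/negP => H.
  by apply: npos; exists t.
by move=> p Ep /=; rewrite TE // (time_reversal_listed _ _ _ _ sa Ep).
Qed.
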